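(* Let $\mu\ge 0$, $\kappa>\mu/2$, and let $w\in C([0,\infty))\cap C^1(0,\infty)$ be real-valued such that, for some $r_0>0$, $\delta>0$, $2w(r)=\frac{\mu}{r}+\widetilde w(r)$ with $|\widetilde w(r)|\lesssim r^{-1-\delta}$ for $r\ge r_0$. Let $f_0\in C^1([0,\infty))$, $f_1\in C^0([0,\infty))$ satisfy $$|f_0(r)|\le \langle r\rangle^{-\kappa},\qquad |f_0'(r)|+|f_1(r)|\le \langle r\rangle^{-\kappa-1}\qquad (r\ge 0),$$ and put $\varphi(r)=rf_0(r)$, $\psi(r)=rf_1(r)$. Set $\nu=\kappa-\mu/2-1$ and $\eta=(\mu/2+1)p-(\mu/2+2)$. If $p>p_S(3+\mu)$ and $p\ge p_F(\kappa)$, then there exists $\varepsilon_0>0$ such that for every $\varepsilon\in(0,\varepsilon_0]$ the integral equation $$u(t,r)=\varepsilon u_L(t,r)+\frac12\iint_{\Delta_-(t,r)}E_-(t-\sigma,r,y)\,\frac{|u(\sigma,y)|^p}{y^{p-1}}\,dy\,d\sigma\qquad (t>0,\ r>0)$$ has a unique global solution satisfying, for all $t>0$, $r>0$, $$|u(t,r)|\lesssim \varepsilon\, r\,\langle r\rangle^{-\mu/2}\times\begin{cases}\langle t+r\rangle^{-1-\nu} & (-1<\nu<0),\\ \langle t+r\rangle^{-1}\,\Psi(t-r,t+r) & (\nu=0),\\ \langle t+r\rangle^{-1}\langle t-r\rangle^{-\min\{\nu,\eta\}} & (\nu>0),\end{cases}$$ where the implied constant is independent of $\varepsilon,t,r$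.
   Context: Notation: $\langle s\rangle=\sqrt{1+s^2}$; $A\lesssim B$ means $A\le CB$ with a constant $C>0$. For $|\beta|\le\alpha$, $\Psi(\beta,\alpha)=1+\log\frac{1+\alpha}{1+|\beta|}$. For real $n>1$, $p_S(n)$ is the positive root of $\gamma_S(p,n):=2+(n+1)p-(n-1)p^2=0$, and $p_F(\kappa)=1+2/\kappa$. $W(r)=\int_0^r w(\tau)\,d\tau$ and, for $t,r\ge0$, $y\ge t-r$, $$E_-(t,r,y)=e^{-W(r)}e^{2W((y-t+r)/2)}e^{-W(y)}.$$ $$\Delta_-(t,r)=\{(\sigma,y)\in(0,\infty)\times(0,\infty):\ |t-r|<\sigma+y<t+r,\ \sigma-y<t-r\}.$$ The free solution is $$u_L(t,r)=\frac12\int_{|t-r|}^{t+r}E_-(t,r,y)\big(\psi(y)+\varphi'(y)+w(y)\varphi(y)\big)dy+\chi(r-t)E_-(t,r,r-t)\varphi(r-t),$$ with $\chi(s)=1$ for $s\ge0$ and $\chi(s)=0$ for $s<0$. A global solution is a function $u\in C([0,\infty)\times(0,\infty))$ satisfying the integral equation. (This integral equation is the integral form, for $u=rU$, of the radial Cauchy problem $(\partial_t^2+2w(r)\partial_t-\Delta+V(r))U=|U|^p$ on $\mathbb R^3$ with $V=-w'+w^2$, $U(0)=\varepsilon f_0$, $\partial_tU(0)=\varepsilon f_1$.) *)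

(* Defs.v *)
From HB Require Import structures.
From mathcomp Require Import all_boot all_order all_algebra.
From mathcomp Require Import all_classical all_reals all_analysis.
From mathcomp Require Import ring lra.

Set Implicit Arguments.
Unset Strict Implicit.
Unset Printing Implicit Defensive.

Import Order.TTheory GRing.Theory Num.Theory.
Import numFieldNormedType.Exports.

Local Open Scope classical_set_scope.
Local Open Scope ring_scope.

Definition jap (R : realType) (s : R) : R := Num.sqrt (1 + s ^+ 2).

Definition Psi (R : realType) (b a : R) : R := 1 + ln ((1 + a) / (1 + `|b|)).

Definition gammaS (R : realType) (p n : R) : R :=
  2 + (n + 1) * p - (n - 1) * p ^+ 2.

(* Meaningful for n > 1, where the positive root exists and is unique
   (see [pS_spec] and [pS_unique]). *)
Definition pS (R : realType) (n : R) : R :=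
  get [set p : R | 0 < p /\ gammaS p n = 0].

Definition pF (R : realType) (kappa : R) : R := 1 + 2 / kappa.

(* Derivative relative to A: the increments x + h stay in A, so this is the
   one-sided derivative at an endpoint of A and f^`() at interior points. *)
Definition diff_quot (R : realType) (f : R -> R) (x : R) : R -> R :=
  fun h => h^-1 * (f (x + h) - f x).

Definition within_dnbhs0 (R : realType) (A : set R) (x : R) : set_system R :=
  within [set h | A (x + h)] 0^'.

Definition derive_in (R : realType) (A : set R) (f : R -> R) (x : R) : R :=
  lim (diff_quot f x @ within_dnbhs0 A x).

Definition C0_on (R : realType) (A : set R) (f : R -> R) : Prop :=
  {within A, continuous f}.

Definition C1_on (R : realType) (A : set R) (f : R -> R) : Prop :=
  (forall x, A x -> cvg (diff_quot f x @ within_dnbhs0 A x)) /\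
  C0_on A (derive_in A f).

Definition primW (R : realType) (w : R -> R) (r : R) : R :=
  \int[@lebesgue_measure R]_(tau in `[0, r]) w tau.

Definition Eminus (R : realType) (w : R -> R) (t r y : R) : R :=
  expR (- primW w r) * expR (2 * primW w ((y - t + r) / 2)) *
  expR (- primW w y).

(* Points are z = (sigma, y). *)
Definition Delta_minus (R : realType) (t r : R) : set (R * R) :=
  [set z | [/\ 0 < z.1, 0 < z.2, `|t - r| < z.1 + z.2 < t + r
             & z.1 - z.2 < t - r]].

Definition chi (R : realType) (s : R) : R := if 0 <= s then 1 else 0.

Definition uL (R : realType) (w phi psi : R -> R) (t r : R) : R :=
  2^-1 * \int[@lebesgue_measure R]_(y in `[`|t - r|, t + r])
           (Eminus w t r y *
            (psi y + derive_in `[0, +oo[ phi y + w y * phi y))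
  + chi (r - t) * Eminus w t r (r - t) * phi (r - t).

(* The integrand is nonnegative, so its integral is always defined in \bar R;
   since the other terms are finite, the equation forces it to be finite. *)
Definition integral_equation (R : realType) (w phi psi : R -> R) (p eps : R)
    (u : R -> R -> R) (t r : R) : Prop :=
  ((u t r)%:E = (eps * uL w phi psi t r)%:E +
    (2^-1)%:E * \int[@lebesgue_measure R \x @lebesgue_measure R]_(z in
                      Delta_minus t r)
      (Eminus w (t - z.1) r z.2 *
       (`|u z.1 z.2| `^ p / z.2 `^ (p - 1)))%:E)%E.

(* Only the values of u on [0, oo) x (0, oo) are relevant. *)
Definition global_solution (R : realType) (w phi psi : R -> R) (p eps : R)
    (u : R -> R -> R) : Prop :=
  {within `[0, +oo[ `*` `]0, +oo[, continuous (fun z : R * R => u z.1 z.2)} /\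
  (forall t r, 0 < t -> 0 < r -> integral_equation w phi psi p eps u t r).

Definition decay (R : realType) (nu eta t r : R) : R :=
  if nu < 0 then jap (t + r) `^ (- 1 - nu)
  else if nu == 0 then (jap (t + r))^-1 * Psi (t - r) (t + r)
  else (jap (t + r))^-1 * jap (t - r) `^ (- Num.min nu eta).

Definition decay_bound (R : realType) (mu nu eta eps C : R)
    (u : R -> R -> R) : Prop :=
  forall t r, 0 < t -> 0 < r ->
    `|u t r| <= C * (eps * r * jap r `^ (- (mu / 2)) * decay nu eta t r).

Lemma gammaS_pos_root (R : realType) (n : R) : 1 < n ->
  exists p : R, 0 < p /\ gammaS p n = 0.
Proof.
move=> n1; have n10 : 0 < n - 1 by rewrite subr_gt0.
have n0 : 0 < n + 1 by rewrite addr_gt0// (lt_trans ltr01 n1).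
pose s := Num.sqrt ((n + 1) ^+ 2 + 8 * (n - 1)).
have s2 : s ^+ 2 = (n + 1) ^+ 2 + 8 * (n - 1).
  by rewrite sqr_sqrtr// addr_ge0 ?sqr_ge0// mulr_ge0// ltW.
exists ((n + 1 + s) / (2 * (n - 1))); split.
  by rewrite divr_gt0 ?mulr_gt0// ltr_wpDr ?sqrtr_ge0.
have nz : n - 1 != 0 by rewrite gt_eqF.
rewrite /gammaS; have -> : 2 + (n + 1) * ((n + 1 + s) / (2 * (n - 1))) -
  (n - 1) * ((n + 1 + s) / (2 * (n - 1))) ^+ 2 =
  ((n + 1) ^+ 2 + 8 * (n - 1) - s ^+ 2) / (4 * (n - 1)) by field.
by rewrite s2 subrr mul0r.
Qed.

Lemma pS_spec (R : realType) (n : R) : 1 < n ->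
  0 < pS n /\ gammaS (pS n) n = 0.
Proof.
by move=> n1; have [p hp] := gammaS_pos_root n1; exact: (@getPex _ [set q | 0 < q /\ gammaS q n = 0] (ex_intro _ p hp)).
Qed.

Lemma pS_unique (R : realType) (n p : R) : 1 < n ->
  0 < p -> gammaS p n = 0 -> p = pS n.
Proof.
move=> n1 p0 gp; have [q0 gq] := pS_spec n1.
set q := pS n in q0 gq *; apply/eqP; rewrite -subr_eq0; apply/eqP.
have : (p - q) * (2 + (n - 1) * (p * q)) = 0.
  have -> : (p - q) * (2 + (n - 1) * (p * q)) =
            p * gammaS q n - q * gammaS p n by rewrite /gammaS; ring.
  by rewrite gp gq !mulr0 subrr.
move/eqP; rewrite mulf_eq0 => /orP[/eqP //|].
by rewrite gt_eqF// addr_gt0// mulr_gt0 ?subr_gt0// mulr_gt0.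
Qed.

(* Main.v *)
Require Import Defs.
From HB Require Import structures.
From mathcomp Require Import all_boot all_order all_algebra.
From mathcomp Require Import all_classical all_reals all_analysis.
From mathcomp Require Import measurable_realfun.
From mathcomp Require Import ring lra.
Import Order.TTheory GRing.Theory Num.Theory.
Import numFieldNormedType.Exports.
Local Open Scope classical_set_scope.
Local Open Scope ring_scope.
Set Implicit Arguments.
Unset Strict Implicit.
Unset Printing Implicit Defensive.

(* On the backward region E_- is bounded by a constant times <r>^(-mu/2) <y>^(mu/2),
   since W(r) - (mu/2) log(1+r) stays bounded.  In the characteristic variable
   alpha = sigma + y the Duhamel integral of weight^p then splits into two integrals in
   one variable.  The inner one is O((1+alpha)^(-1-rho)), with rho = nu if nu <= 0 and
   rho = min(nu, eta) otherwise; this is where p eta > 1 (that is, p > p_S(3+mu)) and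
   nu p + eta >= nu + 1 (that is, p >= p_F(kappa)) enter.  The outer one, over
   |t-r| < alpha < t+r, is O(r decay), and it also controls the free solution.  Hence
   Picard iteration contracts in the weighted supremum norm when eps is small.  The
   Duhamel integral of a merely measurable source is locally Lipschitz, because the
   symmetric difference of two backward regions lies in thin strips; so pointwise limits
   of the iterates suffice.  The constant of a competing solution need not be small:
   uniqueness follows by advancing in short time slabs on t + r <= T. *)

(** * Lebesgue measure in the plane *)

Section planar_measure.
Context {R : realType}.
Notation leb := (@lebesgue_measure R).

(** Origin of the exponents. The kernel contributes (1+y)^(mu/2); the p-th power of the weight,
    divided by y^(p-1), contributes y <y>^(-mu p/2) besides the decay factor. Hence the inner
    integral carries the power mu/2 + 1 - mu p/2 = p - 1 - eta of 1+y, which is where eta comes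
    from. In the same way the kernel turns data of size y^(-kappa) into y^(mu/2-kappa) = y^(-1-nu).
    With these exponents 1 - p eta is half of gamma_S(p, 3+mu), and nu p + eta - nu - 1 equals (p-1)
    kappa - 2. The three cases of the claimed bound reflect the primitive of (1+alpha)^(-1-rho): its
    value at the upper end dominates for rho < 0, its value at the lower end for rho > 0, and rho =
    0 gives the logarithm Psi. The inner integral meets logarithms too, at critical exponents where
    the claim has none to offer; the strict inequality p eta > 1 leaves the room that absorbs them,
    while equality p = p_F(kappa) remains admissible. *)

Lemma ge0_integral_translation (f : R -> \bar R) (c : R) :
  measurable_fun setT f -> (forall x, (0 <= f x)%E) ->
  (\int[leb]_x f (x + c)%R = \int[leb]_x f x)%E.
Proof.
move=> mf f0.
have mc : measurable_fun setT (fun x : R => x + c) by exact: measurable_funD.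
pose push : {measure set (measurableTypeR R) -> \bar R} :=
  pushforward leb (fun x : measurableTypeR R => (x + c : measurableTypeR R)).
have E (A : set (measurableTypeR R)) : measurable A -> push mc A = leb A.
  move=> mA; apply/esym; apply: lebesgue_measure_unique mA => X [[a b]] _ <-.
  rewrite /push /pushforward /=.
  rewrite [RHS](_ : _ = leb [set` `](a - c), (b - c)]]); last first.
    congr (leb _); apply/seteqP; split => x /=; rewrite !in_itv/=.
      by move=> /andP[? ?]; apply/andP; split; lra.
    by move=> /andP[? ?]; apply/andP; split; lra.
  by rewrite /= !lebesgue_measure_itv/= !lte_fin ltrD2r; case: ifP => // _;
     rewrite -!EFinB; congr EFin; lra.
transitivity (\int[push mc]_x f x)%E; last first.
  by apply: eq_measure_integral => A mA _; exact: E.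
pose T := measurableTypeR R.
have mc' : measurable_fun [set: T] (fun x : T => x + c : T) := mc.
have mf' : measurable_fun [set: T] (f : T -> \bar R) := mf.
have := @ge0_integral_pushforward _ _ T T R _ mc' leb setT f measurableT mf'
  (fun y _ => f0 y).
by rewrite preimage_setT => <-.
Qed.

(** Passage to the characteristic variable x = sigma + y. After Tonelli each slice of constant y is
    moved by the translation x -> x - y, so the one-dimensional invariance is enough. *)
Lemma ge0_integral_shear (f : R * R -> \bar R) :
  measurable_fun setT f -> (forall z, (0 <= f z)%E) ->
  (\int[leb \x leb]_z f z = \int[leb]_x \int[leb]_y f (x - y, y)%R)%E.
Proof.
move=> mf f0; rewrite (@fubini_tonelli2 _ _ _ _ R leb leb f mf f0).
pose g (z : R * R) := f (z.1 - z.2, z.2).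
have mg : measurable_fun setT g.
  apply: (measurableT_comp mf); apply: measurable_fun_pair => //=.
  exact: measurable_funB.
rewrite -[RHS]/(\int[leb]_x \int[leb]_y g (x, y))%E (@fubini_tonelli _ _ _ _ R leb leb g mg (fun z => f0 _)).
apply: eq_integral => y _; rewrite /fubini_G /g/=.
rewrite -(@ge0_integral_translation (fun x => f (x, y)) (- y))//.
exact: measurableT_comp.
Qed.

(** The plane carries the product sigma-algebra, so openness has to be reduced to rectangles: A is
    the union of the countably many boxes with rational corners that it contains. *)
Lemma open_measurable_prod (A : set (R * R)) : open A -> measurable A.
Proof.
move=> oA.
pose D := [set q : (rat * rat) * (rat * rat) |
  `]ratr q.1.1, ratr q.1.2[%classic `*` `]ratr q.2.1, ratr q.2.2[%classic `<=` A].
have -> : A = \bigcup_(q in D)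
    (`]ratr q.1.1, ratr q.1.2[%classic `*` `]ratr q.2.1, ratr q.2.2[%classic).
  apply/seteqP; split => [[x y] Axy|z [q]]; last by move=> h /h.
  have := oA; rewrite openE => /(_ _ Axy) /=; rewrite /interior.
  move=> [[U V] /= [/nbhs_ballP[e1 /= e10 U1] /nbhs_ballP[e2 /= e20 V1]] UV].
  have ex (c e : R) : 0 < e -> exists q : rat * rat,
      `]ratr q.1, ratr q.2[%classic c /\ `]ratr q.1, ratr q.2[ `<=` ball c e.
    move=> e0.
    have [q1 hq1] := @rat_in_itvoo R (c - e) c ltac:(lra).
    have [q2 hq2] := @rat_in_itvoo R c (c + e) ltac:(lra).
    move: hq1 hq2; rewrite !in_itv/= => /andP[a1 a2] /andP[b1 b2].
    exists (q1, q2); split => /=; first by rewrite in_itv/= a2 b1.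
    move=> z /=; rewrite in_itv/= => /andP[c1 c2].
    by rewrite /ball/= ltr_distlC; apply/andP; split; lra.
  have [q1 [xq1 q1e]] := ex x _ e10; have [q2 [yq2 q2e]] := ex y _ e20.
  exists (q1, q2) => //= -[x' y'] [/= hx hy]; apply: UV; split => /=.
    exact/U1/q1e.
  exact/V1/q2e.
rewrite bigcup_mkcond; apply: countable_bigcupT_measurable => [|q].
  exact: countableP.
by case: ifPn => // _; exact: measurableX.
Qed.

Lemma open_continuous_measurable_fun_prod (Q : set (R * R)) (f : R * R -> R) :
  open Q -> {in Q, continuous f} -> measurable_fun Q f.
Proof.
move=> oQ cf mQ; apply: (measurability _ (RGenOpens.measurableE R)) => //.
move=> _ [_ [a [b ->]] <-].
apply: open_measurable_prod.
rewrite openE => z [Qz faz]; rewrite /interior.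
have := cf z; rewrite inE => /(_ Qz) cz.
near=> y; split; near: y.
  exact: open_nbhs_nbhs.
by apply: cz; apply: open_nbhs_nbhs; split => //; exact: interval_open.
Unshelve. all: by end_near. Qed.

End planar_measure.

(** * Powers of 1 + x *)

Section power_calculus.
Context {R : realType}.
Notation leb := (@lebesgue_measure R).
Implicit Types a b c s x y : R.

Lemma gt0_powRD x s1 s2 : 0 < x -> x `^ (s1 + s2) = x `^ s1 * x `^ s2.
Proof. by move=> x0; rewrite powRD// (gt_eqF x0) implybT. Qed.

Lemma le0_ger_powR s x y : s <= 0 -> 0 < x -> x <= y -> y `^ s <= x `^ s.
Proof.
move=> s0 x0 xy; rewrite -[s]opprK powRN [leRHS]powRN lef_pV2 ?posrE.
- by rewrite ge0_ler_powR// ?nnegrE; lra.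
- by apply: powR_gt0; lra.
- exact: powR_gt0.
Qed.

(** Exchanges comparable bases whatever the sign of the exponent. For s < 0 the factor c is taken
    out by writing y as c^-1 (c y), after which monotonicity applies to x <= c y. *)
Lemma powR_comparable c s x y : 1 <= c -> 0 < x -> x <= c * y -> y <= c * x ->
  y `^ s <= c `^ `|s| * x `^ s.
Proof.
move=> c1 x0 xcy ycx; have [s0|s0] := leP 0 s.
  rewrite ger0_norm// -powRM; [|lra|lra].
  by apply: ge0_ler_powR => //; rewrite nnegrE; nra.
have y0 : 0 < y by nra.
rewrite ltr0_norm//.
have -> : y = c^-1 * (c * y) by rewrite mulKf//; lra.
have ci : 0 < c^-1 by rewrite invr_gt0; lra.
have cy : 0 < c * y by apply: mulr_gt0; lra.
rewrite powRM ?(ltW ci) ?(ltW cy)//.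
rewrite -[in X in X * _]powR_inv1 -?powRrM ?mulN1r; last lra.
by rewrite ler_wpM2l ?powR_ge0//; apply: le0_ger_powR => //; exact: ltW.
Qed.

Lemma powR_le1 s x : 1 <= x -> s <= 0 -> x `^ s <= 1.
Proof.
by move=> x1 s0; rewrite -[leRHS](congr1 (fun g => g s) (@powR1 R)); apply: le0_ger_powR.
Qed.

Lemma is_derive_powR_comp (f : R -> R) s x df : 0 < f x ->
  is_derive x 1 f df -> is_derive x 1 (fun y => f y `^ s) (s * f x `^ (s - 1) * df).
Proof.
move=> fx0 dfx.
have fin : f x \in `]0, +oo[ by rewrite in_itv/= fx0.
have d : is_derive (f x) 1 ((@powR R)^~ s) (s * f x `^ (s - 1)).
  split; first exact: derivable_powR.
  by rewrite -derive1E powR_derive1.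
exact: (@is_derive1_comp _ ((@powR R)^~ s) f).
Qed.

Lemma is_derive_mulr (k : R) (f : R -> R) x df :
  is_derive x 1 f df -> is_derive x 1 (fun y => f y * k) (df * k).
Proof.
move=> h; rewrite (_ : (fun y => _) = k *: f); last first.
  by apply/funext => y; rewrite /GRing.scale/= mulrC.
by rewrite mulrC; exact: is_deriveZ.
Qed.

Lemma is_derive_continuous (f : R -> R) x df :
  is_derive x 1 f df -> {for x, continuous f}.
Proof.
by move=> [+ _] => /derivable1_diffP/differentiable_continuous.
Qed.

(** * Explicit integrals of powers of 1 + x *)

Lemma integral_is_derive (f F : R -> R) a b : a <= b ->
  (forall x, a <= x <= b -> is_derive x 1 F (f x)) ->
  (forall x, a <= x <= b -> {for x, continuous f}) ->
  (\int[leb]_(x in `[a, b]) (f x)%:E = (F b - F a)%:E)%E.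
Proof.
rewrite le_eqVlt => /predU1P[<- _ _|ab dF cf].
  by rewrite set_itv1 integral_set1 subrr.
rewrite (@continuous_FTC2 _ f F)//.
- apply: continuous_in_subspaceT => x; rewrite inE/= in_itv/=; exact: cf.
- split => [x||].
  + by rewrite in_itv/= => /andP[/ltW ax /ltW xb]; have [] := dF x; rewrite ?ax ?xb.
  + apply: cvg_at_right_filter; apply: is_derive_continuous; apply: dF; lra.
  + apply: cvg_at_left_filter; apply: is_derive_continuous; apply: dF; lra.
- move=> x; rewrite in_itv/= => /andP[ax xb].
  by rewrite derive1E; apply/derive_val/dF; rewrite !ltW.
Qed.

Lemma integral_powR1p s a b : s != 0 -> -1 < a -> a <= b ->
  (\int[leb]_(x in `[a, b]) ((1 + x) `^ (s - 1))%:E =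
   (((1 + b) `^ s - (1 + a) `^ s) / s)%:E)%E.
Proof.
move=> s0 a1 ab.
have d x t : -1 < x -> is_derive x 1 (fun y => (1 + y) `^ t) (t * (1 + x) `^ (t - 1)).
  move=> x1; rewrite -[X in is_derive _ _ _ X]mulr1.
  apply: (@is_derive_powR_comp (fun y => 1 + y)); first lra.
  by rewrite -[X in is_derive _ _ _ X]add0r; exact: is_deriveD.
have D x : a <= x <= b -> is_derive x 1 (fun y => (1 + y) `^ s / s) ((1 + x) `^ (s - 1)).
  move=> xab; have := d x s ltac:(lra).
  by move=> /(is_derive_mulr s^-1); rewrite mulrAC mulfV// mul1r.
rewrite (integral_is_derive ab D) ?mulrBl// => x xab.
by apply: is_derive_continuous; apply: d; lra.
Qed.

Lemma integral_inv1p a b : -1 < a -> a <= b ->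
  (\int[leb]_(x in `[a, b]) ((1 + x) `^ (-1))%:E = (ln ((1 + b) / (1 + a)))%:E)%E.
Proof.
move=> a1 ab; rewrite ln_div ?posrE; [|lra|lra].
have D x : a <= x <= b -> is_derive x 1 (fun y => ln (1 + y)) ((1 + x) `^ (-1)).
  move=> xab; rewrite powR_inv1; last lra.
  rewrite -[X in is_derive _ _ _ X]mulr1.
  apply: (@is_derive1_comp _ (@ln R) (fun y => 1 + y)).
    by apply: is_derive1_ln; lra.
  by rewrite -[X in is_derive _ _ _ X]add0r; exact: is_deriveD.
rewrite (integral_is_derive ab D)// => x xab.
by apply: is_derive_continuous; apply: (@is_derive_powR_comp (fun y => 1 + y)); lra.
Qed.

Lemma measurable_fun_powR d (T : measurableType d) (D : set T) (f : T -> R) (s : R) :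
  measurable_fun D f -> measurable_fun D (fun z => f z `^ s).
Proof. by move=> mf; exact: (measurableT_comp (measurable_powR s)). Qed.

(** On the line sigma + y = al the difference sigma - y is al - 2y, so this is the integral of a
    power of 1 + |sigma - y| along a characteristic. It is split at y = al/2, where the absolute
    value vanishes. *)
Lemma integral_powR1p_abs (s al : R) : s != 0 -> 0 <= al ->
  (\int[leb]_(y in `[0%R, al]) ((1 + `|al - 2 * y|) `^ (s - 1))%:E =
   (((1 + al) `^ s - 1) / s)%:E)%E.
Proof.
move=> s0 al0.
have mf (D : set R) : measurable_fun D (fun y => ((1 + `|al - 2 * y|) `^ (s - 1))%:E).
  apply/measurable_EFinP; apply: measurable_fun_powR.
  apply: measurable_funD => //; apply: measurableT_comp => //.
  by apply: measurable_funB => //; apply: measurable_funM.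
have -> : `[0, al]%classic = `[0, al / 2[%classic `|` `[al / 2, al]%classic :> set R.
  by rewrite -itv_bndbnd_setU// bnd_simp; lra.
rewrite ge0_integral_setU//=; last 2 first.
  exact: mf.
  apply/disj_set2P; rewrite -subset0 => z/=; rewrite !in_itv/=; lra.
rewrite integral_itv_bndo_bndc//.
have dlin c x : is_derive x 1 (fun y : R => 1 + c * (al - 2 * y)) (c * -2).
  have h1 : is_derive x 1 (fun y : R => al - 2 * y) (-2).
    rewrite -[X in is_derive _ _ _ X]add0r; apply: is_deriveB.
    by apply: is_derive_eq; rewrite /GRing.scale/= mulr1.
  rewrite -[X in is_derive _ _ _ X]add0r; apply: is_deriveD.
(* Here c is the sign of al - 2y on the half interval. The primitive acquires the factor (-2c)^-1,
   so the two halves contribute equally. *)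
have half c a b : c ^+ 2 = 1 -> a <= b ->
    (forall x, a <= x <= b -> `|al - 2 * x| = c * (al - 2 * x)) ->
  (\int[leb]_(y in `[a, b]) ((1 + `|al - 2 * y|) `^ (s - 1))%:E =
   (((1 + c * (al - 2 * b)) `^ s - (1 + c * (al - 2 * a)) `^ s) / (- 2 * c * s))%:E)%E.
  move=> c2 ab habs.
  have c0 : c != 0 by apply/eqP => c0; move: c2; rewrite c0; lra.
  transitivity (\int[leb]_(y in `[a, b]) ((1 + c * (al - 2 * y)) `^ (s - 1))%:E)%E.
    by apply: eq_integral => x; rewrite inE/= in_itv/= => /habs ->.
  have dd x t : a <= x <= b -> is_derive x 1 (fun y => (1 + c * (al - 2 * y)) `^ t)
      (t * (1 + c * (al - 2 * x)) `^ (t - 1) * (c * -2)).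
    move=> xab; apply: (@is_derive_powR_comp (fun y => 1 + c * (al - 2 * y))) => //.
    by rewrite -habs// (lt_le_trans ltr01)// lerDl.
  have D x : a <= x <= b -> is_derive x 1
      (fun y => (1 + c * (al - 2 * y)) `^ s / (- 2 * c * s))
      ((1 + c * (al - 2 * x)) `^ (s - 1)).
    move=> xab; have := dd x s xab.
    move=> /(is_derive_mulr (- 2 * c * s)^-1).
    by rewrite (_ : _ / _ = (1 + c * (al - 2 * x)) `^ (s - 1))//; field; rewrite s0 c0.
  rewrite (integral_is_derive ab D) ?mulrBl//.
  by move=> x xab; apply: is_derive_continuous; exact: dd.
rewrite (half 1) ?expr1n//; [|lra|]; last first.
  by move=> x xab; rewrite mul1r ger0_norm//; lra.
rewrite (half (-1)) ?sqrrN ?expr1n//; [|lra|]; last first.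
  by move=> x xab; rewrite mulN1r ler0_norm//; lra.
rewrite -EFinD; congr EFin.
rewrite (_ : 1 + 1 * (al - 2 * (al / 2)) = 1); last lra.
rewrite (_ : 1 + -1 * (al - 2 * (al / 2)) = 1); last lra.
rewrite (_ : 1 + 1 * (al - 2 * 0) = 1 + al); last lra.
rewrite (_ : 1 + -1 * (al - 2 * al) = 1 + al); last lra.
by rewrite powR1; field.
Qed.

End power_calculus.

(** * The decay factor *)

Section decay_estimates.
Context {R : realType}.
Notation leb := (@lebesgue_measure R).
Implicit Types (s t r nu eta p : R).

(** * Comparison of the bracket <s> with 1 + |s| *)

Lemma jap_ge1 s : 1 <= jap s.
Proof. by rewrite -[leLHS]sqrtr1 /jap ler_wsqrtr// lerDl sqr_ge0. Qed.

Lemma jap_gt0 s : 0 < jap s.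
Proof. exact: lt_le_trans ltr01 (jap_ge1 s). Qed.

Lemma jap_le s : jap s <= 1 + `|s|.
Proof.
rewrite -[leRHS]ger0_norm ?addr_ge0// -sqrtr_sqr /jap ler_wsqrtr//.
by rewrite -real_normK ?num_real//; have := normr_ge0 s; nra.
Qed.

Lemma jap_ge s : 1 + `|s| <= 2 * jap s.
Proof.
have h : `|s| <= jap s by rewrite -sqrtr_sqr /jap ler_wsqrtr// lerDr.
by have := jap_ge1 s; lra.
Qed.

Lemma le_jap s t : `|s| <= `|t| -> jap s <= jap t.
Proof. by move=> st; rewrite /jap ler_wsqrtr// lerD2l -real_normK ?num_real// -[leRHS]real_normK ?num_real// lerXn2r ?nnegrE. Qed.

Lemma jap_powR_le e s : jap s `^ e <= 2 `^ `|e| * (1 + `|s|) `^ e.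
Proof.
have := jap_le s; have := jap_ge s; have := normr_ge0 s => h1 h2 h3.
by apply: powR_comparable; lra.
Qed.

Lemma jap_powR_ge e s : (1 + `|s|) `^ e <= 2 `^ `|e| * jap s `^ e.
Proof.
have := jap_le s; have := jap_ge s; have := jap_ge1 s => h1 h2 h3.
by apply: powR_comparable; lra.
Qed.

(** The rate rho such that [decay] dominates a multiple of (1+t+r)^(-1-rho). At nu = 0 it is 0: the
    factor Psi >= 1 is simply given up. *)
Definition decay_rate nu eta := if nu <= 0 then nu else Num.min nu eta.

Lemma Psi_ge1 t r : 0 <= t -> 0 <= r -> 1 <= Psi (t - r) (t + r).
Proof.
move=> t0 r0; rewrite /Psi lerDl ln_ge0// ler_pdivlMr ?mul1r ?lerD2l.
  by rewrite ler_norml; apply/andP; split; lra.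
by have := normr_ge0 (t - r); lra.
Qed.

Lemma abs_sub_le_add t r : 0 <= t -> 0 <= r -> `|t - r| <= t + r.
Proof. by move=> *; rewrite ler_norml; apply/andP; split; lra. Qed.

(** Since |t-r| <= t+r, a negative power of <t-r> dominates the same power of <t+r>, and Psi >= 1
    settles nu = 0. The bound is also the source of the nonnegativity of [decay]. *)
Lemma decay_ge nu eta : 0 < eta ->
  exists2 C : R, 0 < C & forall t r, 0 <= t -> 0 <= r ->
  (1 + (t + r)) `^ (- 1 - decay_rate nu eta) <= C * decay nu eta t r.
Proof.
move=> eta0; exists (2 `^ `|- 1 - decay_rate nu eta|); first exact: powR_gt0.
move=> t r t0 r0.
have tr : `|t + r| = t + r by rewrite ger0_norm// addr_ge0.
apply: (@le_trans _ _ (2 `^ `|- 1 - decay_rate nu eta| *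
    jap (t + r) `^ (- 1 - decay_rate nu eta))).
  by rewrite -{1}tr jap_powR_ge.
rewrite ler_wpM2l ?powR_ge0// /decay /decay_rate.
case: ltgtP => [nu0|nu0|->] //.
- rewrite gt0_powRD ?jap_gt0// powR_inv1 ?(ltW (jap_gt0 _))//.
  rewrite ler_wpM2l ?invr_ge0 ?(ltW (jap_gt0 _))//.
  apply: le0_ger_powR; [|exact: jap_gt0|].
    by rewrite oppr_le0 le_min ltW//= ltW.
  by apply: le_jap; rewrite tr abs_sub_le_add.
- rewrite subr0 powR_inv1 ?(ltW (jap_gt0 _))//.
  by rewrite ler_peMr ?invr_ge0 ?(ltW (jap_gt0 _))// Psi_ge1.
Qed.

Lemma ln_le_powR s (x : R) : 0 < s -> 0 < x -> ln x <= x `^ s / s.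
Proof.
move=> s0 x0; rewrite ler_pdivlMr// mulrC -ln_powR.
have /le_ln1Dx : -1 < x `^ s - 1 by have := powR_gt0 s x0; lra.
by rewrite addrC subrK; lra.
Qed.

Lemma decay_le_neg nu eta : nu < 0 -> exists2 C : R, 0 < C & forall t r, 0 <= t -> 0 <= r ->
  decay nu eta t r <= C * (1 + (t + r)) `^ (- (1 + nu)).
Proof.
move=> nu0; exists (2 `^ `|- 1 - nu|); first exact: powR_gt0.
move=> t r t0 r0; rewrite /decay nu0 opprD.
by apply: (le_trans (jap_powR_le _ _)); rewrite (ger0_norm (addr_ge0 t0 r0)).
Qed.

(** Trades the logarithm for a small power: 1 + ln q <= (1 + 1/s) q^s for q = (1+t+r)/(1+|t-r|) >=
    1. The first exponent loses s and the second gains it, so their sum stays 1. *)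
Lemma decay_le_zero eta s : 0 < s -> exists2 C : R, 0 < C & forall t r, 0 <= t -> 0 <= r ->
  decay 0 eta t r <= C * ((1 + (t + r)) `^ (- (1 - s)) * (1 + `|t - r|) `^ (- s)).
Proof.
move=> s0; exists (2 * (1 + s^-1)); first by rewrite mulr_gt0// addr_gt0// invr_gt0.
move=> t r t0 r0; rewrite /decay ltxx eqxx.
have a0 : 0 < 1 + (t + r) by lra.
have b0 : 0 < 1 + `|t - r| by have := normr_ge0 (t - r); lra.
have hj : (jap (t + r))^-1 <= 2 * (1 + (t + r)) `^ (-1).
  rewrite (powR_inv1 (ltW a0)) -[leLHS]mul1r ler_pdivrMr ?jap_gt0//.
  rewrite -mulrA [X in _ <= 2 * X]mulrC mulrA ler_pdivlMr// mul1r.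
  by have := jap_ge (t + r); rewrite ger0_norm//; lra.
have hP : Psi (t - r) (t + r) <= (1 + s^-1) *
    ((1 + (t + r)) `^ s * (1 + `|t - r|) `^ (- s)).
  set q := (1 + (t + r)) / (1 + `|t - r|).
  have q1 : 1 <= q.
    by rewrite /q ler_pdivlMr// mul1r lerD2l abs_sub_le_add.
  rewrite powRN -(powR_inv1 (powR_ge0 _ _)) -powRrM mulrN1 -mulN1r powRrM.
  rewrite powR_inv1 ?(ltW b0)// -powRM ?(ltW a0) ?invr_ge0 ?(ltW b0)// -/q /Psi -/q mulrDl mul1r lerD//.
    by rewrite -[leLHS](congr1 (fun g => g s) (@powR1 R)) ge0_ler_powR ?nnegrE//; lra.
  by rewrite mulrC ln_le_powR//; lra.
apply: (le_trans (ler_pM _ _ hj hP)).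
- by rewrite invr_ge0 ltW// jap_gt0.
- by apply: le_trans (Psi_ge1 t0 r0).
rewrite (_ : - (1 - s) = -1 + s); last lra.
by rewrite gt0_powRD// le_eqVlt; apply/orP; left; apply/eqP; ring.
Qed.

Lemma decay_le_pos nu eta : 0 < nu -> exists2 C : R, 0 < C & forall t r, 0 <= t -> 0 <= r ->
  decay nu eta t r <= C * ((1 + (t + r)) `^ (- 1) * (1 + `|t - r|) `^ (- Num.min nu eta)).
Proof.
move=> nu0; exists (2 `^ `|-1| * 2 `^ `|- Num.min nu eta|); first by rewrite mulr_gt0 ?powR_gt0.
move=> t r t0 r0; rewrite /decay (ltNge nu) (ltW nu0)/= gt_eqF//.
rewrite -[(jap _)^-1]powR_inv1 ?(ltW (jap_gt0 _))//.
rewrite mulrACA; apply: ler_pM; rewrite ?powR_ge0//.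
  by rewrite (le_trans (jap_powR_le _ _))// (ger0_norm (addr_ge0 t0 r0)).
exact: jap_powR_le.
Qed.

(** This integral is what gives [decay] its shape. Far from the cone the integrand is comparable to
    its value at t+r, and the interval has length at most 2r, which supplies the factor r. When r is
    comparable to 1+t+r the primitive is evaluated exactly, and the factor r / <t+r> that has to
    appear is bounded below. *)
Lemma light_cone_integral nu eta : 0 < eta -> exists2 C : R, 0 < C & forall t r, 0 <= t -> 0 < r ->
  (\int[leb]_(x in `[`|t - r|%R, (t + r)%R]) ((1 + x) `^ (- 1 - decay_rate nu eta))%:E
   <= (C * (r * decay nu eta t r))%:E)%E.
Proof.
move=> eta0; have [C0 C00 hC0] := decay_ge nu eta0.
set e := decay_rate nu eta in hC0 *.
(* either [r] is comparable to [1 + t + r], or the interval of integration lies at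
   distance comparable to [1 + t + r] *)
have far t r : 0 <= t -> 0 < r -> 1 + (t + r) <= 3 * (1 + `|t - r|) ->
  (\int[leb]_(x in `[`|t - r|%R, (t + r)%R]) ((1 + x) `^ (- 1 - e))%:E
   <= (2 * 3 `^ `|- 1 - e| * C0 * (r * decay nu eta t r))%:E)%E.
  move=> t0 r0 h.
  have n0 := normr_ge0 (t - r); have h1 := abs_sub_le_add t0 (ltW r0).
  set K := 3 `^ `|- 1 - e| * (1 + (t + r)) `^ (- 1 - e).
  have K0 : 0 <= K by rewrite mulr_ge0 ?powR_ge0.
  apply: (@le_trans _ _ (\int[leb]_(x in `[`|t - r|%R, (t + r)%R]) (cst K%:E x))%E).
    apply: ge0_le_integral => //.
    - by move=> x _; rewrite lee_fin powR_ge0.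
    - apply/measurable_EFinP; apply: measurable_fun_powR; exact: measurable_funD.
    - move=> x /=; rewrite in_itv/= => /andP[a b]; rewrite lee_fin.
      by apply: powR_comparable; lra.
  rewrite integral_cst//= lebesgue_measure_itv/=.
  have hl : t + r - `|t - r| <= 2 * r.
    by have := ler_norm (t - r); lra.
  case: ifP => _; last first.
    rewrite mule0 lee_fin !mulr_ge0 ?powR_ge0//; [exact: ltW|exact: ltW|].
    have /(le_trans (powR_ge0 _ _)) := hC0 t r t0 (ltW r0).
    by rewrite pmulr_rge0.
  rewrite -EFinD -EFinM lee_fin.
  apply: (@le_trans _ _ (K * (2 * r))); first by rewrite ler_wpM2l.
  rewrite /K (_ : _ * _ * (2 * r) = 2 * 3 `^ `|- 1 - e| * ((1 + (t + r)) `^ (- 1 - e) * r)); last ring.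
  rewrite -[leRHS]mulrA ler_wpM2l ?mulr_ge0 ?powR_ge0//.
  rewrite [r * _]mulrC mulrA; apply: ler_wpM2r; first exact: ltW.
  by apply: hC0 => //; exact: ltW.
have close : exists2 C1 : R, 0 < C1 & forall t r, 0 <= t -> 0 < r -> 1 + (t + r) <= 6 * r ->
  (\int[leb]_(x in `[`|t - r|%R, (t + r)%R]) ((1 + x) `^ (- 1 - e))%:E
   <= (C1 * (r * decay nu eta t r))%:E)%E.
  have base t r : 0 <= t -> 0 < r -> 1 + (t + r) <= 6 * r -> [/\ -1 < `|t - r|,
     `|t - r| <= t + r, 0 < 1 + (t + r), 1 <= 6 * (r * (1 + (t + r))^-1)
     & 0 < 1 + `|t - r|].
    move=> t0 r0 h; have := normr_ge0 (t - r) => n0; split; try lra.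
    - exact: abs_sub_le_add t0 (ltW r0).
    - by rewrite mulrA ler_pdivlMr; lra.
  have hj t r : 0 <= t -> 0 < r -> 1 + (t + r) <= 6 * r -> 1 <= 6 * (r * (jap (t + r))^-1).
    move=> t0 r0 /(base t r t0 r0)[_ _ a1 h _]; apply: (le_trans h).
    rewrite ler_pM2l// ler_pM2l// lef_pV2 ?posrE ?jap_gt0//.
    by apply: le_trans (jap_le _) _; rewrite ger0_norm//; lra.
  clear far hC0; rewrite /e /decay_rate; case: (ltgtP nu 0) => [nu0|nu0|nu0].
  - exists (6 / (- nu) * 2 `^ `|- 1 - nu|); first by rewrite mulr_gt0 ?powR_gt0// divr_gt0//; lra.
    move=> t r t0 r0 h; have [h1 h2 h3 h4 h5] := base t r t0 r0 h.
    rewrite (_ : - 1 - nu = - nu - 1); last lra.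
    rewrite integral_powR1p//; last lra.
    rewrite lee_fin /decay nu0.
    apply: (@le_trans _ _ ((1 + (t + r)) `^ (- nu) / (- nu))).
      by rewrite ler_pM2r ?invr_gt0 ?oppr_gt0// gerBl powR_ge0.
    have := jap_powR_ge (- 1 - nu) (t + r); rewrite ger0_norm; last lra.
    have -> : (1 + (t + r)) `^ (- nu) = (1 + (t + r)) * (1 + (t + r)) `^ (- 1 - nu).
      by rewrite -[in X in X * _](@powRr1 _ (1 + (t + r))) ?(ltW h3)// -gt0_powRD//; congr powR; lra.
    rewrite (_ : - nu - 1 = - 1 - nu); last lra.
    set P := (1 + _) `^ _; set Q := jap _ `^ _; set c := 2 `^ _ => PQ.
    have P0 : 0 <= P := powR_ge0 _ _.
    have nuV : 0 < (- nu)^-1 by rewrite invr_gt0; lra.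
    apply: (@le_trans _ _ (6 * r * (c * Q) / (- nu))).
      rewrite ler_pM2r//; apply: ler_pM => //; lra.
    by rewrite le_eqVlt; apply/orP; left; apply/eqP; ring.
  - set m := Num.min nu eta.
    have m0 : 0 < m by rewrite lt_min nu0 eta0.
    exists (6 / m); first by rewrite divr_gt0.
    move=> t r t0 r0 h; have [h1 h2 h3 h4 h5] := base t r t0 r0 h.
    rewrite (_ : - 1 - m = - m - 1); last lra.
    rewrite integral_powR1p//; last lra.
    rewrite lee_fin /decay (ltNge nu) (ltW nu0)/= gt_eqF// -/m.
    rewrite invrN mulrN -mulNr opprB.
    have h7 : (1 + `|t - r|) `^ (- m) <= jap (t - r) `^ (- m).
      by apply: le0_ger_powR; [lra|exact: jap_gt0|exact: jap_le].
    have := hj t r t0 r0 h; set J := r / _ => hJ.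
    rewrite mulrA -/J; move: h7; set P := (1 + _) `^ _; set Q := jap _ `^ _ => PQ.
    apply: (@le_trans _ _ (Q / m)).
      rewrite ler_pM2r ?invr_gt0//; have := powR_ge0 (1 + (t + r)) (- m); lra.
    have Q0 : 0 <= Q := powR_ge0 _ _.
    have : Q * 1 <= Q * (6 * J) by rewrite ler_wpM2l.
    rewrite mulr1 -(ler_pM2r (_ : 0 < m^-1)) ?invr_gt0// => /le_trans; apply.
    by rewrite le_eqVlt; apply/orP; left; apply/eqP; rewrite /J; ring.
  - exists 6 => // t r t0 r0 h; have [h1 h2 h3 h4 h5] := base t r t0 r0 h.
    rewrite nu0 subr0 integral_inv1p// lee_fin /decay ltxx eqxx.
    have hJ := hj t r t0 r0 h; have P1 := Psi_ge1 t0 (ltW r0).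
    apply: (@le_trans _ _ (Psi (t - r) (t + r))); first by rewrite [leRHS]/Psi lerDr.
    rewrite (_ : 6 * _ = 6 * (r / jap (t + r)) * Psi (t - r) (t + r)); last by ring.
    by rewrite ler_peMl//; lra.
have [C1 C10 hC1] := close.
exists (2 * 3 `^ `|- 1 - e| * C0 + C1).
  by rewrite addr_gt0// !mulr_gt0// powR_gt0.
move=> t r t0 r0.
have d0 : 0 <= r * decay nu eta t r.
  apply: mulr_ge0; first exact: ltW.
  have /(le_trans (powR_ge0 _ _)) := hC0 t r t0 (ltW r0).
  by rewrite pmulr_rge0.
have [h|h] := leP (1 + (t + r)) (3 * (1 + `|t - r|)).
  apply: (le_trans (far t r t0 r0 h)); rewrite lee_fin ler_wpM2r// lerDl ltW//.
apply: (le_trans (hC1 t r t0 r0 _)).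
  (* On either side of t = r, the inequality 3 (1+|t-r|) < 1+t+r forces 1+t+r <= 6r. *)
  have [tr|tr] := leP t r.
    by move: h; rewrite ler0_norm; lra.
  by move: h; rewrite gtr0_norm; lra.
by rewrite lee_fin ler_wpM2r// lerDr !mulr_ge0 ?powR_ge0// ltW.
Qed.

Lemma measurable_fun_decay d (T : measurableType d) (D : set T) nu eta (f g : T -> R) :
  measurable_fun D f -> measurable_fun D g ->
  measurable_fun D (fun z => decay nu eta (f z) (g z)).
Proof.
move=> mf mg.
have mjap (h : T -> R) : measurable_fun D h -> measurable_fun D (fun z => jap (h z)).
  move=> mh; rewrite (_ : (fun z => _) = fun z => (1 + h z ^+ 2) `^ 2^-1).
    by apply: measurable_fun_powR; apply: measurable_funD => //; exact: measurable_funX.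
  by apply/funext => z; rewrite powR12_sqrt// addr_ge0 ?sqr_ge0.
have mD : measurable_fun D (f \+ g) by exact: measurable_funD.
have mB : measurable_fun D (f \- g) by exact: measurable_funB.
have mjapV (h : T -> R) : measurable_fun D h -> measurable_fun D (fun z => (jap (h z))^-1).
  move=> mh; rewrite (_ : (fun z => _) = fun z => jap (h z) `^ (-1)).
    by apply: measurable_fun_powR; exact: mjap.
  by apply/funext => z; rewrite powR_inv1// ltW// jap_gt0.
rewrite /decay; case: (nu < 0); first by apply: measurable_fun_powR; exact: mjap.
case: (nu == 0); last first.
  by apply: measurable_funM; [exact: mjapV|apply: measurable_fun_powR; exact: mjap].
apply: measurable_funM; first exact: mjapV.
apply: measurable_funD => //; apply: (measurableT_comp (@measurable_ln R)).
apply: measurable_funM; first exact: measurable_funD.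
rewrite (_ : (fun z => _) = fun z => (1 + `|f z - g z|) `^ (-1)).
  apply: measurable_fun_powR; apply: measurable_funD => //.
  exact: measurableT_comp.
by apply/funext => z; rewrite powR_inv1// addr_ge0.
Qed.

End decay_estimates.

(** * The inner integral *)

Section interior_integral.
Context {R : realType}.
Notation leb := (@lebesgue_measure R).
Implicit Types (s t r nu eta p th B : R).

(** Split at y = al/4. Above it 1+y is comparable to 1+al and only the power of 1+|al-2y| is
    integrated; below it 1+|al-2y| is comparable to 1+al and only the power of 1+y is integrated.
    The weakened exponents B' <= B and th' >= th keep the two primitives free of logarithms: B' !=
    1, and th' > -1 makes the second one grow like (1+al)^(th'+1). *)
Lemma interior_powR_integral th th' B B' :
  th <= th' -> -1 < th' -> 0 <= B' -> B' <= B -> B' != 1 ->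
  exists2 C : R, 0 < C & forall al : R, 0 <= al ->
  (\int[leb]_(y in `[0%R, al]) ((1 + y) `^ th * (1 + `|al - 2 * y|) `^ (- B))%:E
   <= (C * ((1 + al) `^ (th + Num.max (1 - B') 0) + (1 + al) `^ (th' + 1 - B)))%:E)%E.
Proof.
move=> thth' th1 B'0 B'B B'1.
set s := 1 - B'; have s0 : s != 0 by rewrite subr_eq0 eq_sym.
set c1 := 4 `^ `|th| : R; set c2 := 2 `^ `|- B| : R.
have c10 : 0 < c1 by exact: powR_gt0.
have c20 : 0 < c2 by exact: powR_gt0.
have q0 : 0 < th' + 1 by lra.
have as0 : 0 < `|s| by rewrite normr_gt0.
exists (c1 / `|s| + c2 / (th' + 1)); first by rewrite addr_gt0// divr_gt0.
move=> al al0.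
have a1 : 0 < 1 + al by lra.
have mabs (D : set R) e : measurable_fun D (fun y : R => (1 + `|al - 2 * y|) `^ e).
  apply: measurable_fun_powR.
  apply: measurable_funD => //; apply: measurableT_comp => //.
  by apply: measurable_funB => //; apply: measurable_funM.
have mpow (D : set R) e : measurable_fun D (fun y : R => (1 + y) `^ e).
  by apply: measurable_fun_powR; exact: measurable_funD.
pose g1 (y : R) := c1 * (1 + al) `^ th * (1 + `|al - 2 * y|) `^ (s - 1).
pose g2 (y : R) := c2 * (1 + al) `^ (- B) * (1 + y) `^ (th' + 1 - 1).
have k1 : 0 <= c1 * (1 + al) `^ th by rewrite mulr_ge0 ?powR_ge0// ltW.
have k2 : 0 <= c2 * (1 + al) `^ (- B) by rewrite mulr_ge0 ?powR_ge0// ltW.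
have g10 y : 0 <= g1 y by rewrite mulr_ge0 ?powR_ge0.
have g20 y : 0 <= g2 y by rewrite mulr_ge0 ?powR_ge0.
have mg1 (D : set R) : measurable_fun D (EFin \o g1).
  by apply/measurable_EFinP; apply: measurable_funM => //; exact: mabs.
have mg2 (D : set R) : measurable_fun D (EFin \o g2).
  by apply/measurable_EFinP; apply: measurable_funM => //; exact: mpow.
apply: (@le_trans _ _ (\int[leb]_(y in `[0%R, al]) ((g1 y)%:E + (g2 y)%:E))%E).
  apply: ge0_le_integral => //.
  - by move=> y _; rewrite lee_fin mulr_ge0 ?powR_ge0.
  - by apply/measurable_EFinP; apply: measurable_funM; [exact: mpow|exact: mabs].
  - by apply: emeasurable_funD; [exact: mg1|exact: mg2].
  move=> y /=; rewrite in_itv/= => /andP[y0 yal]; rewrite -EFinD lee_fin.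
  have n0 := normr_ge0 (al - 2 * y).
  have [hy|hy] := leP al (4 * y).
    apply: (@le_trans _ _ (g1 y)); last by rewrite lerDl.
    apply: ler_pM; rewrite ?powR_ge0//.
      by apply: powR_comparable; lra.
    by rewrite (_ : s - 1 = - B'); [apply: ler_powR; lra|rewrite /s; lra].
  apply: (@le_trans _ _ (g2 y)); last by rewrite lerDr.
  rewrite /g2 [leLHS]mulrC; apply: ler_pM; rewrite ?powR_ge0//.
    by apply: powR_comparable => //; rewrite ?ger0_norm; lra.
  by apply: ler_powR; lra.
rewrite ge0_integralD//;
  try solve [exact: mg1|exact: mg2|by move=> y _; rewrite lee_fin].
under eq_integral do rewrite /g1 EFinM.
under [X in (_ + X)%E]eq_integral do rewrite /g2 EFinM.
rewrite ge0_integralZl_EFin//; try solve [by move=> y _; rewrite lee_fin powR_ge0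
  |by apply/measurable_EFinP; exact: mabs].
rewrite ge0_integralZl_EFin//; try solve [by move=> y _; rewrite lee_fin powR_ge0
  |by apply/measurable_EFinP; exact: mpow].
have -> := integral_powR1p_abs s0 al0.
have q1 : th' + 1 != 0 by rewrite gt_eqF.
have -> := integral_powR1p q1 (ltrN10 R) al0.
rewrite -!EFinM -EFinD lee_fin.
have p1 e : 0 < (1 + al) `^ e by exact: powR_gt0.
have i1 : c1 * (1 + al) `^ th * (((1 + al) `^ s - 1) / s) <=
    c1 / `|s| * (1 + al) `^ (th + Num.max s 0).
  rewrite gt0_powRD// (_ : _ / _ * _ = c1 * (1 + al) `^ th *
    ((1 + al) `^ Num.max s 0 / `|s|)); last by ring.
  rewrite ler_wpM2l//.
  have [sp|sn] := ltP 0 s.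
    rewrite gtr0_norm// ler_pM2r ?invr_gt0//.
    by rewrite gerBl.
  have {}sn : s < 0 by rewrite lt_neqAle s0.
  rewrite ltr0_norm// powRr0 -mulrNN -invrN opprB.
  rewrite ler_pM2r ?invr_gt0 ?oppr_gt0// gerBl.
  exact: ltW.
have i2 : c2 * (1 + al) `^ (- B) * (((1 + al) `^ (th' + 1) - (1 + 0) `^ (th' + 1)) / (th' + 1)) <=
    c2 / (th' + 1) * (1 + al) `^ (th' + 1 - B).
  rewrite [(1 + al) `^ (th' + 1 - B)]gt0_powRD// (_ : c2 / _ * _ = c2 * (1 + al) `^ (- B) *
    ((1 + al) `^ (th' + 1) / (th' + 1))); last by ring.
  by rewrite ler_wpM2l// ler_pM2r ?invr_gt0// gerBl powR_ge0.
have j1 : 0 <= c1 / `|s| * (1 + al) `^ (th' + 1 - B).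
  by rewrite mulr_ge0 ?powR_ge0// divr_ge0// ltW.
have j2 : 0 <= c2 / (th' + 1) * (1 + al) `^ (th + Num.max s 0).
  by rewrite mulr_ge0 ?powR_ge0// divr_ge0// ltW.
rewrite mulrDl 2!mulrDr; lra.
Qed.

(* The exponents are those for which [interior_powR_integral] yields the rate
   [(1 + al) ^ (- 1 - decay_rate nu eta)]; [B'] differs from [B] only when [B = 1],
   where a logarithm would otherwise appear. *)
Lemma decay_powR_le nu eta p : 1 < p -> -1 < nu -> 0 < eta -> 1 < p * eta ->
  nu + 1 <= nu * p + eta ->
  let th := p - 1 - eta in let rho := decay_rate nu eta in
  let th' := Num.max th ((p - 1) * (1 + rho) - 1) in
  exists A B B' C : R, [/\ 0 < C, [/\ 0 <= B', B' <= B & B' != 1],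
    th + Num.max (1 - B') 0 - A <= - 1 - rho, th' + 1 - B - A <= - 1 - rho &
    forall t r, 0 <= t -> 0 <= r ->
      decay nu eta t r `^ p <= C * ((1 + (t + r)) `^ (- A) * (1 + `|t - r|) `^ (- B))].
Proof.
move=> p1 nu1 eta0 peta hnu th rho th'.
have key A0 B0 : (exists2 C : R, 0 < C & forall t r, 0 <= t -> 0 <= r ->
    decay nu eta t r <= C * ((1 + (t + r)) `^ (- A0) * (1 + `|t - r|) `^ (- B0))) ->
    exists2 C : R, 0 < C & forall t r, 0 <= t -> 0 <= r ->
    decay nu eta t r `^ p <= C * ((1 + (t + r)) `^ (- (p * A0)) * (1 + `|t - r|) `^ (- (p * B0))).
  move=> [C C0 hC]; exists (C `^ p) => [|t r t0 r0]; first exact: powR_gt0.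
  have d0 : 0 <= decay nu eta t r.
    have [C' C'0 /(_ t r t0 r0)] := decay_ge nu eta0.
    by move/(le_trans (powR_ge0 _ _)); rewrite pmulr_rge0.
  have -> : - (p * A0) = - A0 * p by ring.
  have -> : - (p * B0) = - B0 * p by ring.
  rewrite !powRrM -!powRM ?mulr_ge0 ?powR_ge0 ?(ltW C0)//.
  apply: ge0_ler_powR; rewrite ?nnegrE ?mulr_ge0 ?powR_ge0 ?(ltW C0)//; first lra.
  exact: hC.
have pm1 : 0 < p - 1 by lra.
(* In each of the three cases below A + B = p (1 + rho), so the second entry of [th'] is the largest
   exponent that the target rate permits. *)
have cond A B B' : 0 <= B' -> B' <= B -> B' != 1 ->
    th + Num.max (1 - B') 0 - A <= - 1 - rho ->
    th + 1 - B - A <= - 1 - rho -> (p - 1) * (1 + rho) - B - A <= - 1 - rho ->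
    [/\ 0 <= B', B' <= B & B' != 1] /\
    [/\ th + Num.max (1 - B') 0 - A <= - 1 - rho & th' + 1 - B - A <= - 1 - rho].
  move=> h1 h2 h3 h4 h5 h6; split => //; split => //.
  by rewrite /th' maxEle; case: ifP => _; lra.
case: (ltgtP nu 0) => [nu0|nu0|nu0].
(* For nu < 0 the decay depends on t+r alone, so B = 0, and the conditions involving th come down to
   nu p + eta >= nu + 1. *)
- have rhoE : rho = nu by rewrite /rho /decay_rate (ltW nu0).
  have [] := key (1 + nu) 0.
    have [C C0 hC] := decay_le_neg eta nu0; exists C => // t r t0 r0.
    by rewrite oppr0 powRr0 mulr1; exact: hC.
  move=> C C0 hC; exists (p * (1 + nu)), (p * 0), 0, C.
  have [] := cond (p * (1 + nu)) (p * 0) 0.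
  + by [].
  + by rewrite mulr0.
  + by rewrite eq_sym oner_eq0.
  + rewrite rhoE /th subr0 (max_idPl ler01); lra.
  + rewrite rhoE /th; lra.
  + rewrite rhoE /th; lra.
  by move=> h1 [h2 h3]; split.
- pose m := Num.min nu eta.
  have rhoE : rho = m by rewrite /rho /decay_rate leNgt nu0.
  have m0 : 0 < m by rewrite lt_min nu0.
  have mnu : m <= nu by rewrite ge_min lexx.
  have meta : m <= eta by rewrite ge_min lexx orbT.
  have mE : m < eta -> m = nu by rewrite /m minEle; case: ifP => // _; rewrite ltxx.
  have [C C0 hC] := key 1 m (decay_le_pos eta nu0).
  have [] : exists B', [/\ 0 <= B', B' <= p * m, B' != 1 &
      Num.max (1 - B') 0 <= eta - m].
    (* If p m <= 1, then p eta > 1 gives m < eta, hence m = nu. For p m < 1 the requirement 1 - p nu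
       <= eta - nu is then the hypothesis [hnu]; for p m > 1 it is m <= eta; at p m = 1 the positive
       gap eta - m pays for lowering B' below 1 by tau. *)
    have [pm|pm|pm] := ltgtP (p * m) 1.
    + have mlt : m < eta by nra.
      exists (p * m); split => //; [nra|lra|].
      rewrite (max_idPl _); last lra.
      have := mE mlt; nra.
    + exists (p * m); split => //; [nra|lra|].
      by rewrite (max_idPr _); lra.
    + have mlt : m < eta by nra.
      pose tau := Num.min (eta - m) 1.
      have tau0 : 0 < tau by rewrite lt_min; apply/andP; split; lra.
      have tau1 : tau <= 1 by rewrite ge_min lexx orbT.
      have tau2 : tau <= eta - m by rewrite ge_min lexx.
      exists (1 - tau); split; try lra.
      by rewrite (max_idPl _); lra.
  move=> B' [b1 b2 b3 b4]; exists (p * 1), (p * m), B', C.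
  have [] := cond (p * 1) (p * m) B' b1 b2 b3.
  + rewrite rhoE /th; lra.
  + rewrite rhoE /th.
    have [pm|pm] := leP 1 (p * m); first lra.
    have mlt : m < eta by nra.
    by have := mE mlt; nra.
  + rewrite rhoE; nra.
  by move=> h1 [h2 h3]; split.
- have rhoE : rho = 0 by rewrite /rho /decay_rate nu0 lexx.
  (* This makes B = p s = 1/2, away from the critical value 1; s cancels from the sum of the
     exponents, and what remains to check is eta >= 1. *)
  pose s := (2 * p)^-1.
  have s0 : 0 < s by rewrite invr_gt0; lra.
  have ps : p * s = 2^-1 by rewrite /s; field; lra.
  have [C C0 hC] : exists2 C : R, 0 < C & forall t r, 0 <= t -> 0 <= r ->
    decay nu eta t r `^ p <= C * ((1 + (t + r)) `^ (- (p * (1 - s))) * (1 + `|t - r|) `^ (- (p * s))).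
    by apply: key; rewrite nu0; exact: decay_le_zero.
  exists (p * (1 - s)), (p * s), (p * s), C.
  have [] := cond (p * (1 - s)) (p * s) (p * s).
  + rewrite ps; lra.
  + exact: lexx.
  + rewrite ps; lra.
  + rewrite rhoE /th ps (max_idPl _); move: hnu; rewrite nu0; lra.
  + rewrite rhoE /th; move: hnu; rewrite nu0; lra.
  + rewrite rhoE; lra.
  by move=> h1 [h2 h3]; split.
Qed.

(** Along sigma + y = al the sum of the arguments of [decay] is constant, so its power leaves the
    integral and only 1+y and 1+|al-2y| remain. The two terms of the previous estimate are both
    brought to the rate of the outer integrand. *)
Lemma interior_decay_integral nu eta p : 1 < p -> -1 < nu -> 0 < eta -> 1 < p * eta ->
  nu + 1 <= nu * p + eta ->
  exists2 C : R, 0 < C & forall al : R, 0 <= al ->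
  (\int[leb]_(y in `[0%R, al]) ((1 + y) `^ (p - 1 - eta) * decay nu eta (al - y) y `^ p)%:E
   <= (C * (1 + al) `^ (- 1 - decay_rate nu eta))%:E)%E.
Proof.
move=> p1 nu1 eta0 peta hnu.
have := decay_powR_le p1 nu1 eta0 peta hnu; cbv zeta.
set th := p - 1 - eta; set rho := decay_rate nu eta; set th' := Num.max th _.
move=> [A [B [B' [C1 [C10 [b1 b2 b3] h1 h2 hC1]]]]].
have thth' : th <= th' by rewrite /th' le_max lexx.
have rho1 : -1 < rho.
  by rewrite /rho /decay_rate; case: ifP => // _; rewrite lt_min nu1; lra.
have th'1 : -1 < th' by rewrite /th' lt_max; apply/orP; right; nra.
have [C2 C20 hC2] := interior_powR_integral thth' th'1 b1 b2 b3.
exists (C1 * (2 * C2)) => [|al al0]; first by rewrite !mulr_gt0.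
have k0 : 0 <= C1 * (1 + al) `^ (- A) by rewrite mulr_ge0 ?powR_ge0// ltW.
have msum : measurable_fun `[0, al] (fun y : R => (1 + y) `^ th).
  by apply: measurable_fun_powR; exact: measurable_funD.
have mint : measurable_fun `[0, al]
    (fun y : R => ((1 + y) `^ th * (1 + `|al - 2 * y|) `^ (- B))%:E).
  apply/measurable_EFinP; apply: measurable_funM => //.
  apply: measurable_fun_powR.
  apply: measurable_funD => //; apply: measurableT_comp => //.
  by apply: measurable_funB => //; apply: measurable_funM.
apply: (@le_trans _ _ (\int[leb]_(y in `[0%R, al]) ((C1 * (1 + al) `^ (- A))%:E *
   ((1 + y) `^ th * (1 + `|al - 2 * y|) `^ (- B))%:E))%E).
  apply: ge0_le_integral => //.
  - by move=> y _; rewrite lee_fin mulr_ge0 ?powR_ge0.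
  - apply/measurable_EFinP; apply: measurable_funM => //.
    apply: measurable_fun_powR; apply: measurable_fun_decay => //.
    exact: measurable_funB.
  - by apply: measurable_funeM.
  move=> y /=; rewrite in_itv/= => /andP[y0 yal]; rewrite -EFinM lee_fin.
  rewrite mulrCA ler_wpM2l ?powR_ge0// -mulrA.
  have := hC1 (al - y) y; rewrite subrK (_ : al - y - y = al - 2 * y); last ring.
  by apply; lra.
rewrite ge0_integralZl_EFin//; last first.
  by move=> y _; rewrite lee_fin mulr_ge0 ?powR_ge0.
apply: (le_trans (lee_wpmul2l _ (hC2 al al0))); first by rewrite lee_fin.
rewrite -EFinM lee_fin -!mulrA ler_pM2l// mulrCA.
have a1 : 1 <= 1 + al by lra.
have a0 : 0 < 1 + al by lra.
rewrite [2 * _]mulrCA ler_pM2l// mulrDr -!gt0_powRD// mulr_natl mulr2n.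
by apply: lerD; apply: ler_powR => //; lra.
Qed.

End interior_integral.

(** * The primitive W and the kernel *)

Section weight_primitive.
Context {R : realType}.
Notation leb := (@lebesgue_measure R).
Implicit Types (x y t r mu : R) (w : R -> R).

Lemma C0_on_pos_within (w : R -> R) (a b : R) : C0_on `[0, +oo[ w -> 0 <= a ->
  {within `[a, b], continuous w}.
Proof.
move=> cw a0; apply: continuous_subspaceW cw => x /=.
by rewrite !in_itv/= andbT => /andP[/(le_trans a0)].
Qed.

Lemma C0_on_pos_integrable (w : R -> R) (a b : R) : C0_on `[0, +oo[ w -> 0 <= a ->
  leb.-integrable `[a, b] (EFin \o w).
Proof.
move=> cw a0; apply: continuous_compact_integrable; first exact: segment_compact.
exact: C0_on_pos_within.
Qed.

Lemma C0_on_pos_bounded (w : R -> R) (T : R) : C0_on `[0, +oo[ w -> 0 <= T ->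
  exists2 K : R, 0 < K & forall x, 0 <= x <= T -> `|w x| <= K.
Proof.
move=> cw T0.
have cn : {within `[0, T], continuous (fun x => `|w x|)}.
  move=> x; apply: continuous_comp; first exact: (C0_on_pos_within cw (lexx 0)).
  exact: norm_continuous.
have [c _ hc] := EVT_max T0 cn.
exists (`|w c| + 1) => [|x xT]; first by rewrite ltr_wpDl.
by have := hc x; rewrite in_itv/= xT => /(_ isT); lra.
Qed.

Lemma C0_on_pos_measurable (w : R -> R) (D : set R) : C0_on `[0, +oo[ w ->
  measurable D -> D `<=` `[0, +oo[ -> measurable_fun D w.
Proof.
move=> cw mD D0; apply: (measurable_funS _ D0) => //.
exact: subspace_continuous_measurable_fun.
Qed.

Lemma primW_le0 w r : r <= 0 -> primW w r = 0.
Proof.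
rewrite le_eqVlt => /predU1P[->|r0]; first by rewrite /primW set_itv1 Rintegral_set1.
by rewrite /primW set_itv_ge ?Rintegral_set0// bnd_simp -ltNge.
Qed.

(** On [0,T] the constant is a bound for |w|. The primitive vanishes on the negative half-line and x
    -> max(x,0) is 1-Lipschitz, so the estimate extends to all reals below T, and the midpoint
    (y-t+r)/2 in the kernel may vary freely. *)
Lemma primW_lipschitz w (T : R) : C0_on `[0, +oo[ w -> 0 <= T ->
  exists2 K : R, 0 < K & forall x y, x <= T -> y <= T ->
    `|primW w x - primW w y| <= K * `|x - y|.
Proof.
move=> cw T0; have [K K0 hK] := C0_on_pos_bounded cw T0; exists K => //.
have pos x y : 0 <= y -> y <= x -> x <= T -> `|primW w x - primW w y| <= K * `|x - y|.
  move=> y0 yx xT; rewrite /primW.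
  have iw : leb.-integrable `[0, x] (EFin \o w) by exact: C0_on_pos_integrable.
  rewrite (Rintegral_itvB iw); [|by rewrite bnd_simp|by rewrite bnd_simp].
  have sub : `]y, x] `<=` `[0, x].
    by move=> z /=; rewrite !in_itv/= => /andP[a b]; rewrite b andbT ltW// (le_lt_trans y0 a).
  have iw' : leb.-integrable `]y, x] (EFin \o w) by exact: integrableS iw.
  apply: (le_trans (le_normr_Rintegral _ iw')) => //.
  apply: (@le_trans _ _ (\int[leb]_(z in `]y, x]) (cst K z))).
    apply: le_Rintegral => //.
    - exact: (integrable_norm iw').
    - apply: (@integrableS _ _ _ leb `[y, x]) => //.
        by move=> z /=; rewrite !in_itv/= => /andP[/ltW -> ->].
      apply: continuous_compact_integrable; first exact: segment_compact.
      by move=> z; exact: cvg_cst.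
    - move=> z /=; rewrite in_itv/= => /andP[a b]; apply: hK.
      by apply/andP; split; lra.
  rewrite Rintegral_cst//= lebesgue_measure_itv/= lte_fin.
  by case: ltP => // _; rewrite ?mulr0 ?mulr_ge0 ?(ltW K0)// -EFinB/= ger0_norm// subr_ge0.
have proj x : primW w x = primW w (Num.max x 0).
  by have [x0|//] := leP x 0; rewrite !primW_le0.
have wlog x y : y <= x -> x <= T -> `|primW w x - primW w y| <= K * `|x - y|.
  move=> yx xT; rewrite (proj x) (proj y).
  apply: (le_trans (pos _ _ _ _ _)).
  - by rewrite le_max lexx orbT.
  - by rewrite !maxEle; case: ifP; case: ifP => //; lra.
  - by rewrite ge_max xT.
  rewrite ler_pM2l//.
  by have [x0|x0] := leP x 0; have [y0|y0] := leP y 0;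
     rewrite ?subrr ?normr0 ?subr0// !ger0_norm; lra.
move=> x y xT yT; have [yx|xy] := leP y x; first exact: wlog.
by rewrite distrC [X in _ <= _ * X]distrC; apply: wlog => //; exact: ltW.
Qed.

Lemma primW_continuous w : C0_on `[0, +oo[ w -> continuous (primW w).
Proof.
move=> cw x; apply/cvgrPdist_le => /= e e0.
have T0 : 0 <= `|x| + 1 by rewrite addr_ge0.
have [K K0 hK] := primW_lipschitz cw T0.
near=> y; apply: (le_trans (hK _ _ _ _)).
- by have := ler_norm x; lra.
- near: y; apply/nbhs_ballP; exists 1 => //= y.
  by rewrite /ball/= ltr_distlC => /andP[_ h]; have := ler_norm x; lra.
rewrite mulrC -ler_pdivlMr//; near: y.
apply/nbhs_ballP; exists (e / K) => /=; first exact: divr_gt0.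
by move=> y; rewrite /ball/= => /ltW.
Unshelve. all: by end_near. Qed.

Lemma primW_is_derive w r : C0_on `[0, +oo[ w -> 0 < r ->
  is_derive r 1 (primW w) (w r).
Proof.
move=> cw r0.
have iw : leb.-integrable `[0, r + 1] (EFin \o w) by exact: C0_on_pos_integrable.
have cr : {for r, continuous w}.
  have /continuous_within_itvcyP[+ _] := cw.
  by apply; rewrite in_itv/= r0.
have rr : r < r + 1 by lra.
have [d de] := continuous_FTC1_closed rr iw r0 cr.
by split; [exact: d|rewrite -derive1E; exact: de].
Qed.

Lemma is_derive_le0 (F f : R -> R) (a b : R) : a <= b ->
  (forall x, a <= x -> is_derive x 1 F (f x)) -> (forall x, a <= x -> f x <= 0) ->
  F b <= F a.
Proof.
move=> ab dF f0.
have h x : x \in `]a, b[ -> is_derive x 1 F (f x).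
  by rewrite in_itv/= => /andP[/ltW + _]; exact: dF.
have c : {within `[a, b], continuous F}.
  apply: continuous_in_subspaceT => x; rewrite inE/= in_itv/= => /andP[ax _].
  exact: is_derive_continuous (dF _ ax).
have [x] := MVT_segment ab h c.
rewrite in_itv/= => /andP[/f0 fx _] e.
by rewrite -subr_le0 e mulr_le0_ge0// subr_ge0.
Qed.

Definition short_range_perturbation mu w : Prop :=
  exists (r0 delta C : R) (wt : R -> R),
    [/\ 0 < r0, 0 < delta, 0 < C &
        forall r, r0 <= r ->
          2 * w r = mu / r + wt r /\ `|wt r| <= C * r `^ (- 1 - delta)].

(** The derivative of W - (mu/2) ln is half the short-range remainder. Rather than integrating it,
    one adds k x^(-delta) to W - (mu/2) ln and to its opposite; both sums are nonincreasing beyond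
    r0. The range below r0 and the change from ln r to ln(1+r) cost bounded amounts. *)
Lemma primW_log w mu : C0_on `[0, +oo[ w ->
  short_range_perturbation mu w ->
  exists2 c : R, 0 < c & forall r, 0 <= r -> `|primW w r - mu / 2 * ln (1 + r)| <= c.
Proof.
move=> cw [r0 [d [C [wt [r00 d0 C0 hw]]]]].
(* With this k the derivative of k x^(-d) is -(C/2) x^(-1-d), exactly what outweighs the
   remainder. *)
set a := mu / 2; set k := C / (2 * d).
have k0 : 0 < k by rewrite divr_gt0// mulr_gt0.
have dpow x : r0 <= x -> is_derive x 1 (fun y => y `^ (- d) * k) (- (C / 2 * x `^ (- 1 - d))).
  move=> rx; have x0 : 0 < x by lra.
  have := @is_derive_powR_comp R id (- d) x 1 x0 (is_derive_id _ _).
  move=> /(is_derive_mulr k).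
  rewrite (_ : - d * _ * 1 * k = - (C / 2 * x `^ (- 1 - d)))//.
  by rewrite /k (_ : - d - 1 = - 1 - d); [field; lra|lra].
have dlog x : r0 <= x -> is_derive x 1 (fun y => ln y * a) (x^-1 * a).
  by move=> rx; apply: is_derive_mulr; apply: is_derive1_ln; lra.
have dW x : r0 <= x -> is_derive x 1 (primW w) (w x).
  by move=> rx; apply: primW_is_derive => //; lra.
have wE x : r0 <= x -> `|w x - x^-1 * a| <= C / 2 * x `^ (- 1 - d).
  move=> rx; have [e b] := hw x rx.
  have -> : w x - x^-1 * a = wt x / 2.
    have -> : w x = (mu / x + wt x) / 2 by rewrite -e; field.
    by rewrite /a; field; lra.
  by rewrite normrM (@ger0_norm _ 2^-1)// mulrAC ler_pM2r.
pose c0 := `|primW w r0 - ln r0 * a| + r0 `^ (- d) * k.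
have far r : r0 <= r -> `|primW w r - ln r * a| <= c0.
  move=> rr; have r1 : 0 <= r `^ (- d) * k by rewrite mulr_ge0 ?powR_ge0// ltW.
  have up : primW w r - ln r * a + r `^ (- d) * k <= primW w r0 - ln r0 * a + r0 `^ (- d) * k.
    apply: (@is_derive_le0 (fun r => primW w r - ln r * a + r `^ (- d) * k)
      (fun x => w x - x^-1 * a + - (C / 2 * x `^ (- 1 - d)))) => // x rx.
      apply: is_deriveD; last exact: dpow.
      by apply: is_deriveB; [exact: dW|exact: dlog].
    by have := wE x rx; rewrite ler_norml => /andP[_]; lra.
  have lo : - (primW w r - ln r * a) + r `^ (- d) * k <= - (primW w r0 - ln r0 * a) + r0 `^ (- d) * k.
    apply: (@is_derive_le0 (fun r => - (primW w r - ln r * a) + r `^ (- d) * k)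
      (fun x => - (w x - x^-1 * a) + - (C / 2 * x `^ (- 1 - d)))) => // x rx.
      apply: is_deriveD; last exact: dpow.
      by apply: is_deriveN; apply: is_deriveB; [exact: dW|exact: dlog].
    by have := wE x rx; rewrite ler_norml => /andP[]; lra.
  have n1 := ler_norm (primW w r0 - ln r0 * a).
  have n2 := ler_norm (- (primW w r0 - ln r0 * a)); rewrite normrN in n2.
  by rewrite ler_norml /c0; apply/andP; split; lra.
have [K K0 hK] := primW_lipschitz cw (ltW r00).
exists (c0 + `|a| * ln (1 + r0^-1) + K * r0 + `|a| * ln (1 + r0)) => [|r rp].
  have l1 : 0 <= `|a| * ln (1 + r0^-1).
    by rewrite mulr_ge0// ln_ge0// lerDl invr_ge0 ltW.
  have l2 : 0 <= `|a| * ln (1 + r0) by rewrite mulr_ge0// ln_ge0// lerDl ltW.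
  have l3 : 0 <= c0 by rewrite addr_ge0// mulr_ge0 ?powR_ge0// ltW.
  have l4 : 0 < K * r0 by rewrite mulr_gt0.
  lra.
have l1 : 0 <= `|a| * ln (1 + r0^-1).
  by rewrite mulr_ge0// ln_ge0// lerDl invr_ge0 ltW.
have l2 : 0 <= `|a| * ln (1 + r0) by rewrite mulr_ge0// ln_ge0// lerDl ltW.
have l3 : 0 <= c0 by rewrite addr_ge0// mulr_ge0 ?powR_ge0// ltW.
have l4 : 0 < K * r0 by rewrite mulr_gt0.
have [rr|rr] := leP r0 r.
  have x0 : 0 < r by lra.
  have -> : primW w r - a * ln (1 + r) = (primW w r - ln r * a) - a * ln ((1 + r) / r).
    by rewrite ln_div ?posrE; [ring|lra|lra].
  have h : `|a * ln ((1 + r) / r)| <= `|a| * ln (1 + r0^-1).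
    have q : 1 <= (1 + r) / r <= 1 + r0^-1.
      rewrite mulrDl mul1r mulfV ?gt_eqF// lerDr invr_ge0 ltW//= addrC lerD2l.
      by rewrite lef_pV2 ?posrE.
    case/andP: q => q1 q2.
    rewrite normrM ler_wpM2l// ger0_norm ?ln_ge0// ler_ln ?posrE; lra.
  have := far r rr; have := ler_normB (primW w r - ln r * a) (a * ln ((1 + r) / r)).
  lra.
have h1 : `|primW w r| <= K * r0.
  have := hK r 0 (ltW rr) (ltW r00); rewrite (@primW_le0 w 0)// !subr0 => /le_trans; apply.
  by rewrite ler_pM2l// ger0_norm// ltW.
have h2 : `|a * ln (1 + r)| <= `|a| * ln (1 + r0).
  rewrite normrM ler_wpM2l// ger0_norm ?ln_ge0 ?lerDl//.
  by rewrite ler_ln ?posrE; lra.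
by have := ler_normB (primW w r) (a * ln (1 + r)); lra.
Qed.

(** * Bounds for the kernel E_- *)

Lemma expR_lipschitz (M x y : R) : x <= M -> y <= M ->
  `|expR x - expR y| <= expR M * `|x - y|.
Proof.
have key u v : v <= u -> u <= M -> `|expR u - expR v| <= expR M * `|u - v|.
  move=> vu uM; rewrite ger0_norm ?subr_ge0 ?ler_expR// ger0_norm ?subr_ge0//.
  have h := expR_ge1Dx (v - u).
  have -> : expR u - expR v = expR u * (1 - expR (v - u)).
    by rewrite mulrBr mulr1 -expRD addrCA subrr addr0.
  apply: ler_pM; rewrite ?expR_ge0 ?ler_expR//; last lra.
  by rewrite subr_ge0 -expR0 ler_expR; lra.
move=> xM yM; have [yx|/ltW xy] := leP y x; first exact: key.
by rewrite distrC [X in _ <= _ * X]distrC; exact: key.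
Qed.

Lemma EminusE w t r y : Eminus w t r y =
  expR (2 * primW w ((y - t + r) / 2) - primW w r - primW w y).
Proof. by rewrite /Eminus -!expRD; congr expR; ring. Qed.

Lemma Eminus_ge0 w t r y : 0 <= Eminus w t r y.
Proof. by rewrite EminusE expR_ge0. Qed.

Lemma Eminus_lipschitz w (T : R) : C0_on `[0, +oo[ w -> 0 <= T ->
  exists2 K : R, 0 < K & forall t r y, r <= T -> y <= T -> (y - t + r) / 2 <= T ->
    Eminus w t r y <= K /\
    forall t' r', r' <= T -> (y - t' + r') / 2 <= T ->
      `|Eminus w t r y - Eminus w t' r' y| <= K * (`|t - t'| + `|r - r'|).
Proof.
move=> cw T0; have [K K0 hK] := primW_lipschitz cw T0.
have Wb x : x <= T -> `|primW w x| <= K * T.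
  move=> xT; have [x0|x0] := leP x 0; first by rewrite primW_le0// normr0 mulr_ge0// ltW.
  have := hK x 0 xT T0; rewrite (@primW_le0 w 0)// !subr0 => /le_trans; apply.
  by rewrite ler_pM2l// gtr0_norm.
(* The exponent contains W twice at the midpoint, once at r and once at y, each of size at most K
   T. *)
pose M := 4 * (K * T).
have expb t r y : r <= T -> y <= T -> (y - t + r) / 2 <= T ->
    2 * primW w ((y - t + r) / 2) - primW w r - primW w y <= M.
  move=> /Wb + /Wb + /Wb; rewrite !ler_norml /M => /andP[? ?] /andP[? ?] /andP[? ?]; lra.
exists (expR M * (1 + 2 * K)) => [|t r y rT yT sT].
  by rewrite mulr_gt0 ?expR_gt0//; lra.
have M0 := expR_gt0 M; split.
  rewrite EminusE; apply: (@le_trans _ _ (expR M)); first by rewrite ler_expR expb.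
  by rewrite ler_peMr ?ltW//; lra.
move=> t' r' r'T s'T; rewrite !EminusE.
apply: (le_trans (expR_lipschitz (expb _ _ _ rT yT sT) (expb _ _ _ r'T yT s'T))).
rewrite -mulrA ler_pM2l//.
set s := (y - t + r) / 2; set s' := (y - t' + r') / 2.
have -> : 2 * primW w s - primW w r - primW w y - (2 * primW w s' - primW w r' - primW w y) =
  2 * (primW w s - primW w s') - (primW w r - primW w r') by ring.
have h1 := hK s s' sT s'T; have h2 := hK r r' rT r'T.
have h3 : `|s - s'| <= (`|t - t'| + `|r - r'|) / 2.
  have -> : s - s' = ((t' - t) + (r - r')) / 2 by rewrite /s /s'; field.
  rewrite normrM (@ger0_norm _ 2^-1)// ler_pM2r// (distrC t t').
  exact: ler_normD.
have h4 := ler_normB (2 * (primW w s - primW w s')) (primW w r - primW w r').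
rewrite normrM (@ger0_norm _ 2)// in h4.
have := normr_ge0 (t - t'); have := normr_ge0 (r - r'); nra.
Qed.

(** The two conditions y >= t-r and y >= r-t place the midpoint s = (y-t+r)/2 between 0 and y. Up to
    an error 4c the exponent is mu/2 times 2 ln(1+s) - ln(1+r) - ln(1+y), and mu >= 0 allows s to be
    replaced by y. *)
Lemma Eminus_le w mu : 0 <= mu -> C0_on `[0, +oo[ w ->
  short_range_perturbation mu w ->
  exists2 c : R, 0 < c & forall t r y, 0 <= r -> 0 <= y -> t - r <= y -> r - t <= y ->
    Eminus w t r y <= c * ((1 + r) `^ (- (mu / 2)) * (1 + y) `^ (mu / 2)).
Proof.
move=> mu0 cw hw; have [c c0 hc] := primW_log cw hw.
exists (expR (4 * c)) => [|t r y r0 y0 h1 h2]; first exact: expR_gt0.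
set s := (y - t + r) / 2.
have s0 : 0 <= s by rewrite divr_ge0//; lra.
have sy : s <= y by rewrite /s; lra.
have pE x e : 0 <= x -> (1 + x) `^ e = expR (e * ln (1 + x)).
  by move=> x0; rewrite /powR gt_eqF//; lra.
rewrite EminusE -/s !pE// -!expRD ler_expR.
have l : ln (1 + s) <= ln (1 + y) by rewrite ler_ln ?posrE; lra.
have la : mu / 2 * ln (1 + s) <= mu / 2 * ln (1 + y) by rewrite ler_wpM2l// divr_ge0.
have := hc s s0; have := hc r r0; have := hc y y0.
rewrite !ler_norml => /andP[? ?] /andP[? ?] /andP[? ?]; lra.
Qed.

Lemma measurable_fun_Eminus d (S : measurableType d) (D : set S) w (f g h : S -> R) :
  C0_on `[0, +oo[ w -> measurable_fun D f -> measurable_fun D g -> measurable_fun D h ->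
  measurable_fun D (fun z => Eminus w (f z) (g z) (h z)).
Proof.
move=> cw mf mg mh.
have mW (k : S -> R) : measurable_fun D k -> measurable_fun D (fun z => primW w (k z)).
  move=> mk; apply: measurableT_comp mk => //.
  exact: continuous_measurable_fun (primW_continuous cw).
rewrite /Eminus.
have mE (k : S -> R) : measurable_fun D k -> measurable_fun D (fun z => expR (k z)).
  by move=> mk; exact: measurableT_comp mk.
apply: measurable_funM; [apply: measurable_funM|]; apply: mE.
- by apply: measurableT_comp => //; exact: mW.
- apply: measurable_funM => //; apply: mW; apply: measurable_funM => //.
  by apply: measurable_funD => //; exact: measurable_funB.
- by apply: measurableT_comp => //; exact: mW.
Qed.

End weight_primitive.

(** * Weighted estimate of the Duhamel integral *)

Section duhamel.
Context {R : realType}.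
Notation leb := (@lebesgue_measure R).
Implicit Types (t r mu nu eta p : R) (w : R -> R) (G : R * R -> R).

Lemma measurable_pos_set d (T : measurableType d) (f : T -> R) :
  measurable_fun setT f -> measurable [set z | 0 < f z].
Proof.
move=> mf; have := mf measurableT _ (@measurable_itv R `]0, +oo[).
rewrite setTI; congr measurable; apply/seteqP.
by split => z /=; rewrite in_itv/= andbT.
Qed.

Lemma measurable_Delta_minus t r : measurable (@Delta_minus R t r).
Proof.
have -> : Delta_minus t r = [set z | 0 < z.1] `&` [set z | 0 < z.2] `&`
  [set z | 0 < z.1 + z.2 - `|t - r|] `&` [set z | 0 < t + r - (z.1 + z.2)] `&`
  [set z | 0 < t - r - (z.1 - z.2)] :> set (R * R).
  apply/seteqP; split => z; rewrite /Delta_minus /=.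
    by move=> [h1 h2 /andP[h3 h4] h5]; rewrite !subr_gt0.
  by rewrite !subr_gt0 => -[[[[h1 h2] h3] h4] h5]; rewrite h3 h4.
by do !apply: measurableI; apply: measurable_pos_set => //;
  repeat (apply: measurable_funB || apply: measurable_funD) => //.
Qed.

Definition duhamel w t r G : \bar R :=
  (\int[leb \x leb]_(z in Delta_minus t r) (Eminus w (t - z.1) r z.2 * G z)%:E)%E.

Definition source p (u : R -> R -> R) (z : R * R) : R :=
  `|u z.1 z.2| `^ p / z.2 `^ (p - 1).

Definition weight mu nu eta t r : R := r * jap r `^ (- (mu / 2)) * decay nu eta t r.

Lemma measurable_fun_weight d (T : measurableType d) (D : set T) mu nu eta (f g : T -> R) :
  measurable_fun D f -> measurable_fun D g ->
  measurable_fun D (fun z => weight mu nu eta (f z) (g z)).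
Proof.
move=> mf mg; apply: measurable_funM; last exact: measurable_fun_decay.
apply: measurable_funM => //.
rewrite (_ : (fun z => _) = fun z => (1 + g z ^+ 2) `^ (2^-1 * (- (mu / 2)))).
  by apply: measurable_fun_powR; apply: measurable_funD => //; exact: measurable_funX.
by apply/funext => z; rewrite powRrM powR12_sqrt// addr_ge0 ?sqr_ge0.
Qed.

Lemma decay_ge0 nu eta t r : 0 < eta -> 0 <= t -> 0 <= r -> 0 <= decay nu eta t r.
Proof.
move=> eta0 t0 r0; have [C C0 /(_ t r t0 r0)] := decay_ge nu eta0.
by move=> /(le_trans (powR_ge0 _ _)); rewrite pmulr_rge0.
Qed.

Lemma weight_ge0 mu nu eta t r : 0 < eta -> 0 <= t -> 0 <= r -> 0 <= weight mu nu eta t r.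
Proof. by move=> eta0 t0 r0; rewrite !mulr_ge0 ?powR_ge0 ?decay_ge0. Qed.

(** The factor r of the weight compensates the singularity r^(1-p) at the axis and leaves one power
    of r. *)
Lemma source_weight mu nu eta p t r : 0 < eta -> 0 <= t -> 0 < r ->
  source p (weight mu nu eta) (t, r) =
  r * (jap r `^ (- (mu / 2) * p) * decay nu eta t r `^ p).
Proof.
move=> eta0 t0 r0; rewrite /source/= ger0_norm ?weight_ge0 ?(ltW r0)//.
have h : 0 <= r * jap r `^ (- (mu / 2)) by rewrite mulr_ge0 ?powR_ge0 ?(ltW r0).
rewrite powRM ?decay_ge0 ?(ltW r0)// powRM ?powR_ge0 ?(ltW r0)// -powRrM.
rewrite powRB ?(gt_eqF r0) ?implybT// (powRr1 (ltW r0)).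
by field; rewrite !gt_eqF// powR_gt0.
Qed.

Lemma measurable_fun_source (D : set (R * R)) p (u : R -> R -> R) :
  measurable_fun D (fun z => u z.1 z.2) -> measurable_fun D (source p u).
Proof.
move=> mu; rewrite /source; apply: measurable_funM.
  by apply: measurable_fun_powR; exact: measurableT_comp.
rewrite (_ : (fun z => _) = fun z : R * R => z.2 `^ (- (p - 1))); last first.
  by apply/funext => z; rewrite powRN.
by apply: measurable_fun_powR => //; exact: measurable_funTS.
Qed.

Lemma measurable_fun_duhamel_integrand w t r G (D : set (R * R)) : C0_on `[0, +oo[ w ->
  measurable_fun D G -> measurable_fun D (fun z => Eminus w (t - z.1) r z.2 * G z).
Proof.
move=> cw mG; apply: measurable_funM => //.
apply: measurable_funTS.
by apply: measurable_fun_Eminus => //; exact: measurable_funB.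
Qed.

Lemma duhamel_weight_le w mu nu p : 0 <= mu -> C0_on `[0, +oo[ w ->
  short_range_perturbation mu w ->
  let eta := (mu / 2 + 1) * p - (mu / 2 + 2) in
  1 < p -> -1 < nu -> 0 < eta -> 1 < p * eta -> nu + 1 <= nu * p + eta ->
  exists2 C : R, 0 < C & forall t r, 0 <= t -> 0 < r ->
  (duhamel w t r (source p (weight mu nu eta)) <= (C * weight mu nu eta t r)%:E)%E.
Proof.
move=> mu0 cw hw eta p1 nu1 eta0 peta hnu.
have [c c0 hc] := Eminus_le mu0 cw hw.
have [C1 C10 hC1] := light_cone_integral nu eta0.
have [C2 C20 hC2] := interior_decay_integral p1 nu1 eta0 peta hnu.
set th := p - 1 - eta in hC2; set rho := decay_rate nu eta in hC1 hC2.
set c1 := 2 `^ `|- (mu / 2) * p| : R; set c2 := 2 `^ `|- (mu / 2)| : R.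
have c10 : 0 < c1 by exact: powR_gt0.
have c20 : 0 < c2 by exact: powR_gt0.
exists (c * c2 * c1 * C2 * C1) => [|t r t0 r0]; first by rewrite !mulr_gt0.
pose g (z : R * R) := (1 + z.2) `^ th * decay nu eta z.1 z.2 `^ p.
have g0 z : 0 <= g z by rewrite mulr_ge0 ?powR_ge0.
have mg : measurable_fun setT g.
  apply: measurable_funM.
    by apply: measurable_fun_powR; exact: measurable_funD.
  by apply: measurable_fun_powR; exact: measurable_fun_decay.
have mD := measurable_Delta_minus t r.
pose K := c * (1 + r) `^ (- (mu / 2)) * c1.
have K0 : 0 <= K by rewrite !mulr_ge0 ?powR_ge0 ?(ltW c0) ?(ltW c10).
have mw : measurable_fun setT (fun z : R * R => weight mu nu eta z.1 z.2).
  exact: measurable_fun_weight.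
have step1 : (duhamel w t r (source p (weight mu nu eta)) <=
    K%:E * \int[leb \x leb]_(z in Delta_minus t r) (g z)%:E)%E.
  rewrite -ge0_integralZl_EFin//; try solve [by move=> z _; rewrite lee_fin
    |by apply/measurable_EFinP; exact: measurable_funTS mg].
  apply: ge0_le_integral => //.
  - by move=> z _; rewrite lee_fin mulr_ge0 ?Eminus_ge0// divr_ge0 ?powR_ge0.
  - apply/measurable_EFinP; apply: measurable_fun_duhamel_integrand => //.
    by apply: measurable_fun_source; exact: measurable_funTS mw.
  - by apply: measurable_funeM; apply/measurable_EFinP; exact: measurable_funTS mg.
  move=> [s y] /= [/= s0 y0 /andP[h1 h2] h3]; rewrite -EFinM lee_fin source_weight ?(ltW s0)//.
  rewrite /K /g/=.
  have hE : Eminus w (t - s) r y <= c * ((1 + r) `^ (- (mu / 2)) * (1 + y) `^ (mu / 2)).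
    apply: hc; [exact: ltW|exact: ltW| |lra].
    by have := ler_norm (t - r); lra.
  have hj := jap_powR_le (- (mu / 2) * p) y; rewrite (ger0_norm (ltW y0)) -/c1 in hj.
  set Dp := decay nu eta s y `^ p; have Dp0 : 0 <= Dp := powR_ge0 _ _.
  have y1 : 0 < 1 + y by lra.
  apply: (@le_trans _ _ (c * ((1 + r) `^ (- (mu / 2)) * (1 + y) `^ (mu / 2)) *
     ((1 + y) * ((c1 * (1 + y) `^ (- (mu / 2) * p)) * Dp)))).
    apply: ler_pM; rewrite ?Eminus_ge0// ?mulr_ge0 ?powR_ge0 ?(ltW y0)//.
    by apply: ler_pM; rewrite ?mulr_ge0 ?powR_ge0 ?(ltW y0)//; [lra|rewrite ler_wpM2r].
  (* The powers of 1+y are collected: mu/2 from the kernel, 1 from the source, -mu p/2 from the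
     weight. *)
  have -> : th = mu / 2 + 1 + (- (mu / 2) * p) by rewrite /th /eta; ring.
  rewrite !gt0_powRD// (powRr1 (ltW y1)).
  by rewrite le_eqVlt; apply/orP; left; apply/eqP; ring.
(* In the variable al = sigma + y, slices of the region are empty outside |t-r| < al < t+r, and
   inside this range each is enlarged to 0 <= y <= al. *)
have step2 : (\int[leb \x leb]_(z in Delta_minus t r) (g z)%:E <=
    \int[leb]_(al in `[`|t - r|%R, (t + r)%R]) (C2 * (1 + al) `^ (- 1 - rho))%:E)%E.
  rewrite integral_mkcond.
  pose f := (EFin \o g) \_ (Delta_minus t r).
  have f0 z : (0 <= f z)%E.
    by rewrite /f patchE; case: ifP => // _; rewrite lee_fin.
  have mf : measurable_fun setT f.
    apply/(measurable_restrictT _ _).1 => //.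
    by apply/measurable_EFinP; exact: measurable_funTS mg.
  rewrite -/f ge0_integral_shear// [leRHS]integral_mkcond.
  pose h (x : R * R) := f (x.1 - x.2, x.2).
  have mh : measurable_fun setT h.
    apply: (measurableT_comp mf); apply: measurable_fun_pair => //=.
    exact: measurable_funB.
  apply: ge0_le_integral => //.
  - by move=> x _; apply: integral_ge0.
  - exact: (@measurable_fun_fubini_tonelli_F _ _ _ _ R leb h mh (fun z => f0 _)).
  - apply/(measurable_restrictT _ _).1 => //.
    apply/measurable_EFinP; apply: measurable_funM => //.
    by apply: measurable_fun_powR; exact: measurable_funD.
  move=> x _; rewrite patchE; case: ifPn => [|/negP xn].
    rewrite inE/= in_itv/= => /andP[x1 x2].
    have x0 : 0 <= x := le_trans (normr_ge0 _) x1.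
    apply: le_trans (hC2 x x0); rewrite [leRHS]integral_mkcond.
    have mfx : measurable_fun setT (fun y : R => f (x - y, y)).
      apply: (measurableT_comp mf); apply: measurable_fun_pair => //=.
      exact: measurable_funB.
    have mgx : measurable_fun setT ((fun y : R =>
        ((1 + y) `^ th * decay nu eta (x - y) y `^ p)%:E) \_ `[0, x]).
      apply/(measurable_restrictT _ _).1; first exact: measurable_itv.
      apply/measurable_EFinP; apply: measurable_funM.
        by apply: measurable_fun_powR; exact: measurable_funD.
      by apply: measurable_fun_powR; apply: measurable_fun_decay => //; exact: measurable_funB.
    apply: (@ge0_le_integral _ _ R leb setT measurableT _ _ (fun y _ => f0 _) mfx mgx).
    move=> y _; rewrite /f patchE; case: ifPn => [|_]; last first.
      by rewrite patchE; case: ifP => // _; rewrite lee_fin mulr_ge0 ?powR_ge0.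
    rewrite inE => -[/= h1 h2 _ _].
    by rewrite patchE ifT// inE/= in_itv/= (ltW h2)/=; lra.
  rewrite (_ : \int[leb]_y f (x - y, y)%R = 0)%E//.
  apply: integral0_eq => y _; rewrite /f patchE ifF//; apply/negP.
  rewrite inE => -[/= h1 h2 + _]; rewrite subrK => /andP[h3 h4].
  by apply: xn; rewrite inE/= in_itv/= !ltW.
apply: (le_trans step1); apply: (le_trans (lee_wpmul2l _ step2)); first by rewrite lee_fin.
have mp : measurable_fun `[`|t - r|, t + r] (fun al : R => ((1 + al) `^ (- 1 - rho))%:E).
  by apply/measurable_EFinP; apply: measurable_fun_powR; exact: measurable_funD.
under eq_integral do rewrite EFinM.
rewrite ge0_integralZl_EFin//; try solve [by move=> z _; rewrite lee_fin powR_ge0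
   |exact: ltW|exact: mp].
apply: (@le_trans _ _ (K%:E * (C2%:E * (C1 * (r * decay nu eta t r))%:E))%E).
  apply: lee_wpmul2l; first by rewrite lee_fin.
  by apply: lee_wpmul2l; [rewrite lee_fin ltW|exact: hC1].
rewrite -!EFinM lee_fin /K /weight.
have hj := jap_powR_ge (- (mu / 2)) r; rewrite (ger0_norm (ltW r0)) -/c2 in hj.
have d0 : 0 <= decay nu eta t r by rewrite decay_ge0 ?(ltW r0).
rewrite [leLHS](_ : _ = (c * c1 * C2 * C1 * r * decay nu eta t r) * (1 + r) `^ (- (mu / 2))); last by ring.
rewrite [leRHS](_ : _ = (c * c1 * C2 * C1 * r * decay nu eta t r) * (c2 * jap r `^ (- (mu / 2)))); last by ring.
by rewrite ler_wpM2l// !mulr_ge0 ?(ltW r0) ?(ltW C10) ?(ltW C20) ?(ltW c10) ?(ltW c0).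
Qed.

End duhamel.

(** * Lipschitz dependence of the Duhamel integral *)

Section duhamel_continuity.
Context {R : realType}.
Notation leb := (@lebesgue_measure R).
Implicit Types (t r : R) (w : R -> R) (G H : R * R -> R).

Lemma Rintegral_dist_le d (T : measurableType d) (m : {measure set T -> \bar R})
    (D : set T) (f1 f2 h : T -> R) : measurable D ->
  m.-integrable D (EFin \o f1) -> m.-integrable D (EFin \o f2) ->
  measurable_fun D h -> (forall x, D x -> `|f1 x - f2 x| <= h x) ->
  ((`|\int[m]_(x in D) f1 x - \int[m]_(x in D) f2 x|)%:E <= \int[m]_(x in D) (h x)%:E)%E.
Proof.
move=> mD i1 i2 mh hh; rewrite -RintegralB//.
have iB : m.-integrable D (EFin \o (fun x => f1 x - f2 x)).
  by rewrite (_ : _ \o _ = (EFin \o f1) \- (EFin \o f2))%E//; exact: integrableB.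
rewrite EFin_normr_Rintegral//.
apply: (le_trans (le_abse_integral _ mD (measurable_int _ iB))).
apply: ge0_le_integral => //.
- by apply: measurableT_comp => //; exact: measurable_int iB.
- exact/measurable_EFinP.
Qed.

Lemma ge0_integrable_of_fin_num d (T : measurableType d) (m : {measure set T -> \bar R})
    (D : set T) (f : T -> R) : measurable D -> measurable_fun D f ->
  (forall x, D x -> 0 <= f x) -> (\int[m]_(x in D) (f x)%:E < +oo)%E ->
  m.-integrable D (EFin \o f).
Proof.
move=> mD mf f0 fin; apply/integrableP; split; first exact/measurable_EFinP.
apply: le_lt_trans fin; rewrite le_eqVlt; apply/orP; left; apply/eqP.
by apply: eq_integral => x; rewrite inE => Dx /=; rewrite ger0_norm// f0.
Qed.

Lemma duhamel_dist_le w t r G1 G2 H : C0_on `[0, +oo[ w ->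
  measurable_fun setT G1 -> measurable_fun setT G2 -> measurable_fun setT H ->
  (forall z, Delta_minus t r z -> 0 <= G1 z) ->
  (forall z, Delta_minus t r z -> 0 <= G2 z) ->
  (forall z, Delta_minus t r z -> `|G1 z - G2 z| <= H z) ->
  (duhamel w t r G1 < +oo)%E -> (duhamel w t r G2 < +oo)%E ->
  ((`|fine (duhamel w t r G1) - fine (duhamel w t r G2)|)%:E <= duhamel w t r H)%E.
Proof.
move=> cw m1 m2 mH G10 G20 hH fin1 fin2.
have mD := measurable_Delta_minus t r.
have mI G : measurable_fun setT G -> measurable_fun (Delta_minus t r)
    (fun z => Eminus w (t - z.1) r z.2 * G z).
  by move=> mG; apply: measurable_fun_duhamel_integrand => //; exact: measurable_funTS.
have iI G : measurable_fun setT G -> (forall z, Delta_minus t r z -> 0 <= G z) ->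
    (duhamel w t r G < +oo)%E -> (leb \x leb)%E.-integrable (Delta_minus t r)
      (EFin \o (fun z => Eminus w (t - z.1) r z.2 * G z)).
  move=> mG G0; apply: ge0_integrable_of_fin_num => //; first exact: mI.
  by move=> z /G0 Gz; rewrite mulr_ge0 ?Eminus_ge0.
have := Rintegral_dist_le (m := (leb \x leb)%E) mD (iI _ m1 G10 fin1) (iI _ m2 G20 fin2) (mI _ mH).
apply => z Dz; rewrite -mulrBr normrM ger0_norm ?Eminus_ge0//.
by rewrite ler_wpM2l ?Eminus_ge0// hH.
Qed.

Lemma strip_measure_le (c : R -> R) (T d : R) : measurable_fun setT c -> 0 <= T -> 0 <= d ->
  let S := [set z : R * R | 0 < z.1 < T /\ `|z.2 - c z.1| <= d] in
  measurable S /\ ((leb \x leb) S <= (2 * d * T)%:E)%E.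
Proof.
move=> mc T0 d0 S.
have mS : measurable S.
  have -> : S = [set z : R * R | 0 < z.1] `&` [set z : R * R | 0 < T - z.1] `&`
      ~` [set z : R * R | 0 < `|z.2 - c z.1| - d].
    apply/seteqP; split => z; rewrite /S /= !subr_gt0.
      by move=> [/andP[h1 h2] h3]; split => //; rewrite ltNge h3.
    by move=> [[h1 h2] /negP]; rewrite -leNgt h1 h2.
  apply: measurableI; first by apply: measurableI; apply: measurable_pos_set => //; exact: measurable_funB.
  apply: measurableC; apply: measurable_pos_set; apply: measurable_funB => //.
  apply: measurableT_comp => //; apply: measurable_funB => //.
  exact: measurableT_comp.
split => //.
have -> : ((leb \x leb) S = \int[leb]_x leb (xsection S x))%E by [].
apply: (@le_trans _ _ (\int[leb]_(x in `]0%R, T[) (cst (2 * d)%:E x))%E).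
  rewrite [leRHS]integral_mkcond.
  apply: (@ge0_le_integral _ _ R leb setT measurableT) => //.
  - exact: measurable_fun_xsection.
  - apply/(measurable_restrictT _ _).1 => //.
  move=> x _; rewrite patchE; case: ifPn => [_|xn].
    have sub : xsection S x `<=` `[c x - d, c x + d]%classic.
      move=> y; rewrite /xsection /= inE /S/= => -[_]; rewrite ler_distl in_itv/=.
      by [].
    apply: (@le_trans _ _ (leb `[c x - d, c x + d]%classic)).
      by apply: le_measure => //; rewrite inE//; exact: measurable_xsection.
    rewrite lebesgue_measure_itv/= lte_fin; case: ifP => _.
      by rewrite -EFinB lee_fin; lra.
    by rewrite lee_fin mulr_ge0.
  rewrite (_ : xsection S x = set0) ?measure0//.
  apply/seteqP; split => y //; rewrite /xsection/= inE /S/= => -[h _].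
  by move/negP: xn; apply; rewrite inE/= in_itv/=.
rewrite integral_cst//= lebesgue_measure_itv/= lte_fin; case: ifP => _.
  by rewrite -EFinB -EFinM lee_fin subr0.
by rewrite mule0 lee_fin !mulr_ge0.
Qed.

(** A threshold that moves by at most d cannot cross a point farther than d from it. This decides
    membership outside the strips. *)
Lemma lt_far (q c c' d : R) : d < `|q - c| -> `|c - c'| <= d ->
  (c < q) = (c' < q) /\ (q < c) = (q < c').
Proof.
rewrite ltr_normr ler_norml => /orP[h|h] /andP[h1 h2];
by split; apply/idP/idP => ?; lra.
Qed.

(* The symmetric difference of two backward regions lies in three strips around the
   boundary lines of one of them. *)
Lemma Delta_minus_far t r t' r' z (d := `|t - t'| + `|r - r'|) :
  d < `|z.2 - (`|t - r| - z.1)| -> d < `|z.2 - (t + r - z.1)| ->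
  d < `|z.2 - (z.1 - (t - r))| ->
  Delta_minus t r z <-> Delta_minus t' r' z.
Proof.
move=> h1 h2 h3.
have e1 : `| `|t - r| - `|t' - r'| | <= d.
  apply: (le_trans (ler_dist_dist _ _)).
  by rewrite (_ : t - r - (t' - r') = (t - t') - (r - r')); [exact: ler_normB|ring].
have e2 : `|t + r - (t' + r')| <= d.
  by rewrite (_ : t + r - (t' + r') = (t - t') + (r - r')); [exact: ler_normD|ring].
have e3 : `|t - r - (t' - r')| <= d.
  by rewrite (_ : t - r - (t' - r') = (t - t') - (r - r')); [exact: ler_normB|ring].
have g1 : d < `|z.1 + z.2 - `|t - r| | by move: h1; congr (_ < `|_|); ring.
have g2 : d < `|z.1 + z.2 - (t + r)| by move: h2; congr (_ < `|_|); ring.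
have g3 : d < `|z.1 - z.2 - (t - r)| by move: h3; rewrite distrC; congr (_ < `|_|); ring.
rewrite /Delta_minus/=.
rewrite (lt_far g1 e1).1 (lt_far g2 e2).2 (lt_far g3 e3).2.
by [].
Qed.

Lemma dist_le_of_range (a b k : R) : 0 <= a -> a <= k -> 0 <= b -> b <= k -> `|a - b| <= k.
Proof. by move=> *; rewrite ler_norml; apply/andP; split; lra. Qed.

Lemma duhamel_lipschitz w (T B : R) : C0_on `[0, +oo[ w -> 0 <= T -> 0 <= B ->
  exists2 K : R, 0 < K & forall G, measurable_fun setT G ->
    (forall z, 0 < z.1 -> 0 < z.2 -> z.1 + z.2 < T -> 0 <= G z <= B) ->
    forall t r, 0 <= t -> 0 < r -> t + r <= T ->
    (duhamel w t r G < +oo)%E /\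
    forall t' r', 0 <= t' -> 0 < r' -> t' + r' <= T ->
    `|fine (duhamel w t r G) - fine (duhamel w t' r' G)| <= K * (`|t - t'| + `|r - r'|).
Proof.
move=> cw T0 B0; have [K1 K10 hK] := Eminus_lipschitz cw T0.
pose X : set (R * R) := `]0, T[%classic `*` `]0, T[%classic.
have mX : measurable X by exact: measurableX.
have muX : ((leb \x leb) X <= (T * T)%:E)%E.
  rewrite product_measure1E//= lebesgue_measure_itv/= lte_fin.
  case: ifP => _; last by rewrite mule0 lee_fin mulr_ge0.
  by rewrite -EFinB subr0 -EFinM lexx.
(* The first term is the variation of the kernel over a box of area T^2; the second comes from three
   strips of area at most 2dT, on which the integrand is only known to be between 0 and K1 B; the 1
   ensures positivity. None depends on G beyond its bound B. *)
exists (K1 * B * (T * T) + 3 * (K1 * B * (2 * T)) + 1).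
  by rewrite ltr_wpDl// addr_ge0// !mulr_ge0 ?(ltW K10).
move=> G mG hG.
pose f t r z := \1_(Delta_minus t r) z * (Eminus w (t - z.1) r z.2 * G z).
have f_out t r z : ~ Delta_minus t r z -> f t r z = 0.
  by move=> nD; rewrite /f indicE memNset// mul0r.
have f_in t r z : Delta_minus t r z -> f t r z = Eminus w (t - z.1) r z.2 * G z.
  by move=> Dz; rewrite /f indicE mem_set// mul1r.
have fE t r : duhamel w t r G = (\int[leb \x leb]_z (f t r z)%:E)%E.
  rewrite /duhamel integral_mkcond; apply: eq_integral => z _.
  by rewrite patchE /f indicE; case: ifP => _; rewrite ?mul1r ?mul0r.
have mf t r : measurable_fun setT (f t r).
  apply: measurable_funM; first by apply: measurable_indic; exact: measurable_Delta_minus.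
  exact: measurable_fun_duhamel_integrand.
have DX t r z : t + r <= T -> Delta_minus t r z -> X z.
  move=> trT [h1 h2 /andP[h3 h4] h5]; rewrite /X/= !in_itv/= h1 h2/=.
  by split; lra.
have Dside t r z : 0 <= t -> 0 < r -> t + r <= T -> Delta_minus t r z ->
    [/\ r <= T, z.2 <= T, (z.2 - (t - z.1) + r) / 2 <= T & 0 <= G z <= B].
  move=> t0 r0 trT [h1 h2 /andP[h3 h4] h5]; split; try lra.
  by apply: hG => //; lra.
have fb t r z : 0 <= t -> 0 < r -> t + r <= T -> 0 <= f t r z <= K1 * B * \1_X z.
  move=> t0 r0 trT; rewrite /f !indicE.
  have [Dz|/negP nDz] := boolP (z \in Delta_minus t r); last first.
    by rewrite mul0r lexx/= mulr_ge0// mulr_ge0// ltW.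
  have {}Dz : Delta_minus t r z by rewrite inE in Dz.
  rewrite mem_set ?mul1r ?mulr1; last exact: DX Dz.
  have [a1 a2 a3 /andP[G0 GB]] := Dside _ _ _ t0 r0 trT Dz.
  rewrite mulr_ge0 ?Eminus_ge0//=; apply: ler_pM; rewrite ?Eminus_ge0//.
  by have [] := hK (t - z.1) r z.2 a1 a2 a3.
have fin t r : 0 <= t -> 0 < r -> t + r <= T -> (duhamel w t r G < +oo)%E.
  move=> t0 r0 trT; rewrite fE.
  apply: (@le_lt_trans _ _ (\int[leb \x leb]_z ((K1 * B)%:E * (\1_X z)%:E))%E).
    apply: ge0_le_integral => //.
    - by move=> z _; rewrite lee_fin; case/andP: (fb t r z t0 r0 trT).
    - by apply/measurable_EFinP; exact: mf.
    - by apply: measurable_funeM; apply/measurable_EFinP; exact: measurable_indic.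
    - by move=> z _; rewrite -EFinM lee_fin; case/andP: (fb t r z t0 r0 trT).
  rewrite ge0_integralZl_EFin//; last by rewrite mulr_ge0// ltW.
    by rewrite integral_indic// setIT lte_mul_pinfty ?lee_fin ?mulr_ge0 ?(ltW K10)//
      (le_lt_trans muX)// ltry.
  by apply/measurable_EFinP; exact: measurable_indic.
move=> t r t0 r0 trT; split => [|t' r' t'0 r'0 trT']; first exact: fin.
set d := `|t - t'| + `|r - r'|.
have d0 : 0 <= d by rewrite addr_ge0.
pose S c := [set z : R * R | 0 < z.1 < T /\ `|z.2 - c z.1| <= d].
pose c1 (s : R) := `|t - r| - s; pose c2 (s : R) := t + r - s; pose c3 (s : R) := s - (t - r).
have mc1 : measurable_fun setT c1 by exact: measurable_funB.
have mc2 : measurable_fun setT c2 by exact: measurable_funB.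
have mc3 : measurable_fun setT c3 by exact: measurable_funB.
have [mS1 muS1] := strip_measure_le mc1 T0 d0.
have [mS2 muS2] := strip_measure_le mc2 T0 d0.
have [mS3 muS3] := strip_measure_le mc3 T0 d0.
rewrite -/(S c1) in mS1 muS1; rewrite -/(S c2) in mS2 muS2; rewrite -/(S c3) in mS3 muS3.
pose h z := K1 * d * B * \1_X z + K1 * B * (\1_(S c1) z + \1_(S c2) z + \1_(S c3) z).
have int t1 r1 : 0 <= t1 -> 0 < r1 -> t1 + r1 <= T ->
    (leb \x leb)%E.-integrable setT (EFin \o f t1 r1).
  move=> t10 r10 tr1; apply: ge0_integrable_of_fin_num => //.
  - exact: mf.
  - by move=> z _; case/andP: (fb t1 r1 z t10 r10 tr1).
  - by rewrite -fE; exact: fin.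
have mh : measurable_fun setT h.
  apply: measurable_funD; apply: measurable_funM => //.
  by repeat apply: measurable_funD.
have hle z : `|f t r z - f t' r' z| <= h z.
  have KB : 0 <= K1 * B by rewrite mulr_ge0// ltW.
  have KdB : 0 <= K1 * d * B by rewrite !mulr_ge0// ltW.
  have I (A : set (R * R)) : 0 <= \1_A z :> R by rewrite indicE.
  have [Xz|nXz] := pselect (X z); last first.
    have no t1 r1 : t1 + r1 <= T -> f t1 r1 z = 0.
      move=> tr1; rewrite /f indicE memNset ?mul0r// => Dz; exact: nXz (DX _ _ _ tr1 Dz).
    by rewrite !no// subr0 normr0 addr_ge0// mulr_ge0// !addr_ge0.
  have X1 : \1_X z = 1 :> R by rewrite indicE mem_set.
  have [in1|ni1] := pselect (S c1 z \/ S c2 z \/ S c3 z).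
    have I1 (A : set (R * R)) : A z -> \1_A z = 1 :> R by move=> Az; rewrite indicE mem_set.
    have one : 1 <= \1_(S c1) z + \1_(S c2) z + \1_(S c3) z :> R.
      have := I (S c1); have := I (S c2); have := I (S c3).
      by case: in1 => [/I1|[/I1|/I1]] ->; lra.
    have := fb t r z t0 r0 trT; have := fb t' r' z t'0 r'0 trT'.
    rewrite X1 mulr1 => /andP[u1 u2] /andP[u3 u4].
    apply: (@le_trans _ _ (K1 * B * 1)).
      by rewrite mulr1; exact: dist_le_of_range.
    by apply: (@le_trans _ _ (K1 * B * (\1_(S c1) z + \1_(S c2) z + \1_(S c3) z)));
      [rewrite ler_wpM2l|rewrite lerDr mulr_ge0].
  have zT : 0 < z.1 < T by move: Xz; rewrite /X/= !in_itv/= => -[].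
  have out c : ~ S c z -> d < `|z.2 - c z.1|.
    by move=> nS; rewrite ltNge; apply/negP => le; apply: nS.
  have DD : Delta_minus t r z <-> Delta_minus t' r' z.
    by apply: Delta_minus_far; [apply: (out c1)|apply: (out c2)|apply: (out c3)]; tauto.
  apply: (@le_trans _ _ (K1 * d * B)); last first.
    by rewrite /h X1 mulr1 lerDl mulr_ge0// !addr_ge0.
  have [Dz|nDz] := pselect (Delta_minus t r z); last first.
    have nDz' : ~ Delta_minus t' r' z by move=> /DD.
    by rewrite (f_out _ _ _ nDz) (f_out _ _ _ nDz') subr0 normr0.
  rewrite (f_in _ _ _ Dz) (f_in _ _ _ (DD.1 Dz)) -mulrBl normrM.
  have [a1 a2 a3 /andP[G0 GB]] := Dside _ _ _ t0 r0 trT Dz.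
  have [b1 _ b3 _] := Dside _ _ _ t'0 r'0 trT' (DD.1 Dz).
  apply: ler_pM; rewrite ?(ger0_norm G0)//.
  have [_ hh] := hK (t - z.1) r z.2 a1 a2 a3.
  apply: (le_trans (hh (t' - z.1) r' b1 b3)).
  by rewrite (_ : t - z.1 - (t' - z.1) = t - t'); last ring.
rewrite !fE -lee_fin.
apply: (le_trans (Rintegral_dist_le measurableT (int _ _ t0 r0 trT) (int _ _ t'0 r'0 trT') mh
  (fun z _ => hle z))).
have KB : 0 <= K1 * B by rewrite mulr_ge0// ltW.
have KdB : 0 <= K1 * d * B by rewrite !mulr_ge0// ltW.
have mI (A : set (R * R)) : measurable A -> measurable_fun setT (fun z => (\1_A z : R)%:E).
  by move=> mA; apply/measurable_EFinP; exact: measurable_indic.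
have I0 (A : set (R * R)) (z : R * R) : setT z -> (0 <= (\1_A z : R)%:E)%E by rewrite lee_fin indicE.
have -> : (\int[leb \x leb]_z (h z)%:E = (K1 * d * B)%:E * (leb \x leb) X +
    (K1 * B)%:E * ((leb \x leb) (S c1) + (leb \x leb) (S c2) + (leb \x leb) (S c3)))%E.
  have iE (A : set (R * R)) : measurable A ->
      ((leb \x leb) A = \int[leb \x leb]_z (\1_A z)%:E)%E.
    by move=> mA; rewrite integral_indic// setIT.
  rewrite !iE// -!ge0_integralD//; try solve [exact: mI|exact: I0
    |by apply: emeasurable_funD; exact: mI|by move=> z _; rewrite adde_ge0// I0].
  rewrite -!ge0_integralZl_EFin//; try solve [exact: mI|exact: I0
    |by do !apply: emeasurable_funD; exact: mI|by move=> z _; rewrite !adde_ge0// I0].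
  rewrite -ge0_integralD//; try solve [by move=> z _; rewrite mule_ge0 ?lee_fin// I0
    |by move=> z _; rewrite mule_ge0 ?lee_fin// !adde_ge0// I0
    |by apply: measurable_funeM; exact: mI
    |by apply: measurable_funeM; do !apply: emeasurable_funD; exact: mI].
apply: (@le_trans _ _ ((K1 * d * B)%:E * (T * T)%:E +
    (K1 * B)%:E * ((2 * d * T)%:E + (2 * d * T)%:E + (2 * d * T)%:E))%E).
  apply: leeD; apply: lee_wpmul2l; rewrite ?lee_fin//.
  by apply: (leeD (leeD muS1 muS2) muS3).
rewrite -[leLHS]/((K1 * d * B * (T * T) + K1 * B * (2 * d * T + 2 * d * T + 2 * d * T))%:E) lee_fin.
rewrite [leRHS](_ : _ = K1 * d * B * (T * T) +
  K1 * B * (2 * d * T + 2 * d * T + 2 * d * T) + d); last by rewrite -/d; ring.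
by rewrite lerDl.
Qed.

End duhamel_continuity.

(** * The initial data *)

Section initial_data.
Context {R : realType}.
Notation leb := (@lebesgue_measure R).
Implicit Types (x y t r mu nu eta kappa : R) (w f : R -> R).

Lemma within_dnbhs0_proper x : 0 <= x -> ProperFilter (within_dnbhs0 `[(0 : R), +oo[ x).
Proof.
move=> x0; apply: Build_ProperFilter_ex => P.
rewrite /within_dnbhs0 /within/= => /nbhs_ballP[e /= e0 he].
exists (e / 2); apply: he => /=.
- by rewrite /ball/= sub0r normrN gtr0_norm ?divr_gt0//; lra.
- by rewrite gt_eqF// divr_gt0.
- by rewrite in_itv/= andbT addr_ge0// divr_ge0// ltW.
Qed.

Lemma diff_quot_bound f x (l : R) : diff_quot f x @ within_dnbhs0 `[0, +oo[ x --> l ->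
  exists2 d : R, 0 < d & forall h, `|h| < d -> 0 <= x + h ->
    `|f (x + h) - f x| <= (`|l| + 1) * `|h|.
Proof.
move=> /cvgrPdist_lt /(_ 1 ltr01); rewrite /within_dnbhs0 near_withinE.
move=> /nbhs_ballP[d /= d0 hd]; exists d => // h hd' xh.
have [->|h0] := eqVneq h 0; first by rewrite addr0 subrr normr0 mulr0.
have := hd h; rewrite /ball/= sub0r normrN => /(_ hd' h0).
rewrite in_itv/= andbT => /(_ xh); rewrite /diff_quot.
set q := h^-1 * _ => lq.
have -> : f (x + h) - f x = q * h by rewrite /q mulrAC mulVf// mul1r.
rewrite normrM ler_wpM2r//.
by have := ler_normB l (l - q); rewrite subKr; lra.
Qed.

Lemma C1_on_C0_on f : C1_on `[0, +oo[ f -> C0_on `[0, +oo[ f.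
Proof.
move=> [df _]; apply/continuous_within_itvcyP.
have key x e : 0 <= x -> 0 < e ->
    exists2 d : R, 0 < d & forall y, 0 <= y -> `|x - y| < d -> `|f x - f y| <= e.
  move=> x0 e0.
  have [d d0 hd] := diff_quot_bound (df x (ltac:(by rewrite /= in_itv/= x0))).
  set l := lim _ in hd; have l0 : 0 < `|l| + 1 by rewrite ltr_wpDl.
  exists (Num.min d (e / (`|l| + 1))) => [|y y0]; first by rewrite lt_min d0 divr_gt0.
  rewrite lt_min distrC => /andP[h1 h2].
  have := hd (y - x) h1; rewrite addrC subrK distrC => /(_ y0) /le_trans; apply.
  by rewrite mulrC -ler_pdivlMr// ltW.
split => [x|].
  rewrite in_itv/= andbT => x0; apply/cvgrPdist_le => /= e e0.
  have [d d0 hd] := key x e (ltW x0) e0.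
  apply/nbhs_ballP; exists (Num.min d x) => /= [|y]; first by rewrite lt_min d0.
  rewrite /ball/= lt_min => /andP[xyd xyx]; apply: hd => //.
  by have := ler_norm (x - y); lra.
apply/cvgrPdist_le => /= e e0.
have [d d0 hd] := key 0 e (lexx 0) e0.
near=> y; apply: hd; first by near: y; exact: nbhs_right_ge.
rewrite sub0r normrN ger0_norm; first by near: y; exact: nbhs_right_lt.
by near: y; exact: nbhs_right_ge.
Unshelve. all: by end_near. Qed.

(** Leibniz rule for the relative derivative, endpoint included: the difference quotient of x f(x)
    at r is f(r+h) plus r times that of f, and f(r+h) is controlled by the local Lipschitz bound. *)
Lemma derive_in_mulid f r : C1_on `[0, +oo[ f -> 0 <= r ->
  derive_in `[0, +oo[ (fun x => x * f x) r = f r + r * derive_in `[0, +oo[ f r.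
Proof.
move=> cf r0; have PF := within_dnbhs0_proper r0.
have rA : `[(0:R), +oo[%classic r by rewrite /= in_itv/= r0.
have dr : diff_quot f r @ within_dnbhs0 `[0, +oo[ r --> derive_in `[0, +oo[ f r := cf.1 r rA.
apply: cvg_lim => //; apply/cvgrPdist_le => /= e e0.
have [d d0 hd] := diff_quot_bound dr.
set l := derive_in _ _ _ in dr hd *.
have l0 : 0 < `|l| + 1 by rewrite ltr_wpDl.
move: dr => /cvgrPdist_le /(_ (e / 2 / (r + 1))).
have e1 : 0 < e / 2 / (r + 1) by rewrite !divr_gt0//; lra.
move=> /(_ e1); rewrite /within_dnbhs0 !near_withinE.
move=> /nbhs_ballP[d' /= d'0 hd']; apply/nbhs_ballP.
exists (Num.min (Num.min d d') (e / 2 / (`|l| + 1))) => /=.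
  by rewrite !lt_min d0 d'0 !divr_gt0.
move=> h; rewrite /ball/= sub0r normrN !lt_min => /andP[/andP[h1 h2] h3] h0 rh.
have rh' : 0 <= r + h by move: rh; rewrite in_itv/= andbT.
have := hd' h; rewrite /ball/= sub0r normrN => /(_ h2 h0 rh) b1.
have b2 := hd h h1 rh'.
have -> : f r + r * l - diff_quot (fun x => x * f x) r h =
    - (f (r + h) - f r) + r * (l - diff_quot f r h).
  by rewrite /diff_quot; field.
apply: (le_trans (ler_normD _ _)); rewrite normrN normrM (ger0_norm r0).
have b3 : (`|l| + 1) * `|h| <= e / 2 by rewrite mulrC -ler_pdivlMr// ltW.
have b4 : r * `|l - diff_quot f r h| <= e / 2.
  apply: (@le_trans _ _ ((r + 1) * (e / 2 / (r + 1)))).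
    by apply: ler_pM => //; lra.
  by rewrite mulrC divfK// gt_eqF//; lra.
lra.
Qed.

(** Freezing f at its value at 0 turns relative continuity into continuity on the line; this form
    suits the boundary term of the free solution. *)
Lemma C0_on_max f : C0_on `[0, +oo[ f -> continuous (fun s : R => f (Num.max s 0)).
Proof.
move=> /continuous_within_itvcyP[cf cf0] x.
have [x0|x0|x0] := ltgtP x 0.
- apply/cvgrPdist_le => /= e e0; apply/nbhs_ballP; exists (- x) => /= [|y]; first by lra.
  rewrite /ball/= => xy; have y0 : y <= 0 by have := ler_norm (- (x - y)); rewrite normrN; lra.
  by rewrite (max_idPr (ltW x0)) (max_idPr y0) subrr normr0 ltW.
- have : {for x, continuous f} by apply: cf; rewrite in_itv/= x0.
  move=> /cvgrPdist_le cx; apply/cvgrPdist_le => /= e e0.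
  have /nbhs_ballP[d /= d0 hd] := cx e e0.
  apply/nbhs_ballP; exists (Num.min d x) => /= [|y]; first by rewrite lt_min d0.
  rewrite /ball/= lt_min => /andP[xyd xyx].
  have y0 : 0 <= y by have := ler_norm (x - y); lra.
  by rewrite (max_idPl (ltW x0)) (max_idPl y0); exact: hd.
- rewrite x0; apply/cvgrPdist_le => /= e e0; rewrite maxxx.
  move: cf0 => /cvgrPdist_le /(_ e e0) /nbhs_ballP[d /= d0 hd].
  apply/nbhs_ballP; exists d => //= y yd.
  have [y0|y0] := leP y 0; first by rewrite subrr normr0 ltW.
  exact: hd.
Qed.

(** The asymptotics 2w ~ mu/r make w a quantity of order 1/y at infinity, so the potential term w(y)
    y f0(y) of the data decays no worse than f0. *)
Lemma weight_potential_bound w mu : C0_on `[0, +oo[ w ->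
  short_range_perturbation mu w ->
  exists2 c : R, 0 < c & forall y, 0 <= y -> `|w y * y| <= c.
Proof.
move=> cw [r0 [d [C [wt [r00 d0 C0 hw]]]]].
have [K K0 hK] := C0_on_pos_bounded cw (ltW r00).
exists (K * r0 + (`|mu| + C * r0 `^ (- d))) => [|y y0].
  by rewrite ltr_pwDl ?mulr_gt0// addr_ge0// mulr_ge0 ?powR_ge0// ltW.
have p0 : 0 <= C * r0 `^ (- d) by rewrite mulr_ge0 ?powR_ge0// ltW.
have [yr|yr] := leP r0 y.
  have yp : 0 < y by lra.
  have [e b] := hw y yr.
  have -> : w y * y = (mu + wt y * y) / 2.
    have -> : w y = (mu / y + wt y) / 2 by rewrite -e; field.
    by field; lra.
  have h : `|wt y * y| <= C * r0 `^ (- d).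
    rewrite normrM (gtr0_norm yp).
    apply: (@le_trans _ _ (C * y `^ (- 1 - d) * y)); first by rewrite ler_pM2r.
    rewrite -mulrA ler_pM2l// -[X in _ * X](powRr1 (ltW yp)) -gt0_powRD//.
    rewrite (_ : - 1 - d + 1 = - d); last lra.
    by apply: le0_ger_powR => //; lra.
  rewrite normrM (@ger0_norm _ 2^-1)//.
  have := ler_normD mu (wt y * y); have := normr_ge0 mu.
  have : 0 <= K * r0 by rewrite mulr_ge0// ltW.
  lra.
have := hK y; rewrite y0 ltW// => /(_ isT) b.
rewrite normrM (ger0_norm y0).
have : `|w y| * y <= K * r0 by apply: ler_pM => //; lra.
have := normr_ge0 mu; lra.
Qed.

Definition data_density w (f0 f1 : R -> R) (y : R) : R :=
  y * f1 y + derive_in `[0, +oo[ (fun x => x * f0 x) y + w y * (y * f0 y).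

Lemma measurable_data_density w (f0 f1 : R -> R) : C0_on `[0, +oo[ w -> C1_on `[0, +oo[ f0 ->
  C0_on `[0, +oo[ f1 -> measurable_fun (`[0, +oo[%classic : set R) (data_density w f0 f1).
Proof.
move=> cw cf0 cf1.
have mC f : C0_on `[0, +oo[ f -> measurable_fun (`[0, +oo[%classic : set R) f.
  by move=> cf; exact: C0_on_pos_measurable.
apply: (@eq_measurable_fun _ _ _ _ _ (fun y => y * f1 y +
  (f0 y + y * derive_in `[0, +oo[ f0 y) + w y * (y * f0 y))).
  move=> y; rewrite inE/= in_itv/= andbT => y0.
  by rewrite /data_density derive_in_mulid.
have m0 := mC _ (C1_on_C0_on cf0); have m1 := mC _ cf1; have m2 := mC _ cf0.2.
have m3 := mC _ cw.
apply: measurable_funD; [apply: measurable_funD|].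
- exact: measurable_funM.
- by apply: measurable_funD => //; exact: measurable_funM.
- by apply: measurable_funM => //; exact: measurable_funM.
Qed.

Lemma data_density_bound w mu (f0 f1 : R -> R) kappa : C0_on `[0, +oo[ w ->
  short_range_perturbation mu w ->
  C1_on `[0, +oo[ f0 ->
  (forall r, 0 <= r -> `|f0 r| <= jap r `^ (- kappa)) ->
  (forall r, 0 <= r -> `|derive_in `[0, +oo[ f0 r| + `|f1 r| <= jap r `^ (- kappa - 1)) ->
  exists2 c : R, 0 < c & forall y, 0 <= y ->
    `|data_density w f0 f1 y| <= c * (1 + y) `^ (- kappa).
Proof.
move=> cw hw cf0 hf0 hf1; have [c c0 hc] := weight_potential_bound cw hw.
exists ((2 + c) * 2 `^ `|- kappa|) => [|y y0].
  by rewrite mulr_gt0 ?powR_gt0//; lra.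
apply: (@le_trans _ _ ((2 + c) * jap y `^ (- kappa))); last first.
  rewrite -mulrA ler_wpM2l//; first lra.
  by have := jap_powR_le (- kappa) y; rewrite (ger0_norm y0).
rewrite /data_density derive_in_mulid//.
set D := derive_in _ _ _; set J := jap y `^ (- kappa).
have J0 : 0 <= J := powR_ge0 _ _.
have a1 := hf0 y y0; rewrite -/J in a1.
have a2 : y * (`|D| + `|f1 y|) <= J.
  apply: (@le_trans _ _ (jap y * jap y `^ (- kappa - 1))).
    apply: ler_pM => //; last exact: hf1.
    have : `|y| <= jap y by rewrite -sqrtr_sqr /jap ler_wsqrtr// lerDr.
    by rewrite ger0_norm.
  rewrite -[X in X * _](powRr1 (ltW (jap_gt0 y))) -gt0_powRD ?jap_gt0//.
  by rewrite addrCA subrr addr0.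
have a3 : `|w y * y * f0 y| <= c * J by rewrite normrM; apply: ler_pM => //; exact: hc.
have -> : y * f1 y + (f0 y + y * D) + w y * (y * f0 y) =
  y * f1 y + y * D + f0 y + w y * y * f0 y by ring.
have b1 := ler_normD (y * f1 y + y * D + f0 y) (w y * y * f0 y).
have b2 := ler_normD (y * f1 y + y * D) (f0 y).
have b3 := ler_normD (y * f1 y) (y * D).
by rewrite !normrM (ger0_norm y0) in b3; nra.
Qed.

End initial_data.

(** * The free solution *)

Section free_solution.
Context {R : realType}.
Notation leb := (@lebesgue_measure R).
Implicit Types (x y t r mu nu eta kappa : R) (w f g : R -> R).

Lemma normr_Rintegral_le d (T : measurableType d) (m : {measure set T -> \bar R})
    (D : set T) (f : T -> R) : measurable D -> measurable_fun D f ->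
  ((`|\int[m]_(x in D) f x|)%:E <= \int[m]_(x in D) (`|f x|)%:E)%E.
Proof.
move=> mD mf; apply: (@le_trans _ _ `|\int[m]_(x in D) (f x)%:E|%E).
  by rewrite /Rintegral; case: (\int[m]_(x in D) (f x)%:E)%E => [r| |]//=;
     rewrite normr0 leey.
by apply: le_abse_integral => //; exact/measurable_EFinP.
Qed.

Lemma ratio_le (s r : R) : 0 <= s -> s <= r -> s / (1 + s) <= r / (1 + r).
Proof.
move=> s0 sr; have s1 : 0 < 1 + s by lra.
have r1 : 0 < 1 + r by lra.
by rewrite ler_pdivrMr// mulrAC ler_pdivlMr// !mulrDr !mulr1 [r * s]mulrC lerD2r.
Qed.

(** Based on the monotonicity of x/(1+x). For nu <= 0 the whole expression increases with r-t, so
    r-t is replaced by r, and 1+r is comparable to 1+t+r because t <= r. For nu > 0 the power of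
    1+(r-t) is kept as the factor in <t-r>, and only (r-t)/(1+(r-t)) is enlarged to r/(1+r). *)
Lemma boundary_decay nu eta : 0 < eta -> exists2 C : R, 0 < C & forall t r,
  0 <= t -> 0 < r -> t <= r ->
  (r - t) * (1 + (r - t)) `^ (- 1 - nu) <= C * (r * decay nu eta t r).
Proof.
move=> eta0; have [C0 C00 hC0] := decay_ge nu eta0.
exists (2 `^ `|- 1 - nu| * C0 + 2) => [|t r t0 r0 tr].
  by rewrite addr_gt0// mulr_gt0 ?powR_gt0.
set s := r - t; have s0 : 0 <= s by rewrite /s; lra.
have s1 : 0 < 1 + s by lra.
have r1 : 0 < 1 + r by lra.
have d0 := decay_ge0 nu eta0 t0 (ltW r0).
have split e x : 0 < 1 + x -> x * (1 + x) `^ (- 1 - e) = x / (1 + x) * (1 + x) `^ (- e).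
  by move=> x1; rewrite gt0_powRD// (powR_inv1 (ltW x1)) mulrA.
have rd := ratio_le s0 (_ : s <= r); rewrite /s in rd; move: rd => /(_ ltac:(lra)); rewrite -/s => rd.
have sr0 : 0 <= s / (1 + s) by rewrite divr_ge0// ltW.
rewrite [leRHS]mulrDl; have [nu0|nu0] := leP nu 0.
  apply: (@le_trans _ _ (2 `^ `|- 1 - nu| * C0 * (r * decay nu eta t r))); last first.
    by rewrite lerDl mulr_ge0// mulr_ge0// ltW.
  apply: (@le_trans _ _ (r * (1 + r) `^ (- 1 - nu))).
    rewrite !split//; apply: ler_pM => //; first exact: powR_ge0.
    by apply: ge0_ler_powR; rewrite ?nnegrE /s; lra.
  rewrite [leRHS](_ : _ = r * (2 `^ `|- 1 - nu| * (C0 * decay nu eta t r))); last by ring.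
  rewrite ler_pM2l//.
  apply: (@le_trans _ _ (2 `^ `|- 1 - nu| * (1 + (t + r)) `^ (- 1 - nu))).
    by apply: powR_comparable; lra.
  rewrite ler_pM2l ?powR_gt0//.
  by have := hC0 t r t0 (ltW r0); rewrite /decay_rate nu0.
apply: (@le_trans _ _ (2 * (r * decay nu eta t r))); last first.
  by rewrite lerDr !mulr_ge0 ?powR_ge0 ?(ltW C00) ?(ltW r0).
set m := Num.min nu eta.
have m0 : 0 < m by rewrite lt_min nu0.
have mnu : m <= nu by rewrite ge_min lexx.
rewrite split// /decay (ltNge nu) (ltW nu0)/= gt_eqF// -/m.
apply: (@le_trans _ _ (r / (1 + r) * jap (t - r) `^ (- m))).
  apply: ler_pM => //; first exact: powR_ge0.
  apply: (@le_trans _ _ ((1 + s) `^ (- m))); first by apply: ler_powR; lra.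
  apply: le0_ger_powR; [lra|exact: jap_gt0|].
  by have := jap_le (t - r); rewrite distrC ger0_norm// /s; lra.
rewrite !mulrA ler_wpM2r ?powR_ge0// [2 * r]mulrC -mulrA ler_pM2l//.
rewrite ler_pdivlMr ?jap_gt0// mulrC ler_pdivrMr//.
by apply: (le_trans (jap_le _)); rewrite ger0_norm; lra.
Qed.

(** The data density is O((1+y)^(-kappa)) and the kernel multiplies it by (1+y)^(mu/2), which yields
    the exponent -1-nu. Since nu is at least [decay_rate nu eta], the integral falls under the
    estimate already used for the outer Duhamel integral. *)
Lemma uL_weight_le w mu kappa eta (f0 f1 : R -> R) : 0 <= mu -> mu / 2 < kappa ->
  C0_on `[0, +oo[ w ->
  short_range_perturbation mu w ->
  C1_on `[0, +oo[ f0 -> C0_on `[0, +oo[ f1 ->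
  (forall r, 0 <= r -> `|f0 r| <= jap r `^ (- kappa)) ->
  (forall r, 0 <= r -> `|derive_in `[0, +oo[ f0 r| + `|f1 r| <= jap r `^ (- kappa - 1)) ->
  0 < eta ->
  exists2 C : R, 0 < C & forall t r, 0 <= t -> 0 < r ->
    `|uL w (fun r => r * f0 r) (fun r => r * f1 r) t r| <=
      C * weight mu (kappa - mu / 2 - 1) eta t r.
Proof.
move=> mu0 hk cw hw cf0 cf1 hf0 hf1 eta0.
set nu := kappa - mu / 2 - 1.
have [c c0 hc] := Eminus_le mu0 cw hw.
have [b b0 hb] := data_density_bound cw hw cf0 hf0 hf1.
have [C1 C10 hC1] := light_cone_integral nu eta0.
have [C2 C20 hC2] := boundary_decay nu eta0.
set c2 := 2 `^ `|- (mu / 2)| : R.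
have c20 : 0 < c2 by exact: powR_gt0.
set c3 := 2 `^ `|- kappa| : R.
have c30 : 0 < c3 by exact: powR_gt0.
exists (c * b * C1 * c2 + c * c3 * C2 * c2) => [|t r t0 r0].
  by rewrite addr_gt0// !mulr_gt0.
have d0 := decay_ge0 nu eta0 t0 (ltW r0).
have hj : (1 + r) `^ (- (mu / 2)) <= c2 * jap r `^ (- (mu / 2)).
  by have := jap_powR_ge (- (mu / 2)) r; rewrite (ger0_norm (ltW r0)).
have abs0 := normr_ge0 (t - r).
have fac K x : 0 <= K -> x <= K * (1 + r) `^ (- (mu / 2)) * (r * decay nu eta t r) ->
    x <= K * c2 * weight mu nu eta t r.
  move=> K0 /le_trans; apply.
  rewrite (_ : K * c2 * _ = K * (c2 * jap r `^ (- (mu / 2))) * (r * decay nu eta t r)).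
    rewrite ler_wpM2r ?mulr_ge0 ?(ltW r0)//; exact: ler_wpM2l.
  by rewrite /weight; ring.
rewrite [leRHS]mulrDl; apply: (le_trans (ler_normD _ _)); apply: lerD.
  set I := (X in `|2^-1 * X|).
  have hI : `|I| <= c * b * C1 * c2 * weight mu nu eta t r.
    apply: fac; first by rewrite !mulr_ge0 ?(ltW c0) ?(ltW b0) ?(ltW C10).
    have sub : `[`|t - r|, t + r] `<=` (`[0, +oo[%classic : set R).
      by move=> y /=; rewrite !in_itv/= andbT => /andP[/(le_trans abs0)].
    have mI : measurable_fun `[`|t - r|, t + r] (fun y => Eminus w t r y * data_density w f0 f1 y).
      apply: measurable_funM.
        by apply: measurable_fun_Eminus.
      by apply: measurable_funS (measurable_data_density cw cf0 cf1).
    rewrite -lee_fin; apply: (le_trans (@normr_Rintegral_le _ _ leb _ _ (measurable_itv _) mI)).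
    pose k := c * b * (1 + r) `^ (- (mu / 2)).
    have k0 : 0 <= k by rewrite !mulr_ge0 ?powR_ge0 ?(ltW c0) ?(ltW b0).
    have mp : measurable_fun `[`|t - r|, t + r] (fun y : R => ((1 + y) `^ (- 1 - decay_rate nu eta))%:E).
      by apply/measurable_EFinP; apply: measurable_fun_powR; exact: measurable_funD.
    apply: (@le_trans _ _ (\int[leb]_(y in `[`|t - r|%R, (t + r)%R])
        (k%:E * ((1 + y) `^ (- 1 - decay_rate nu eta))%:E))%E).
      apply: ge0_le_integral => //.
      - by apply/measurable_EFinP; exact: measurableT_comp mI.
      - exact: measurable_funeM mp.
      move=> y /=; rewrite in_itv/= => /andP[y1 y2].
      have y0 : 0 <= y := le_trans abs0 y1.
      rewrite -EFinM lee_fin normrM ger0_norm ?Eminus_ge0//.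
      apply: (@le_trans _ _ (c * ((1 + r) `^ (- (mu / 2)) * (1 + y) `^ (mu / 2)) *
         (b * (1 + y) `^ (- kappa)))).
        apply: ler_pM; rewrite ?Eminus_ge0 ?hb//.
        apply: hc => //; first exact: ltW.
          by have := ler_norm (t - r); lra.
        by have := ler_norm (- (t - r)); rewrite normrN; lra.
      rewrite (_ : _ * _ * (b * _) = k * ((1 + y) `^ (mu / 2) * (1 + y) `^ (- kappa))); last first.
        by rewrite /k; ring.
      rewrite -gt0_powRD ?ler_wpM2l//; last lra.
      apply: ler_powR; first lra.
      rewrite /decay_rate; case: ifP => _; first by rewrite /nu; lra.
      have : Num.min nu eta <= nu by rewrite ge_min lexx.
      by rewrite {2}/nu; lra.
    rewrite ge0_integralZl_EFin//; try solve [by move=> z _; rewrite lee_fin powR_ge0|exact: mp].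
    apply: (le_trans (lee_wpmul2l _ (hC1 t r t0 r0))); first by rewrite lee_fin.
    by rewrite -EFinM lee_fin /k le_eqVlt; apply/orP; left; apply/eqP; ring.
  rewrite normrM (@ger0_norm _ 2^-1)//; apply: le_trans hI.
  by have := normr_ge0 I; lra.
apply: fac; first by rewrite !mulr_ge0 ?(ltW c0) ?(ltW c30) ?(ltW C20).
rewrite /chi; case: ifPn => rt; last first.
  by rewrite !mul0r normr0 !mulr_ge0 ?powR_ge0 ?(ltW c0) ?(ltW c30) ?(ltW C20) ?(ltW r0).
rewrite mul1r normrM ger0_norm ?Eminus_ge0//.
set s := r - t in rt *.
have s1 : 0 < 1 + s by lra.
have hE : Eminus w t r s <= c * ((1 + r) `^ (- (mu / 2)) * (1 + s) `^ (mu / 2)).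
  by have rt' : 0 <= r - t := rt; apply: hc; rewrite /s; lra.
have hp : `|s * f0 s| <= s * (c3 * (1 + s) `^ (- kappa)).
  rewrite normrM (ger0_norm rt) ler_wpM2l//; apply: (le_trans (hf0 s rt)).
  by have := jap_powR_le (- kappa) s; rewrite (ger0_norm rt).
apply: (le_trans (ler_pM _ _ hE hp)); rewrite ?Eminus_ge0//.
have := hC2 t r t0 r0; rewrite -/s => /(_ ltac:(rewrite /s in rt; lra)) h.
rewrite [leLHS](_ : _ = c * c3 * (1 + r) `^ (- (mu / 2)) * (s * ((1 + s) `^ (mu / 2) * (1 + s) `^ (- kappa)))); last by ring.
rewrite -gt0_powRD// (_ : mu / 2 - kappa = - 1 - nu); last by rewrite /nu; ring.
rewrite [leRHS](_ : _ = c * c3 * (1 + r) `^ (- (mu / 2)) * (C2 * (r * decay nu eta t r))); last by ring.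
by rewrite ler_wpM2l// !mulr_ge0 ?powR_ge0 ?(ltW c0) ?(ltW c30).
Qed.

Lemma lipschitz_within_continuous (u : R -> R -> R) :
  (forall T : R, exists2 K : R, 0 < K & forall t r t' r', 0 <= t -> 0 < r -> t + r <= T ->
    0 <= t' -> 0 < r' -> t' + r' <= T -> `|u t r - u t' r'| <= K * (`|t - t'| + `|r - r'|)) ->
  {within `[0, +oo[ `*` `]0, +oo[, continuous (fun z : R * R => u z.1 z.2)}.
Proof.
move=> hu; apply/subspace_continuousP => -[t r] [/=].
rewrite !in_itv/= !andbT => t0 r0.
have [K K0 hK] := hu (t + r + 2).
apply/cvgrPdist_le => /= e e0; rewrite near_withinE.
apply/nbhs_ballP; exists (Num.min 1 (e / (2 * K))) => /= [|[t' r'] [/=]].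
  by rewrite lt_min ltr01 divr_gt0// mulr_gt0.
rewrite /ball/= !lt_min => /andP[t1 t2] /andP[r1 r2] [/=].
rewrite !in_itv/= !andbT => t'0 r'0.
have n1 := ler_norm (- (t - t')); have n2 := ler_norm (- (r - r')).
rewrite !normrN in n1 n2.
apply: (le_trans (hK t r t' r' t0 r0 _ t'0 r'0 _)); [lra|lra|].
have : `|t - t'| + `|r - r'| <= e / K.
  have -> : e / K = e / (2 * K) + e / (2 * K) by field; rewrite gt_eqF.
  by rewrite lerD// ltW.
by rewrite ler_pdivlMr// mulrC.
Qed.

(** One-dimensional counterpart of [duhamel_lipschitz]: the strips become intervals of radius d
    around the two endpoints |t-r| and t+r. *)
Lemma free_integral_lipschitz w g (T B : R) : C0_on `[0, +oo[ w -> 0 <= T -> 0 <= B ->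
  measurable_fun (`[0, +oo[%classic : set R) g -> (forall y, 0 <= y -> `|g y| <= B) ->
  exists2 K : R, 0 < K & forall t r t' r', 0 <= t -> 0 < r -> t + r <= T ->
    0 <= t' -> 0 < r' -> t' + r' <= T ->
   `|\int[leb]_(y in `[`|t - r|, t + r]) (Eminus w t r y * g y) -
     \int[leb]_(y in `[`|t' - r'|, t' + r']) (Eminus w t' r' y * g y)| <=
     K * (`|t - t'| + `|r - r'|).
Proof.
move=> cw T0 B0 mg hg; have [K1 K10 hK] := Eminus_lipschitz cw T0.
have KB : 0 <= K1 * B by rewrite mulr_ge0// ltW.
pose D : set R := `[0, T]%classic.
have mD : measurable D by exact: measurable_itv.
have D0 : D `<=` (`[0, +oo[%classic : set R).
  by move=> y; rewrite /D/= !in_itv/= andbT => /andP[].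
pose J t r : set R := `[`|t - r|, t + r]%classic.
pose f t r y := \1_(J t r) y * (Eminus w t r y * g y).
have JD t r : t + r <= T -> J t r `<=` D.
  move=> tr y; rewrite /J /D/= !in_itv/= => /andP[a b].
  by rewrite (le_trans (normr_ge0 _) a)/=; lra.
have f_in t r y : J t r y -> f t r y = Eminus w t r y * g y.
  by move=> Jy; rewrite /f indicE mem_set// mul1r.
have f_out t r y : ~ J t r y -> f t r y = 0.
  by move=> Jy; rewrite /f indicE memNset// mul0r.
have fE t r : t + r <= T ->
    \int[leb]_(y in J t r) (Eminus w t r y * g y) = \int[leb]_(y in D) f t r y.
  move=> tr; rewrite Rintegral_mkcond [RHS]Rintegral_mkcond.
  apply: eq_Rintegral => y _; rewrite !patchE.
  case: ifPn => [|/negP nJ].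
    by rewrite inE => Jy; rewrite mem_set ?f_in//; exact: JD Jy.
  by case: ifP => // _; rewrite f_out// => Jy; apply: nJ; rewrite inE.
have mJ t r : measurable (J t r) by exact: measurable_itv.
have mf t r : measurable_fun D (f t r).
  apply: measurable_funM; first by apply: measurable_indic; exact: mJ.
  apply: measurable_funM; first exact: measurable_fun_Eminus.
  exact: measurable_funS mg.
have Jside t r y : 0 <= t -> 0 < r -> t + r <= T -> J t r y ->
    [/\ 0 <= y, r <= T, y <= T & (y - t + r) / 2 <= T].
  move=> t0 r0 tr; rewrite /J/= in_itv/= => /andP[a b].
  by have := normr_ge0 (t - r); split; lra.
have fb t r y : 0 <= t -> 0 < r -> t + r <= T -> `|f t r y| <= K1 * B.
  move=> t0 r0 tr; have [Jy|nJ] := pselect (J t r y); last by rewrite f_out// normr0.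
  have [y0 a1 a2 a3] := Jside _ _ _ t0 r0 tr Jy.
  rewrite f_in// normrM ger0_norm ?Eminus_ge0//; apply: ler_pM; rewrite ?Eminus_ge0 ?hg//.
  by have [] := hK t r y a1 a2 a3.
have muD : (leb D <= T%:E)%E.
  rewrite /D lebesgue_measure_itv/= lte_fin; case: ifP => _; last by rewrite lee_fin.
  by rewrite -EFinB subr0.
have int t r : 0 <= t -> 0 < r -> t + r <= T -> leb.-integrable D (EFin \o f t r).
  move=> t0 r0 tr; apply: (@le_integrable _ _ _ leb D mD _ (cst (K1 * B)%:E)).
  - by apply/measurable_EFinP; exact: mf.
  - by move=> y _ /=; rewrite lee_fin (ger0_norm KB) fb.
  - apply/integrableP; split; first exact: measurable_cst.
    rewrite (_ : (fun _ => _) = cst (K1 * B)%:E); last by apply/funext => y /=; rewrite ger0_norm.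
    rewrite integral_cst//; apply: (@le_lt_trans _ _ ((K1 * B)%:E * T%:E)%E).
      by apply: lee_wpmul2l; rewrite ?lee_fin.
    by rewrite -EFinM ltry.
(* The 8 is two intervals of length 2d times the bound 2 K1 B; the additional factor 2 is due to g
   being signed. *)
exists (K1 * B * T + 8 * (K1 * B) + 1) => [|t r t' r' t0 r0 tr t'0 r'0 tr'].
  by rewrite ltr_wpDl// addr_ge0// mulr_ge0.
rewrite -[X in `|X - _|]/(\int[leb]_(y in J t r) (Eminus w t r y * g y)).
rewrite -[X in `|_ - X|]/(\int[leb]_(y in J t' r') (Eminus w t' r' y * g y)).
rewrite (fE _ _ tr) (fE _ _ tr').
set d := `|t - t'| + `|r - r'|.
have d0 : 0 <= d by rewrite addr_ge0.
have KdB : 0 <= K1 * d * B by rewrite !mulr_ge0// ltW.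
pose S (q : R) : set R := `[q - d, q + d]%classic.
have mS q : measurable (S q) by exact: measurable_itv.
have muS q : (leb (S q) <= (2 * d)%:E)%E.
  rewrite /S lebesgue_measure_itv/= lte_fin; case: ifP => _; last by rewrite lee_fin mulr_ge0.
  by rewrite -EFinB lee_fin; lra.
pose h y := K1 * d * B + 2 * (K1 * B) * (\1_(S `|t - r|) y + \1_(S (t + r)) y).
have hle y : D y -> `|f t r y - f t' r' y| <= h y.
  move=> Dy.
  have I q : 0 <= \1_(S q) y :> R by rewrite indicE.
  have I1 q : S q y -> \1_(S q) y = 1 :> R by move=> Sy; rewrite indicE mem_set.
  have [in1|ni1] := pselect (S `|t - r| y \/ S (t + r) y).
    have one : 1 <= \1_(S `|t - r|) y + \1_(S (t + r)) y :> R.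
      have := I `|t - r|; have := I (t + r).
      by case: in1 => /I1 ->; lra.
    apply: (le_trans (ler_normB _ _)).
    apply: (@le_trans _ _ (2 * (K1 * B) * 1)).
      by rewrite mulr1 mulr_natl mulr2n; apply: lerD; exact: fb.
    apply: (@le_trans _ _ (2 * (K1 * B) * (\1_(S `|t - r|) y + \1_(S (t + r)) y))).
      by apply: ler_wpM2l one; rewrite mulr_ge0.
    by rewrite /h lerDr.
  have out q : ~ S q y -> d < `|y - q|.
    move=> nS; rewrite ltNge; apply/negP; rewrite ler_distl => /andP[a b].
    by apply: nS; rewrite /S/= in_itv/= a b.
  have e1 : `| `|t - r| - `|t' - r'| | <= d.
    apply: (le_trans (ler_dist_dist _ _)).
    by rewrite (_ : t - r - (t' - r') = (t - t') - (r - r')); [exact: ler_normB|ring].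
  have e2 : `|t + r - (t' + r')| <= d.
    by rewrite (_ : t + r - (t' + r') = (t - t') + (r - r')); [exact: ler_normD|ring].
  have JJ : J t r y <-> J t' r' y.
    rewrite /J/= !in_itv/= !(leNgt _ y) !(leNgt y).
    have [_ ->] := lt_far (out _ (fun s => ni1 (or_introl s))) e1.
    by have [-> _] := lt_far (out _ (fun s => ni1 (or_intror s))) e2.
  apply: (@le_trans _ _ (K1 * d * B)); last first.
    by rewrite /h lerDl; apply: mulr_ge0; [rewrite mulr_ge0|rewrite addr_ge0].
  have [Jy|nJ] := pselect (J t r y); last first.
    have nJ' : ~ J t' r' y by move=> /JJ.
    by rewrite (f_out _ _ _ nJ) (f_out _ _ _ nJ') subr0 normr0.
  rewrite (f_in _ _ _ Jy) (f_in _ _ _ (JJ.1 Jy)) -mulrBl normrM.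
  have [y0 a1 a2 a3] := Jside _ _ _ t0 r0 tr Jy.
  have [_ b1 _ b3] := Jside _ _ _ t'0 r'0 tr' (JJ.1 Jy).
  apply: ler_pM; rewrite ?hg//.
  by have [_ hh] := hK t r y a1 a2 a3; exact: hh.
have mI q : measurable_fun D (fun y => (\1_(S q) y : R)%:E).
  by apply/measurable_EFinP; apply: measurable_indic; exact: mS.
have I0 q y : D y -> (0 <= (\1_(S q) y : R)%:E)%E by rewrite lee_fin indicE.
have mh : measurable_fun D h.
  apply: measurable_funD => //; apply: measurable_funM => //.
  by apply: measurable_funD; apply: measurable_indic; exact: mS.
rewrite -lee_fin.
apply: (le_trans (Rintegral_dist_le (m := leb) mD (int _ _ t0 r0 tr) (int _ _ t'0 r'0 tr') mh hle)).
have -> : (\int[leb]_(y in D) (h y)%:E = (K1 * d * B)%:E * leb D +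
    (2 * (K1 * B))%:E * (leb (S `|t - r|%R `&` D) + leb (S (t + r)%R `&` D)))%E.
  have iE q : (leb (S q `&` D) = \int[leb]_(y in D) (\1_(S q) y)%:E)%E.
    by apply/esym; apply: integral_indic => //; exact: mS.
  have k2 : 0 <= 2 * (K1 * B) by rewrite mulr_ge0.
  have mI2 : measurable_fun D (fun y => ((\1_(S `|t - r|%R) y : R)%:E + (\1_(S (t + r)%R) y)%:E))%E.
    by apply: emeasurable_funD; exact: mI.
  rewrite !iE -ge0_integralD//; try solve [exact: mI|exact: I0].
  rewrite -ge0_integralZl_EFin//; try solve [exact: mI2|by move=> y Dy; rewrite adde_ge0 ?I0].
  rewrite -(integral_cst leb mD) -ge0_integralD//;
    try solve [by move=> y Dy; rewrite lee_fin
    |by move=> y Dy; rewrite mule_ge0 ?lee_fin// adde_ge0 ?I0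
    |exact: measurable_funeM mI2].
apply: (@le_trans _ _ ((K1 * d * B)%:E * T%:E + (2 * (K1 * B))%:E * ((2 * d)%:E + (2 * d)%:E))%E).
  have sub q : (leb (S q `&` D) <= (2 * d)%:E)%E.
    apply: le_trans (muS q); apply: le_measure; rewrite ?inE; [|exact: mS|exact: subIsetl].
    by apply: measurableI => //; exact: mS.
  apply: leeD; apply: lee_wpmul2l; rewrite ?lee_fin//; first by rewrite mulr_ge0.
  exact: (leeD (sub _) (sub _)).
rewrite -[leLHS]/((K1 * d * B * T + 2 * (K1 * B) * (2 * d + 2 * d))%:E) lee_fin.
rewrite [leRHS](_ : _ = K1 * d * B * T + 2 * (K1 * B) * (2 * d + 2 * d) + d); last by rewrite -/d; ring.
by rewrite lerDl.
Qed.

Lemma uL_continuous w (f0 f1 : R -> R) (B : R) : C0_on `[0, +oo[ w ->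
  C1_on `[0, +oo[ f0 -> C0_on `[0, +oo[ f1 -> 0 <= B ->
  (forall y, 0 <= y -> `|data_density w f0 f1 y| <= B) ->
  {within `[0, +oo[ `*` `]0, +oo[, continuous
    (fun z : R * R => uL w (fun r => r * f0 r) (fun r => r * f1 r) z.1 z.2)}.
Proof.
move=> cw cf0 cf1 B0 hB.
pose I t r := \int[leb]_(y in `[`|t - r|, t + r]) (Eminus w t r y * data_density w f0 f1 y).
have cI : {within `[0, +oo[ `*` `]0, +oo[, continuous (fun z : R * R => I z.1 z.2)}.
  apply: lipschitz_within_continuous => T.
  have T0 : 0 <= `|T| by [].
  have [K K0 hK] := free_integral_lipschitz cw T0 B0 (measurable_data_density cw cf0 cf1) hB.
  exists K => // t r t' r' t0 r0 tr t'0 r'0 tr'.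
  by apply: hK => //; apply: (le_trans _ (ler_norm T)).
(* The boundary term without its cutoff. At y = r-t the midpoint is r-t itself, so E_- reduces to
   exp(W(r-t) - W(r)). The jump of [chi] is harmless because s f0(s) vanishes at s = 0, which lets
   max(r-t,0) replace it. *)
pose b (z : R * R) := expR (primW w (z.2 - z.1) - primW w z.2) *
   (Num.max (z.2 - z.1) 0 * f0 (Num.max (z.2 - z.1) 0)).
have cb : continuous b.
  move=> z; have cB : {for z, continuous (fun z : R * R => z.2 - z.1)}.
    by apply: continuousB; [exact: cvg_snd|exact: cvg_fst].
  have cW (k : R * R -> R) : {for z, continuous k} -> {for z, continuous (primW w \o k)}.
    by move=> ck; apply: continuous_comp => //; exact: primW_continuous.
  have cX (k : R * R -> R) : {for z, continuous k} -> {for z, continuous (expR \o k)}.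
    by move=> ck; apply: continuous_comp => //; exact: continuous_expR.
  have c1 : {for z, continuous (fun z : R * R => expR (primW w (z.2 - z.1) - primW w z.2))}.
    apply: (cX (fun z => primW w (z.2 - z.1) - primW w z.2)).
    apply: continuousB; first exact: (cW _ cB).
    by apply: (cW (fun z : R * R => z.2)); exact: cvg_snd.
  have cp : C0_on `[0, +oo[ (fun y => y * f0 y).
    move=> y; apply: continuousM; last exact: (C1_on_C0_on cf0).
    by apply: continuous_subspaceT => ?; exact: cvg_id.
  have c2 : {for z, continuous (fun z : R * R => Num.max (z.2 - z.1) 0 * f0 (Num.max (z.2 - z.1) 0))}.
    by apply: (@continuous_comp _ _ _ (fun z : R * R => z.2 - z.1)
       (fun s : R => Num.max s 0 * f0 (Num.max s 0))) => //; exact: (C0_on_max cp).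
  exact: continuousM c1 c2.
have E z : uL w (fun r => r * f0 r) (fun r => r * f1 r) z.1 z.2 = 2^-1 * I z.1 z.2 + b z.
  rewrite /uL /I /data_density; congr (_ + _).
  rewrite /b /chi; case: ifPn => h; last first.
    by rewrite !mul0r (max_idPr _) ?mul0r ?mulr0//; apply: ltW; rewrite ltNge.
  rewrite mul1r (max_idPl h); congr (_ * _); rewrite EminusE; congr expR.
  by rewrite (_ : (z.2 - z.1 - z.1 + z.2) / 2 = z.2 - z.1); [ring|field].
rewrite (_ : (fun z => _) = fun z => 2^-1 * I z.1 z.2 + b z); last exact/funext.
apply/subspace_continuousP => z Az; apply: cvgD.
  by apply: cvgM; [exact: cvg_cst|exact: ((subspace_continuousP _ _).1 cI z Az)].
by apply: cvg_within_filter; exact: cb.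
Qed.

End free_solution.

(** * Picard iteration *)

Section fixed_point.
Context {R : realType}.
Notation leb := (@lebesgue_measure R).
Implicit Types (t r p eps M S : R) (w : R -> R) (G H : R * R -> R) (u v om F : R -> R -> R).

Lemma powR_dist_le p (a b m : R) : 1 < p -> `|a| <= m -> `|b| <= m ->
  `| `|a| `^ p - `|b| `^ p| <= p * m `^ (p - 1) * `|a - b|.
Proof.
move=> p1.
have key (x y : R) : 0 <= y -> y <= x -> x <= m ->
    `|x `^ p - y `^ p| <= p * m `^ (p - 1) * `|x - y|.
  move=> y0 yx xm; have x0 : 0 <= x by lra.
  rewrite ger0_norm; last by rewrite subr_ge0 ge0_ler_powR ?nnegrE//; lra.
  rewrite [in leRHS]ger0_norm ?subr_ge0//.
  have mono z : 0 <= z -> z <= m -> z `^ (p - 1) <= m `^ (p - 1).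
    by move=> z0 zm; apply: ge0_ler_powR; rewrite ?nnegrE; lra.
  (* The power is differentiated only at positive base; the endpoint 0 is covered by x^p = x
     x^(p-1). *)
  have [->|yn0] := eqVneq y 0.
    rewrite powR0; last by rewrite gt_eqF//; lra.
    rewrite !subr0 -(@mulr_powRB1 _ x p)//; last lra.
    rewrite mulrC ler_wpM2r//.
    by have := mono x x0 xm; have := powR_ge0 m (p - 1); nra.
  have yp : 0 < y by rewrite lt_neqAle eq_sym yn0.
  have dp z : y <= z -> is_derive z 1 (fun z => z `^ p) (p * z `^ (p - 1)).
    move=> yz; rewrite -[X in is_derive _ _ _ X]mulr1.
    by apply: (@is_derive_powR_comp R id); exact: lt_le_trans yp yz.
  have h z : z \in `]y, x[ -> is_derive z 1 (fun z => z `^ p) (p * z `^ (p - 1)).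
    by rewrite in_itv/= => /andP[/ltW yz _]; exact: dp.
  have c : {within `[y, x], continuous (fun z : R => z `^ p)}.
    apply: continuous_in_subspaceT => z; rewrite inE/= in_itv/= => /andP[yz _].
    exact: is_derive_continuous (dp z yz).
  have [z + ->] := MVT_segment yx h c.
  rewrite in_itv/= => /andP[yz zx]; rewrite ler_wpM2r ?subr_ge0//.
  by rewrite ler_wpM2l; [|lra|apply: mono; lra].
move=> am bm; have [ba|/ltW ab] := leP `|b| `|a|.
  apply: (le_trans (key _ _ (normr_ge0 b) ba am)).
  by rewrite ler_wpM2l ?ler_dist_dist// mulr_ge0 ?powR_ge0//; lra.
rewrite distrC (distrC a); apply: (le_trans (key _ _ (normr_ge0 a) ab bm)).
by rewrite ler_wpM2l ?ler_dist_dist// mulr_ge0 ?powR_ge0//; lra.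
Qed.

(** With e n = 2c/2^n one has e n - e (n+1) = c/2^n, so the intervals of radius e n about a n are
    nested. The infimum of their right ends lies in all of them, which gives the limit together with
    its rate. *)
Lemma geometric_limit (a : nat -> R) (c : R) :
  (forall n, `|a n.+1 - a n| <= c / 2 ^+ n) ->
  exists l : R, forall n, `|l - a n| <= 2 * c / 2 ^+ n.
Proof.
move=> ha; pose e n := 2 * c / 2 ^+ n.
have e_half n : e n = e n.+1 + c / 2 ^+ n.
  by rewrite /e exprS; field; rewrite expf_neq0.
have c0 : 0 <= c by have := le_trans (normr_ge0 _) (ha 0%N); rewrite expr0 divr1.
have e0 n : 0 <= e n by rewrite divr_ge0 ?mulr_ge0// exprn_ge0.
have up n k : a (n + k)%N + e (n + k)%N <= a n + e n.
  elim: k => [|k IH]; first by rewrite addn0.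
  apply: le_trans IH; rewrite addnS (e_half (n + k)%N).
  by have := ha (n + k)%N; rewrite ler_norml => /andP[_]; lra.
have lo n k : a n - e n <= a (n + k)%N - e (n + k)%N.
  elim: k => [|k IH]; first by rewrite addn0.
  apply: (le_trans IH); rewrite addnS (e_half (n + k)%N).
  by have := ha (n + k)%N; rewrite ler_norml => /andP[]; lra.
have cross n m : a n - e n <= a m + e m.
  have h1 := lo n m; have h2 := up m n; rewrite addnC in h2.
  by have := e0 (n + m)%N; lra.
pose A := [set x | exists n, x = a n + e n].
have A0 : A !=set0 by exists (a 0%N + e 0%N), 0%N.
have lbA n : lbound A (a n - e n) by move=> x [m ->]; exact: cross.
exists (inf A) => n; rewrite ler_norml; apply/andP; split.
  by have := lb_le_inf A0 (lbA n); rewrite /e; lra.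
have : inf A <= a n + e n.
  by apply: ge_inf; [exists (a 0%N - e 0%N); exact: lbA|exists n].
by rewrite /e; lra.
Qed.

(** * Measurability on the open quadrant *)

Definition quadrant : set (R * R) := [set z | 0 < z.1 /\ 0 < z.2].

(** Solutions are constrained only for t >= 0 and r > 0 and may be arbitrary elsewhere. The cutoff
    makes them measurable on the plane and changes no Duhamel integral, because the backward regions
    lie in the quadrant. *)
Definition trunc u t r : R := if (0 < t) && (0 < r) then u t r else 0.

Lemma truncE u t r : 0 < t -> 0 < r -> trunc u t r = u t r.
Proof. by rewrite /trunc => -> ->. Qed.

Lemma open_quadrant : open quadrant.
Proof.
rewrite openE => -[t r] [/= t0 r0]; apply/nbhs_ballP.
exists (Num.min t r) => /=; first by rewrite lt_min t0.
move=> [t' r'] [/=]; rewrite /ball/= !lt_min => /andP[h1 _] /andP[_ h2].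
have := ler_norm (t - t'); have := ler_norm (r - r').
by split => /=; lra.
Qed.

Lemma measurable_trunc u :
  measurable_fun quadrant (fun z : R * R => u z.1 z.2) ->
  measurable_fun setT (fun z : R * R => trunc u z.1 z.2).
Proof.
move=> mu; have mQ := open_measurable_prod open_quadrant.
have -> : (fun z : R * R => trunc u z.1 z.2) = (fun z : R * R => u z.1 z.2) \_ quadrant.
  apply/funext => z; rewrite patchE /trunc; case: ifPn => [/andP[a b]|h].
    by rewrite mem_set.
  by rewrite memNset// => -[a b]; move: h; rewrite a b.
by apply/(measurable_restrictT _ _).1.
Qed.

Lemma within_continuous_measurable u :
  {within `[0, +oo[ `*` `]0, +oo[, continuous (fun z : R * R => u z.1 z.2)} ->
  measurable_fun setT (fun z : R * R => trunc u z.1 z.2).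
Proof.
move=> cu; apply: measurable_trunc.
apply: open_continuous_measurable_fun_prod; first exact: open_quadrant.
have QA : quadrant `<=` `[0, +oo[ `*` `]0, +oo[.
  by move=> z [a b]; split; rewrite /= in_itv/= andbT// ltW.
have := continuous_subspaceW QA cu.
by rewrite continuous_open_subspace//; exact: open_quadrant.
Qed.

Lemma Delta_minus_quadrant t r z : Delta_minus t r z ->
  [/\ 0 < z.1, 0 < z.2, z.1 < t & z.1 + z.2 < t + r].
Proof. by move=> [a b /andP[c d] e]; split => //; lra. Qed.

Lemma duhamel_trunc w t r p u :
  duhamel w t r (source p (trunc u)) = duhamel w t r (source p u).
Proof.
apply: eq_integral => z; rewrite inE => /Delta_minus_quadrant[a b _ _].
by rewrite /source truncE.
Qed.

Lemma duhamel_ge0 w t r G : (forall z, Delta_minus t r z -> 0 <= G z) ->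
  (0 <= duhamel w t r G)%E.
Proof.
by move=> G0; apply: integral_ge0 => z /G0 h; rewrite lee_fin mulr_ge0 ?Eminus_ge0.
Qed.

Lemma duhamel_le w t r G H (k : R) : C0_on `[0, +oo[ w -> 0 <= k ->
  measurable_fun setT G -> measurable_fun setT H ->
  (forall z, Delta_minus t r z -> 0 <= G z <= k * H z) ->
  (forall z, Delta_minus t r z -> 0 <= H z) ->
  (duhamel w t r G <= k%:E * duhamel w t r H)%E.
Proof.
move=> cw k0 mG mH hG hH; have mD := measurable_Delta_minus t r.
have mI L : measurable_fun setT L -> measurable_fun (Delta_minus t r)
    (fun z => (Eminus w (t - z.1) r z.2 * L z)%:E).
  move=> mL; apply/measurable_EFinP.
  by apply: measurable_fun_duhamel_integrand => //; exact: measurable_funTS.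
have H0 z : Delta_minus t r z -> (0 <= (Eminus w (t - z.1) r z.2 * H z)%:E)%E.
  by move=> /hH h; rewrite lee_fin mulr_ge0 ?Eminus_ge0.
have mG' := mI G mG; have mH' := mI H mH.
rewrite /duhamel -ge0_integralZl_EFin//.
apply: ge0_le_integral => //.
- by move=> z /hG /andP[h _]; rewrite lee_fin mulr_ge0 ?Eminus_ge0.
- exact: measurable_funeM.
- move=> z /hG /andP[_ h]; rewrite -EFinM lee_fin mulrCA.
  by rewrite ler_wpM2l ?Eminus_ge0.
Qed.

(** All that the iteration needs to know of the weight. The bound by B0 r keeps the source locally
    bounded up to the axis, hence the Duhamel integral locally Lipschitz; the last clause closes the
    nonlinear estimate. *)
Definition admissible_weight w p om (B0 C1 : R) : Prop :=
  [/\ 0 < B0, 0 < C1, measurable_fun setT (fun z : R * R => om z.1 z.2),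
      forall t r, 0 <= t -> 0 < r -> 0 <= om t r <= B0 * r &
      forall t r, 0 <= t -> 0 < r ->
        (duhamel w t r (source p om) <= (C1 * om t r)%:E)%E].

Definition dominated M om u := forall t r, 0 < t -> 0 < r -> `|u t r| <= M * om t r.

Lemma source_ge0 p u z : 0 <= source p u z.
Proof. by rewrite divr_ge0 ?powR_ge0. Qed.

(** The first bound serves the weighted estimates, the second the continuity: (M B0 y)^p / y^(p-1) =
    (M B0)^p y has no singularity at y = 0. *)
Lemma source_bound p M om B0 u : 0 < p -> 0 <= M ->
  (forall t r, 0 <= t -> 0 < r -> 0 <= om t r <= B0 * r) -> dominated M om u ->
  forall z, 0 < z.1 -> 0 < z.2 ->
  source p (trunc u) z <= M `^ p * source p om z /\
  source p (trunc u) z <= (M * B0) `^ p * z.2.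
Proof.
move=> p0 M0 hom hu z z1 z2; rewrite /source truncE//.
have /andP[omz0 omzB] := hom z.1 z.2 (ltW z1) z2.
have B00 : 0 <= B0 by have := le_trans omz0 omzB; rewrite pmulr_lge0.
have y0 : 0 < z.2 `^ (p - 1) by exact: powR_gt0.
have h1 : `|u z.1 z.2| `^ p <= M `^ p * `|om z.1 z.2| `^ p.
  rewrite -powRM//; apply: ge0_ler_powR; rewrite ?nnegrE ?mulr_ge0//; first exact: ltW.
  by rewrite (ger0_norm omz0); exact: hu.
have e1 : `|u z.1 z.2| `^ p / z.2 `^ (p - 1) <= M `^ p * (`|om z.1 z.2| `^ p / z.2 `^ (p - 1)).
  by rewrite mulrA ler_pM2r// invr_gt0.
split => //; apply: (le_trans e1); rewrite powRM// -mulrA ler_wpM2l ?powR_ge0//.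
rewrite ler_pdivrMr// -mulrA (mulr_powRB1 (ltW z2))// (ger0_norm omz0) -powRM ?(ltW z2)//.
by apply: ge0_ler_powR; rewrite ?nnegrE ?(ltW p0)// mulr_ge0 ?(ltW z2).
Qed.

Lemma source_dist p M om B0 u v : 1 < p -> 0 <= M ->
  (forall t r, 0 <= t -> 0 < r -> 0 <= om t r <= B0 * r) ->
  dominated M om u -> dominated M om v -> forall z, 0 < z.1 -> 0 < z.2 ->
  `|source p (trunc u) z - source p (trunc v) z| <=
     p * (M * om z.1 z.2) `^ (p - 1) * `|u z.1 z.2 - v z.1 z.2| / z.2 `^ (p - 1).
Proof.
move=> p1 M0 hom hu hv z z1 z2; rewrite /source !truncE// -mulrBl normrM.
have y0 : 0 < z.2 `^ (p - 1) by exact: powR_gt0.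
rewrite (@gtr0_norm _ (_ ^-1)) ?invr_gt0// ler_pM2r ?invr_gt0//.
by apply: powR_dist_le => //; [exact: hu|exact: hv].
Qed.

Lemma duhamel_finite w p om B0 C1 M u t r : C0_on `[0, +oo[ w -> 1 < p -> 0 <= M ->
  admissible_weight w p om B0 C1 ->
  measurable_fun setT (fun z : R * R => trunc u z.1 z.2) -> dominated M om u ->
  0 <= t -> 0 < r ->
  (duhamel w t r (source p (trunc u)) <= (M `^ p * (C1 * om t r))%:E)%E.
Proof.
move=> cw p1 M0 [B00 C10 mom hom hC1] mu hu t0 r0.
have p0 : 0 < p by lra.
apply: (@le_trans _ _ ((M `^ p)%:E * duhamel w t r (source p om))%E).
  apply: duhamel_le; rewrite ?powR_ge0//.
  - exact: measurable_fun_source.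
  - exact: measurable_fun_source.
  - move=> z /Delta_minus_quadrant[a b _ _]; rewrite source_ge0/=.
    by have [] := source_bound p0 M0 hom hu a b.
  - by move=> z _; exact: source_ge0.
by rewrite EFinM; apply: lee_wpmul2l; rewrite ?lee_fin ?powR_ge0// hC1.
Qed.

Definition picard w p eps F u t r : R :=
  eps * F t r + 2^-1 * fine (duhamel w t r (source p (trunc u))).

Lemma picard_continuous w p om B0 C1 M eps F u : C0_on `[0, +oo[ w -> 1 < p -> 0 <= M ->
  admissible_weight w p om B0 C1 ->
  {within `[0, +oo[ `*` `]0, +oo[, continuous (fun z : R * R => F z.1 z.2)} ->
  measurable_fun setT (fun z : R * R => trunc u z.1 z.2) -> dominated M om u ->
  {within `[0, +oo[ `*` `]0, +oo[, continuous (fun z : R * R => picard w p eps F u z.1 z.2)}.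
Proof.
move=> cw p1 M0 [B00 C10 mom hom hC1] cF mu hu.
have p0 : 0 < p by lra.
have cd : {within `[0, +oo[ `*` `]0, +oo[, continuous
    (fun z : R * R => fine (duhamel w z.1 z.2 (source p (trunc u))))}.
  apply: (@lipschitz_within_continuous _ (fun t r => fine (duhamel w t r (source p (trunc u))))) => T.
  have T0 : 0 <= `|T| by [].
  have B1 : 0 <= (M * B0) `^ p * `|T| by rewrite mulr_ge0 ?powR_ge0.
  have [K K0 hK] := duhamel_lipschitz cw T0 B1.
  exists K => // t r t' r' t0 r0 tr t'0 r'0 tr'.
  have Tn := ler_norm T.
  have [|_ hh] := hK _ (measurable_fun_source p mu) _ t r t0 r0 (le_trans tr Tn).
    move=> z z1 z2 zT; rewrite source_ge0/=.
    have [_ /le_trans] := source_bound p0 M0 hom hu z1 z2; apply.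
    by rewrite ler_wpM2l ?powR_ge0//; lra.
  by apply: hh => //; exact: le_trans tr' Tn.
apply/subspace_continuousP => z Az; apply: cvgD.
  by apply: cvgM; [exact: cvg_cst|exact: ((subspace_continuousP _ _).1 cF z Az)].
by apply: cvgM; [exact: cvg_cst|exact: ((subspace_continuousP _ _).1 cd z Az)].
Qed.

(** The choice M = 2 C2 eps gives half of the bound to the free solution. The Duhamel integral is at
    most C1 M^(p-1) M om <= M om, and the factor 1/2 in the equation makes it the other half. *)
Lemma picard_dominated w p om B0 C1 C2 M eps F u : C0_on `[0, +oo[ w -> 1 < p ->
  admissible_weight w p om B0 C1 -> 0 < eps -> 0 < C2 -> M = 2 * C2 * eps ->
  C1 * p * M `^ (p - 1) <= 1 ->
  (forall t r, 0 <= t -> 0 < r -> `|F t r| <= C2 * om t r) ->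
  measurable_fun setT (fun z : R * R => trunc u z.1 z.2) -> dominated M om u ->
  forall t r, 0 <= t -> 0 < r -> `|picard w p eps F u t r| <= M * om t r.
Proof.
move=> cw p1 adm eps0 C20 ME hM hF mu hu t r t0 r0.
have M0 : 0 < M by rewrite ME !mulr_gt0.
have hd := duhamel_finite cw p1 (ltW M0) adm mu hu t0 r0.
have [B00 C10 mom hom hC1] := adm; have /andP[omz0 _] := hom t r t0 r0.
have d0 : (0 <= duhamel w t r (source p (trunc u)))%E.
  by apply: duhamel_ge0 => z _; exact: source_ge0.
have f1 : 0 <= fine (duhamel w t r (source p (trunc u))) by exact: fine_ge0.
have f2 : fine (duhamel w t r (source p (trunc u))) <= M `^ p * (C1 * om t r).
  by rewrite -lee_fin fineK// ge0_fin_numE// (le_lt_trans hd)// ltry.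
apply: (le_trans (ler_normD _ _)).
rewrite normrM (gtr0_norm eps0) normrM (@ger0_norm _ 2^-1)// (ger0_norm f1).
have h1 : eps * `|F t r| <= M / 2 * om t r.
  rewrite ME (_ : 2 * C2 * eps / 2 * om t r = eps * (C2 * om t r)); last by field.
  by rewrite ler_pM2l// hF.
have h2 : M `^ p * (C1 * om t r) <= M * om t r.
  rewrite -(mulr_powRB1 (ltW M0)); last lra.
  rewrite (_ : _ * (C1 * om t r) = M * om t r * (C1 * M `^ (p - 1))); last by ring.
  rewrite ler_piMr ?mulr_ge0 ?(ltW M0)//; apply: le_trans hM; rewrite mulrAC.
  by rewrite ler_peMr ?mulr_ge0 ?powR_ge0 ?(ltW C10)//; exact: ltW.
lra.
Qed.

(** By the mean value bound the difference of the sources is at most p M^(p-1) S times the source of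
    the weight, so the estimate of the weight applies once more. The smallness condition reduces the
    constant to S, and the ratio 1/2 is the factor in front of the integral. *)
Lemma picard_contraction w p om B0 C1 M S eps F u v : C0_on `[0, +oo[ w -> 1 < p ->
  admissible_weight w p om B0 C1 -> 0 <= M -> 0 <= S ->
  C1 * p * M `^ (p - 1) <= 1 ->
  measurable_fun setT (fun z : R * R => trunc u z.1 z.2) -> dominated M om u ->
  measurable_fun setT (fun z : R * R => trunc v z.1 z.2) -> dominated M om v ->
  (forall t r, 0 < t -> 0 < r -> `|u t r - v t r| <= S * om t r) ->
  forall t r, 0 <= t -> 0 < r ->
    `|picard w p eps F u t r - picard w p eps F v t r| <= S / 2 * om t r.
Proof.
move=> cw p1 adm M0 S0 hM mu hu mv hv huv t r t0 r0.
have fu := duhamel_finite cw p1 M0 adm mu hu t0 r0.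
have fv := duhamel_finite cw p1 M0 adm mv hv t0 r0.
have [B00 C10 mom hom hC1] := adm; have /andP[omz0 _] := hom t r t0 r0.
have p0 : 0 < p by lra.
pose k := p * M `^ (p - 1) * S.
have k0 : 0 <= k by rewrite !mulr_ge0 ?powR_ge0 ?(ltW p0).
rewrite /picard opprD addrACA subrr add0r -mulrBr.
rewrite normrM (@ger0_norm _ 2^-1)// [S / 2]mulrC -mulrA ler_pM2l//.
have ms : measurable_fun setT (source p om) by exact: measurable_fun_source.
rewrite -lee_fin; apply: (@le_trans _ _ (duhamel w t r (fun z => k * source p om z))).
  apply: duhamel_dist_le => //; try exact: measurable_fun_source.
  - by apply: measurable_funM.
  - by move=> z _; exact: source_ge0.
  - by move=> z _; exact: source_ge0.
  - move=> z /Delta_minus_quadrant[a b _ _].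
    apply: (le_trans (source_dist p1 M0 hom hu hv a b)).
    have /andP[omz _] := hom z.1 z.2 (ltW a) b.
    rewrite /source (ger0_norm omz) mulrA ler_pM2r ?invr_gt0 ?powR_gt0//.
    rewrite powRM// -(mulr_powRB1 omz p0).
    rewrite /k (_ : p * M `^ (p - 1) * S * (om z.1 z.2 * om z.1 z.2 `^ (p - 1)) =
      p * (M `^ (p - 1) * om z.1 z.2 `^ (p - 1)) * (S * om z.1 z.2)); last by ring.
    by rewrite ler_wpM2l ?huv// !mulr_ge0 ?powR_ge0 ?(ltW p0).
  - by apply: le_lt_trans fu _; rewrite ltry.
  - by apply: le_lt_trans fv _; rewrite ltry.
apply: (@le_trans _ _ (k%:E * duhamel w t r (source p om))%E).
  apply: duhamel_le => //.
  - by apply: measurable_funM.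
  - by move=> z _; rewrite lexx andbT mulr_ge0 ?source_ge0.
  - by move=> z _; exact: source_ge0.
apply: (le_trans (lee_wpmul2l _ (hC1 t r t0 r0))); rewrite ?lee_fin//.
rewrite /k (_ : _ * _ * S * (C1 * om t r) = C1 * p * M `^ (p - 1) * (S * om t r)); last by ring.
by rewrite ler_piMl// mulr_ge0.
Qed.

Lemma picard_equation w p eps F u t r : (duhamel w t r (source p (trunc u)) < +oo)%E ->
  ((picard w p eps F u t r)%:E = (eps * F t r)%:E +
    (2^-1)%:E * duhamel w t r (source p (trunc u)))%E.
Proof.
move=> fin; have d0 : (0 <= duhamel w t r (source p (trunc u)))%E.
  by apply: duhamel_ge0 => z _; exact: source_ge0.
by rewrite /picard EFinD [in RHS]EFinM [X in (_ + X)%E]EFinM fineK// ge0_fin_numE.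
Qed.

Lemma eq_of_geometric (x y c : R) : (forall n, `|x - y| <= c / 2 ^+ n) -> x = y.
Proof.
move=> h; apply/eqP; rewrite -subr_eq0 -normr_le0; apply/ler_addgt0Pl => e e0.
rewrite addr0.
have c0 : 0 <= c by have := le_trans (normr_ge0 _) (h 0%N); rewrite expr0 divr1.
pose n := Num.bound (c / e).
apply: (le_trans (h n)); rewrite ler_pdivrMr ?exprn_gt0//.
rewrite mulrC -ler_pdivrMr//; apply: (@le_trans _ _ n%:R).
  by apply: ltW; apply: archi_boundP; rewrite divr_ge0// ltW.
by rewrite -natrX ler_nat ltnW// ltn_expl.
Qed.

Lemma picard_existence w p om B0 C1 C2 eps F : C0_on `[0, +oo[ w -> 1 < p ->
  admissible_weight w p om B0 C1 -> 0 < eps -> 0 < C2 ->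
  C1 * p * (2 * C2 * eps) `^ (p - 1) <= 1 ->
  (forall t r, 0 <= t -> 0 < r -> `|F t r| <= C2 * om t r) ->
  {within `[0, +oo[ `*` `]0, +oo[, continuous (fun z : R * R => F z.1 z.2)} ->
  exists u, [/\ {within `[0, +oo[ `*` `]0, +oo[, continuous (fun z : R * R => u z.1 z.2)},
    dominated (2 * C2 * eps) om u &
    forall t r, 0 < t -> 0 < r ->
      ((u t r)%:E = (eps * F t r)%:E + (2^-1)%:E * duhamel w t r (source p u))%E].
Proof.
move=> cw p1 adm eps0 C20; set M := 2 * C2 * eps => hM hF cF.
have M0 : 0 < M by rewrite /M !mulr_gt0.
pose P := picard w p eps F.
pose good u := measurable_fun setT (fun z : R * R => trunc u z.1 z.2) /\ dominated M om u.
have domP u : good u -> forall t r, 0 <= t -> 0 < r -> `|P u t r| <= M * om t r.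
  by move=> [mu hu]; exact: (picard_dominated cw p1 adm eps0 C20 erefl hM hF mu hu).
have contP u : good u ->
    {within `[0, +oo[ `*` `]0, +oo[, continuous (fun z : R * R => P u z.1 z.2)}.
  by move=> [mu hu]; exact: (picard_continuous cw p1 (ltW M0) adm cF mu hu).
have goodP u : good u -> good (P u).
  move=> gu; split; first exact: within_continuous_measurable (contP u gu).
  by move=> t r /ltW t0 r0; exact: domP.
have contraction S u v : 0 <= S -> good u -> good v ->
    (forall t r, 0 < t -> 0 < r -> `|u t r - v t r| <= S * om t r) ->
    forall t r, 0 <= t -> 0 < r -> `|P u t r - P v t r| <= S / 2 * om t r.
  move=> S0 [mu hu] [mv hv].
  exact: (@picard_contraction w p om B0 C1 M S eps F u v cw p1 adm (ltW M0) S0 hM mu hu mv hv).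
have [B00 C10 mom hom hC1] := adm.
have good0 : good (fun _ _ => 0).
  split; first by rewrite /trunc; under eq_fun do rewrite if_same; exact: measurable_cst.
  move=> t r t0 r0; rewrite normr0; have /andP[w0 _] := hom t r (ltW t0) r0.
  by rewrite mulr_ge0// ltW.
pose a n := iter n P (fun _ _ => 0).
have gooda n : good (a n) by elim: n => //= n; exact: goodP.
have step n t r : 0 < t -> 0 < r -> `|a n.+1 t r - a n t r| <= M / 2 ^+ n * om t r.
  elim: n t r => [|n IH] t r t0 r0.
    by rewrite /a/= subr0 expr0 divr1; apply: domP => //; exact: ltW.
  have h := contraction (M / 2 ^+ n) (a n.+1) (a n).
  rewrite exprSr invfM mulrA; apply: h => //; last exact: ltW.
  by rewrite divr_ge0 ?exprn_ge0// ltW.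
(* The sign conditions stand under the existential, so that a limit can be chosen for all real t and
   r at once. *)
have lim t r : exists l : R, 0 < t -> 0 < r -> forall n, `|l - a n t r| <= 2 * (M * om t r) / 2 ^+ n.
  have [t0|t0] := pselect (0 < t); last by exists 0 => /t0.
  have [r0|r0] := pselect (0 < r); last by exists 0 => _ /r0.
  have [l hl] := @geometric_limit (fun n => a n t r) (M * om t r)
    (fun n => ltac:(by have := step n t r t0 r0; rewrite mulrAC)).
  by exists l.
pose l t r := sval (cid (lim t r)).
have hl n t r : 0 < t -> 0 < r -> `|l t r - a n t r| <= 2 * M / 2 ^+ n * om t r.
  move=> t0 r0; have := svalP (cid (lim t r)) t0 r0 n.
  by rewrite -/(l t r) mulrA mulrAC.
have conv (x y c : R) : (forall n, `|x - y| <= c / 2 ^+ n) -> x = y := @eq_of_geometric x y c.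
have goodl : good l.
  split.
    apply: (@measurable_fun_cvg _ _ R setT (fun n (z : R * R) => trunc (a n) z.1 z.2)).
    - by move=> n; have [] := gooda n.
    - move=> z _; rewrite /trunc; case: ifPn => [/andP[z1 z2]|_]; last exact: cvg_cst.
      apply/cvgrPdist_le => e e0.
      have geo : (2 * M * om z.1 z.2) * 2^-1 ^+ n @[n --> \oo] --> 0.
        rewrite -[X in _ --> X](mulr0 (2 * M * om z.1 z.2)); apply: cvgM; first exact: cvg_cst.
        by apply: cvg_expr; rewrite ger0_norm; lra.
      move/cvgrPdist_le : geo => /(_ e e0); apply: filterS => n.
      rewrite sub0r normrN => hn; apply: (le_trans (hl n _ _ z1 z2)).
      apply: le_trans hn; apply: le_trans (ler_norm _).
      by rewrite exprVn mulrAC.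
  move=> t r t0 r0; rewrite leNgt; apply/negP => lt.
  have /andP[w0 _] := hom t r (ltW t0) r0.
  pose e := `|l t r| - M * om t r; have e0 : 0 < e by rewrite /e subr_gt0.
  have : `|l t r| = M * om t r.
    apply: (conv _ _ (2 * M * om t r)) => n.
    rewrite ger0_norm; last by rewrite subr_ge0 ltW.
    have [_ /(_ t r t0 r0)] := gooda n; have := hl n t r t0 r0.
    have := ler_dist_dist (l t r) (a n t r).
    have := ler_norm (`|l t r| - `|a n t r|).
    rewrite (_ : 2 * M / 2 ^+ n * om t r = 2 * M * om t r / 2 ^+ n); last by rewrite mulrAC.
    lra.
  by move=> E; move: lt; rewrite E ltxx.
(* The pointwise limit l is only known to be measurable and carries information for t > 0 alone. Its
   image under the Picard map agrees with l on the quadrant and is continuous up to t = 0. *)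
exists (P l).
have Pl t r : 0 < t -> 0 < r -> P l t r = l t r.
  move=> t0 r0; apply: (conv _ _ (4 * M * om t r)) => n.
  have S0 : 0 <= 2 * M / 2 ^+ n by rewrite divr_ge0 ?exprn_ge0// mulr_ge0// ltW.
  have h1 := contraction _ _ _ S0 goodl (gooda n) (hl n) t r (ltW t0) r0.
  have h2 := hl n.+1 t r t0 r0.
  rewrite exprS in h2; rewrite distrC in h2.
  have h3 := ler_normD (P l t r - a n.+1 t r) (a n.+1 t r - l t r).
  rewrite addrA subrK in h3; apply: (le_trans h3).
  apply: (le_trans (lerD h1 h2)).
  have /andP[w0 _] := hom t r (ltW t0) r0.
  rewrite (_ : _ + _ = 2 * M / 2 ^+ n * om t r); last first.
    by field; rewrite expf_neq0.
  rewrite mulrAC ler_pM2r ?invr_gt0 ?exprn_gt0// -[leLHS]mulrA -[leRHS]mulrA.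
  by apply: ler_wpM2r; [rewrite mulr_ge0// ltW|rewrite ler_nat].
split; first exact: contP.
- by move=> t r /ltW t0 r0; exact: domP.
- move=> t r t0 r0; rewrite /P picard_equation; last first.
    apply: le_lt_trans (duhamel_finite cw p1 (ltW M0) adm goodl.1 goodl.2 (ltW t0) r0) _.
    exact: ltry.
  rewrite duhamel_trunc /duhamel; congr (_ + _ * _)%E.
  apply: eq_integral => z; rewrite inE => /Delta_minus_quadrant[z1 z2 _ _].
  by rewrite /source -/P -/(P l z.1 z.2) Pl.
Qed.

Lemma picard_uniqueness w p om B0 C1 M eps F u v : C0_on `[0, +oo[ w -> 1 < p -> 0 <= M ->
  admissible_weight w p om B0 C1 ->
  {within `[0, +oo[ `*` `]0, +oo[, continuous (fun z : R * R => u z.1 z.2)} ->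
  {within `[0, +oo[ `*` `]0, +oo[, continuous (fun z : R * R => v z.1 z.2)} ->
  dominated M om u -> dominated M om v ->
  (forall t r, 0 < t -> 0 < r ->
      ((u t r)%:E = (eps * F t r)%:E + (2^-1)%:E * duhamel w t r (source p u))%E) ->
  (forall t r, 0 < t -> 0 < r ->
      ((v t r)%:E = (eps * F t r)%:E + (2^-1)%:E * duhamel w t r (source p v))%E) ->
  forall t r, 0 <= t -> 0 < r -> u t r = v t r.
Proof.
move=> cw p1 M0 adm cu cv hu hv equ eqv.
have mu := within_continuous_measurable cu; have mv := within_continuous_measurable cv.
have [B00 C10 mom hom hC1] := adm.
have p0 : 0 < p by lra.
have MB : 0 <= M * B0 by rewrite mulr_ge0// ltW.
(* A Lipschitz constant of the source with respect to u: as om <= B0 y, the power (M om)^(p-1)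
   absorbs the singular factor y^(1-p). *)
pose k := p * (M * B0) `^ (p - 1).
have k0 : 0 <= k by rewrite mulr_ge0 ?powR_ge0// ltW.
have picE (x : R -> R -> R) : measurable_fun setT (fun z : R * R => trunc x z.1 z.2) ->
    dominated M om x ->
    (forall t r, 0 < t -> 0 < r ->
      ((x t r)%:E = (eps * F t r)%:E + (2^-1)%:E * duhamel w t r (source p x))%E) ->
    forall t r, 0 < t -> 0 < r -> (duhamel w t r (source p (trunc x)) < +oo)%E /\
      x t r = picard w p eps F x t r.
  move=> mx hx eqx t r t0 r0.
  have fin : (duhamel w t r (source p (trunc x)) < +oo)%E.
    apply: le_lt_trans (duhamel_finite cw p1 M0 adm mx hx (ltW t0) r0) _.
    exact: ltry.
  split; first exact: fin.
  by apply: EFin_inj; rewrite (picard_equation eps F fin) duhamel_trunc; exact: eqx.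
(* on [t + r <= T] the two solutions are compared on successive short time slabs *)
have pos T : 0 < T -> forall t r, 0 < t -> 0 < r -> t + r <= T -> u t r = v t r.
  move=> T0; have [K K0 hK] := Eminus_lipschitz cw (ltW T0).
  have q00 : 0 <= K * k * T := mulr_ge0 (mulr_ge0 (ltW K0) k0) (ltW T0).
  have q0 : 0 < K * k * T + 1 by rewrite ltr_wpDl.
  (* The slab height is chosen so that K k T h <= 1: kernel bound, Lipschitz constant and slab area
     h T together do not exceed 1. It is independent of n, so finitely many slabs reach any time. *)
  pose h := (K * k * T + 1)^-1.
  have h0 : 0 < h by rewrite invr_gt0.
  have hq : K * k * T * h <= 1.
    by rewrite /h ler_pdivrMr// mul1r lerDl.
  have slab n : forall t r, 0 < t -> 0 < r -> t + r <= T -> t <= n%:R * h -> u t r = v t r.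
    elim: n => [t r t0 _ _|n IH]; first by rewrite mul0r; lra.
    pose A : set (R * R) := `](n%:R * h), (n.+1%:R * h)]%classic `*` `]0, T]%classic.
    have mA : measurable A by exact: measurableX.
    have muA : ((leb \x leb) A <= (h * T)%:E)%E.
      rewrite product_measure1E//= !lebesgue_measure_itv/= !lte_fin T0.
      rewrite ltr_pM2r// ltr_nat ltnSn -!EFinB -EFinM lee_fin subr0.
      by rewrite -mulrBl -natr1 addrAC subrr add0r mul1r.
    (* Contraction in the unweighted supremum norm on one slab: earlier slabs contribute nothing by
       induction, and the factor 1/2 of the equation halves any bound S. Iterating it from the crude
       bound [base] forces the difference to vanish. *)
    have gain S : 0 <= S ->
      (forall t r, 0 < t -> 0 < r -> t + r <= T -> t <= n.+1%:R * h -> `|u t r - v t r| <= S) ->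
      forall t r, 0 < t -> 0 < r -> t + r <= T -> t <= n.+1%:R * h -> `|u t r - v t r| <= S / 2.
      move=> S0 hS t r t0 r0 tr tn.
      have [fu ->] := picE u mu hu equ t r t0 r0.
      have [fv ->] := picE v mv hv eqv t r t0 r0.
      rewrite /picard opprD addrACA subrr add0r -mulrBr.
      rewrite normrM (@ger0_norm _ 2^-1)// [S / 2]mulrC ler_pM2l//.
      have mH : measurable_fun setT (fun z : R * R => k * S * (\1_A z : R)).
        by apply: measurable_funM => //; exact: measurable_indic.
      rewrite -lee_fin; apply: (@le_trans _ _ (duhamel w t r (fun z => k * S * \1_A z))).
        apply: duhamel_dist_le => //; try exact: measurable_fun_source.
        - by move=> z _; exact: source_ge0.
        - by move=> z _; exact: source_ge0.
        - move=> z /Delta_minus_quadrant[z1 z2 zt ztr].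
          have zT : z.1 + z.2 <= T by lra.
          have zn : z.1 <= n.+1%:R * h by lra.
          have [zle|zgt] := leP z.1 (n%:R * h).
            rewrite /source !truncE// (IH _ _ z1 z2 zT zle) subrr normr0.
            by apply: mulr_ge0; [exact: mulr_ge0|rewrite indicE].
          have Az : A z by rewrite /A/= !in_itv/= zgt zn z2/=; lra.
          rewrite indicE mem_set// mulr1.
          apply: (le_trans (source_dist p1 M0 hom hu hv z1 z2)).
          have /andP[w0 wB] := hom z.1 z.2 (ltW z1) z2.
          have y0 : 0 < z.2 `^ (p - 1) by exact: powR_gt0.
          rewrite ler_pdivrMr// [leRHS]mulrAC; apply: ler_pM; rewrite ?mulr_ge0 ?powR_ge0 ?(ltW p0)//.
            rewrite /k -mulrA ler_pM2l// -powRM ?(ltW z2)//.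
            apply: ge0_ler_powR; rewrite ?nnegrE ?mulr_ge0 ?(ltW B00) ?(ltW z2)//; first lra.
            by rewrite -mulrA ler_wpM2l.
          exact: hS.
      rewrite /duhamel; have mD := measurable_Delta_minus t r.
      have kS : 0 <= k * S by rewrite mulr_ge0.
      have mI : measurable_fun (Delta_minus t r) (fun z : R * R => (\1_A z : R)%:E).
        by apply/measurable_EFinP; apply: measurable_indic.
      have I0 z : Delta_minus t r z -> (0 <= (\1_A z : R)%:E)%E by rewrite lee_fin indicE.
      apply: (@le_trans _ _ (\int[leb \x leb]_(z in Delta_minus t r)
          ((K * (k * S))%:E * (\1_A z : R)%:E))%E).
        apply: ge0_le_integral => //.
        - move=> z Dz; rewrite lee_fin; apply: mulr_ge0; first exact: Eminus_ge0.
          by apply: mulr_ge0; [exact: kS|rewrite indicE].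
        - apply/measurable_EFinP; apply: measurable_fun_duhamel_integrand => //.
          exact: measurable_funTS mH.
        - exact: measurable_funeM.
        move=> z Dz; rewrite -EFinM lee_fin mulrA.
        apply: ler_wpM2r; first by rewrite indicE.
        apply: ler_wpM2r; first exact: kS.
        have [z1 z2 zt ztr] := Delta_minus_quadrant Dz.
        have rT : r <= T by lra.
        have yT : z.2 <= T by lra.
        have sT : (z.2 - (t - z.1) + r) / 2 <= T by lra.
        by have [] := hK (t - z.1) r z.2 rT yT sT.
      rewrite ge0_integralZl_EFin//; last by rewrite mulr_ge0// ltW.
      have -> : (\int[leb \x leb]_(z in Delta_minus t r) (\1_A z : R)%:E =
          (leb \x leb) (A `&` Delta_minus t r))%E by exact: integral_indic.
      apply: (@le_trans _ _ ((K * (k * S))%:E * (h * T)%:E)%E).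
        apply: lee_wpmul2l; first by rewrite lee_fin mulr_ge0// ltW.
        apply: le_trans muA; apply: le_measure; rewrite ?inE//; try exact: subIsetl.
        exact: measurableI.
      rewrite -EFinM lee_fin [leLHS](_ : _ = K * k * T * h * S); last by ring.
      by rewrite ler_piMl.
    have base t r : 0 < t -> 0 < r -> t + r <= T -> `|u t r - v t r| <= 2 * (M * B0 * T).
      move=> t0 r0 tr; apply: (le_trans (ler_normB _ _)).
      have /andP[w0 wB] := hom t r (ltW t0) r0.
      have b x : dominated M om x -> `|x t r| <= M * B0 * T.
        move=> hx; apply: (le_trans (hx t r t0 r0)); rewrite -mulrA ler_wpM2l//.
        apply: (le_trans wB); rewrite ler_pM2l//; lra.
      by rewrite mulr_natl mulr2n; apply: lerD; exact: b.
    move=> t r t0 r0 tr tn; apply: (@eq_of_geometric _ _ (2 * (M * B0 * T))) => m.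
    elim: m t r t0 r0 tr tn => [|m IHm] t r t0 r0 tr tn.
      by rewrite expr0 divr1; exact: base.
    rewrite exprSr invfM [leRHS]mulrA; apply: gain => //.
    by rewrite divr_ge0 ?exprn_ge0// !mulr_ge0 ?(ltW B00) ?(ltW T0).
  move=> t r t0 r0 tr; apply: (slab (Num.bound (t / h))) => //.
  by rewrite -ler_pdivrMr//; apply: ltW; apply: archi_boundP; rewrite divr_ge0// ltW.
(* The equation is imposed only for t > 0; equality at t = 0 is recovered from the continuity of
   both solutions there. *)
move=> t r; rewrite le_eqVlt => /predU1P[<- r0|t0 r0]; last first.
  by apply: (pos (t + r)) => //; rewrite addr_gt0.
have A0 : (`[0, +oo[ `*` `]0, +oo[) ((0 : R), r) by split; rewrite /= in_itv/= ?lexx ?r0.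
apply/eqP; rewrite -subr_eq0 -normr_le0; apply/ler_addgt0Pl => e e0; rewrite addr0.
have e2 : 0 < e / 2 by rewrite divr_gt0.
have near_val (x : R -> R -> R) :
    {within `[0, +oo[ `*` `]0, +oo[, continuous (fun z : R * R => x z.1 z.2)} ->
    exists2 d : R, 0 < d & forall s, 0 < s -> s < d -> `|x 0 r - x s r| <= e / 2.
  move=> cx; have /cvgrPdist_le /(_ _ e2) := (subspace_continuousP _ _).1 cx _ A0.
  rewrite near_withinE => /nbhs_ballP[d /= d0 hd]; exists d => // s s0 sd.
  apply: (hd (s, r)) => /=.
    by split => /=; rewrite /ball/= ?subrr ?normr0// sub0r normrN gtr0_norm.
  by split; rewrite /= in_itv/= ?r0// ltW.
have [d1 d10 hd1] := near_val u cu; have [d2 d20 hd2] := near_val v cv.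
pose s := Num.min d1 d2 / 2.
have m0 : 0 < Num.min d1 d2 by rewrite lt_min d10.
have s0 : 0 < s by rewrite /s divr_gt0.
have m1 : Num.min d1 d2 <= d1 by rewrite ge_min lexx.
have m2 : Num.min d1 d2 <= d2 by rewrite ge_min lexx orbT.
have s1 : s < d1 by rewrite /s; lra.
have s2 : s < d2 by rewrite /s; lra.
have b1 := hd1 s s0 s1; have b2 := hd2 s s0 s2.
have E : u s r = v s r by apply: (pos (s + r)) => //; rewrite addr_gt0.
rewrite (_ : u 0 r - v 0 r = (u 0 r - u s r) - (v 0 r - v s r)); last by rewrite E; ring.
by apply: (le_trans (ler_normB _ _)); lra.
Qed.

End fixed_point.

(** * The exponents and the theorem *)

Section exponents.
Context {R : realType}.
Implicit Types (mu p nu eta kappa : R).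

(** With eta seen as a function of the exponent, gamma_S(q, 3+mu) = 2 - 2 q eta(q), so p_S(3+mu)
    solves q eta(q) = 1. There both factors are positive, and they increase with q; positivity of
    eta(q) also gives q > 1. *)
Lemma pS_lt_spec mu p : 0 <= mu -> pS (3 + mu) < p ->
  1 < p /\ 1 < p * ((mu / 2 + 1) * p - (mu / 2 + 2)).
Proof.
move=> mu0 hp; have n1 : 1 < 3 + mu by lra.
have [q0 gq] := pS_spec n1; set q := pS (3 + mu) in q0 gq hp.
set s := (2 + mu) * q - (4 + mu).
have qs : q * s = 2.
  have -> : q * s = 2 - gammaS q (3 + mu) by rewrite /s /gammaS; ring.
  by rewrite gq subr0.
have s0 : 0 < s by rewrite -(pmulr_rgt0 _ q0) qs.
have ps : s < (2 + mu) * p - (4 + mu) by rewrite /s; nra.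
split; first by nra.
have : q * s < p * ((2 + mu) * p - (4 + mu)) by apply: ltr_pM; lra.
rewrite qs (_ : (2 + mu) * p - (4 + mu) = 2 * ((mu / 2 + 1) * p - (mu / 2 + 2))); last by field.
by rewrite mulrCA; lra.
Qed.

(** The difference of the two sides is (p-1) kappa - 2, whose nonnegativity is the condition p >= 1
    + 2/kappa. *)
Lemma pF_le_spec mu kappa p : 0 <= mu -> mu / 2 < kappa -> pF kappa <= p ->
  (kappa - mu / 2 - 1) + 1 <=
    (kappa - mu / 2 - 1) * p + ((mu / 2 + 1) * p - (mu / 2 + 2)).
Proof.
move=> mu0 hk; have k0 : 0 < kappa by lra.
rewrite /pF -lerBrDl ler_pdivrMr// => h.
rewrite -subr_ge0 (_ : _ - _ = (p - 1) * kappa - 2); last by ring.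
by rewrite subr_ge0.
Qed.

(** Supplies the constant B0 = 2 of the admissible weight. The 2 comes from the logarithmic case:
    Psi <= 1 + ln(1+a) <= 1+a <= 2 <a> with a = t+r. *)
Lemma decay_le2 nu eta (t r : R) : -1 < nu -> 0 < eta -> 0 <= t -> 0 <= r ->
  decay nu eta t r <= 2.
Proof.
move=> nu1 eta0 t0 r0; rewrite /decay.
have j0 := jap_gt0 (t + r).
have jV : (jap (t + r))^-1 <= 1 by rewrite invf_le1// jap_ge1.
case: ltgtP => [nu0|nu0|_].
- by apply: (@le_trans _ _ 1); [apply: powR_le1; [exact: jap_ge1|lra]|lra].
- apply: (@le_trans _ _ (1 * 1)); last lra.
  apply: ler_pM => //; [by rewrite invr_ge0 ltW|exact: powR_ge0|].
  by apply: powR_le1; [exact: jap_ge1|rewrite oppr_le0 le_min ltW//= ltW].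
- rewrite mulrC ler_pdivrMr//.
  have hj := jap_ge (t + r); rewrite ger0_norm ?addr_ge0// in hj.
  apply: le_trans hj; rewrite /Psi lerD2l.
  have n0 := normr_ge0 (t - r).
  apply: (@le_trans _ _ (ln (1 + (t + r)))); last by apply: le_ln1Dx; lra.
  rewrite ler_ln ?posrE ?divr_gt0//; try lra.
  by rewrite ler_pdivrMr; [rewrite ler_peMr|]; lra.
Qed.

End exponents.

Unset Implicit Arguments.

Theorem theorem2p2 (R : realType) (mu kappa p : R) (w f0 f1 : R -> R)
  (hmu : 0 <= mu) (hkappa : mu / 2 < kappa)
  (hw0 : C0_on `[0, +oo[ w) (hw1 : C1_on `]0, +oo[ w)
  (hw : exists (r0 delta C : R) (wt : R -> R),
     [/\ 0 < r0, 0 < delta, 0 < C &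
         forall r, r0 <= r ->
           2 * w r = mu / r + wt r /\ `|wt r| <= C * r `^ (- 1 - delta)])
  (hf0 : C1_on `[0, +oo[ f0) (hf1 : C0_on `[0, +oo[ f1)
  (hf0_decay : forall r, 0 <= r -> `|f0 r| <= jap r `^ (- kappa))
  (hf1_decay : forall r, 0 <= r ->
     `|derive_in `[0, +oo[ f0 r| + `|f1 r| <= jap r `^ (- kappa - 1))
  (hpS : pS (3 + mu) < p) (hpF : pF kappa <= p) :
  let phi := fun r => r * f0 r in
  let psi := fun r => r * f1 r in
  let nu := kappa - mu / 2 - 1 in
  let eta := (mu / 2 + 1) * p - (mu / 2 + 2) in
  exists eps0 C : R, [/\ 0 < eps0, 0 < C &
    forall eps, 0 < eps -> eps <= eps0 ->
      exists u : R -> R -> R,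
        [/\ global_solution w phi psi p eps u,
            decay_bound mu nu eta eps C u &
            forall v : R -> R -> R,
              global_solution w phi psi p eps v ->
              (exists C' : R, 0 < C' /\ decay_bound mu nu eta eps C' v) ->
              forall t r, 0 <= t -> 0 < r -> v t r = u t r]].
Proof.
move=> phi psi nu eta.
have [p1 peta] := pS_lt_spec hmu hpS; rewrite -/eta in peta.
have hnu := pF_le_spec hmu hkappa hpF; rewrite -/nu -/eta in hnu.
have eta0 : 0 < eta by rewrite -(@pmulr_rgt0 _ p); lra.
have nu1 : -1 < nu by rewrite /nu; lra.
have [C1 C10 hC1] := duhamel_weight_le hmu hw0 hw p1 nu1 eta0 peta hnu.
have [C2 C20 hC2] := uL_weight_le hmu hkappa hw0 hw hf0 hf1 hf0_decay hf1_decay eta0.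
have adm : admissible_weight w p (weight mu nu eta) 2 C1.
  split => // [|t r t0 r0]; first exact: measurable_fun_weight.
  rewrite weight_ge0 ?(ltW r0)//= /weight mulrAC [2 * r]mulrC -mulrA ler_pM2l//.
  rewrite -[leRHS]mulr1; apply: ler_pM; rewrite ?powR_ge0 ?decay_ge0 ?decay_le2 ?(ltW r0)//.
  by apply: powR_le1; [exact: jap_ge1|rewrite oppr_le0 divr_ge0].
have [b b0 hb] := data_density_bound hw0 hw hf0 hf0_decay hf1_decay.
have cF : {within `[0, +oo[ `*` `]0, +oo[, continuous
    (fun z : R * R => uL w phi psi z.1 z.2)}.
  apply: (@uL_continuous _ w f0 f1 b hw0 hf0 hf1 (ltW b0)) => y y0.
  apply: (le_trans (hb y y0)); rewrite ler_piMr ?(ltW b0)//.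
  by apply: powR_le1; [rewrite lerDl|rewrite oppr_le0; lra].
have pm1 : 0 < p - 1 by lra.
have Cp0 : 0 < C1 * p by rewrite mulr_gt0//; lra.
have CpV0 : 0 < (C1 * p)^-1 by rewrite invr_gt0.
(* The value at which the smallness condition C1 p (2 C2 eps)^(p-1) <= 1 becomes an equality. *)
pose eps0 := (C1 * p)^-1 `^ (p - 1)^-1 / (2 * C2).
have eps00 : 0 < eps0 by rewrite divr_gt0 ?powR_gt0// mulr_gt0.
exists eps0, (2 * C2); split => //; first by rewrite mulr_gt0.
move=> eps e0 ele.
have small : C1 * p * (2 * C2 * eps) `^ (p - 1) <= 1.
  rewrite -ler_pdivlMl// mulr1.
  have -> : (C1 * p)^-1 = (2 * C2 * eps0) `^ (p - 1).
    rewrite /eps0 [X in X `^ _](_ : _ = (C1 * p)^-1 `^ (p - 1)^-1); last by field; lra.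
    by rewrite -powRrM mulVf ?gt_eqF// powRr1// ltW.
  apply: ge0_ler_powR; rewrite ?nnegrE ?(ltW pm1)//.
  - by rewrite !mulr_ge0 ?(ltW C20) ?(ltW e0).
  - exact: mulr_ge0 (mulr_ge0 (ler0n _ _) (ltW C20)) (ltW eps00).
  - by rewrite ler_pM2l// mulr_gt0.
have [u [cu du equ]] := picard_existence hw0 p1 adm e0 C20 small hC2 cF.
have dom C (x : R -> R -> R) : decay_bound mu nu eta eps C x ->
    dominated (C * eps) (weight mu nu eta) x.
  move=> hx t r t0 r0; apply: (le_trans (hx t r t0 r0)).
  by rewrite /weight le_eqVlt; apply/orP; left; apply/eqP; ring.
exists u; split; first by split.
  move=> t r t0 r0; apply: (le_trans (du t r t0 r0)).
  by rewrite /weight le_eqVlt; apply/orP; left; apply/eqP; ring.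
move=> v [cv eqv] [C' [C'0 hv]] t r t0 r0.
have mono M M' (x : R -> R -> R) : M <= M' -> dominated M (weight mu nu eta) x ->
    dominated M' (weight mu nu eta) x.
  move=> MM hx t' r' t'0 r'0; apply: (le_trans (hx t' r' t'0 r'0)).
  by rewrite ler_wpM2r// weight_ge0 ?(ltW t'0) ?(ltW r'0).
have M1 : 0 <= C' * eps by rewrite mulr_ge0 ?(ltW C'0) ?(ltW e0).
have M2 : 0 <= 2 * C2 * eps by rewrite !mulr_ge0 ?(ltW C20) ?(ltW e0).
(* [picard_uniqueness] compares solutions under one common bound, of any size; the sum of the two
   constants serves both. *)
have dv : dominated (C' * eps + 2 * C2 * eps) (weight mu nu eta) v.
  by apply: mono (dom _ _ hv); rewrite lerDl.
have du' : dominated (C' * eps + 2 * C2 * eps) (weight mu nu eta) u.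
  by apply: mono du; rewrite lerDr.
exact: (@picard_uniqueness _ w p (weight mu nu eta) 2 C1 (C' * eps + 2 * C2 * eps) eps
  (uL w phi psi) v u hw0 p1 (addr_ge0 M1 M2) adm cv cu dv du' eqv equ).
Qed.
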